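(* Let $\Phi(A)=V(A,\dots,A,K_1,\dots,K_{n-m})$ ($A$ repeated $m$ times) be a size functional. Then: (i) for every compact convex sets $A_1,\dots,A_m\subseteq\mathbb{R}^n$, \[ V(A_1,\dots,A_m,K_1,\dots,K_{n-m})\ge V(A_1^\Phi,\dots,A_m^\Phi,K_1,\dots,K_{n-m}); \] (ii) for every $f_1,\dots,f_m\in\mathrm{QC}_0(\mathbb{R}^n)$ with compact level sets, \[ V(f_1,\dots,f_m,\mathbf{1}_{K_1},\dots,\mathbf{1}_{K_{n-m}})\ge V(f_1^\Phi,\dots,f_m^\Phi,\mathbf{1}_{K_1},\dots,\mathbf{1}_{K_{n-m}}). \]
   Context: $V(K_1,\dots,K_n)$ on convex sets is the classical mixed volume. A size functional of degree $m$ is $\Phi(A)=V(A,\dots,A,K_1,\dots,K_{n-m})$ with fixed compact convex $K_1,\dots,K_{n-m}$ having non-empty interior. For compact convex $K$, $K^\Phi=(\Phi(K)/\Phi(D))^{1/m}D$, with $D$ the Euclidean unit ball. $\mathrm{QC}_0(\mathbb{R}^n)$: upper semicontinuous quasi-concave $f:\mathbb{R}^n\to[0,\infty)$ (i.e. $f(\lambda x+(1-\lambda)y)\ge\min\{f(x),f(y)\}$) with $\max f=f(0)=1$. $\overline{K}_t(f)=\{x:f(x)\ge t\}$; compact level sets means these are compact for all $t>0$; then $f^\Phi$ is the function in $\mathrm{QC}_0(\mathbb{R}^n)$ with $\overline{K}_t(f^\Phi)=\overline{K}_t(f)^\Phi$ for all $t>0$. $\mathbf{1}_K$ is the indicator function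 of $K$. For quasi-concave functions $g_1,\dots,g_n$, the mixed integral is $V(g_1,\dots,g_n)=\int_0^\infty V(\overline{K}_t(g_1),\dots,\overline{K}_t(g_n))\,dt$. *)

(* Defs.v *)
From HB Require Import structures.
From mathcomp Require Import all_boot all_order all_algebra.
From mathcomp Require Import all_classical all_reals all_analysis.
Set Implicit Arguments. Unset Strict Implicit. Unset Printing Implicit Defensive.
Import Order.TTheory GRing.Theory Num.Theory.
Import numFieldNormedType.Exports.
Local Open Scope classical_set_scope.
Local Open Scope ring_scope.

Section Defs.
Variable R : realType.

Definition convex_set n (A : set 'rV[R]_n) : Prop :=
  forall x y, A x -> A y -> forall l : R, 0 <= l <= 1 ->
    A (l *: x + (1 - l) *: y).

Definition cc_set n (A : set 'rV[R]_n) : Prop := compact A /\ convex_set A.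

Definition row_cons n (t : R) (v : 'rV[R]_n) : 'rV[R]_n.+1 :=
  \row_(i < n.+1) (if unlift ord0 i is Some j then v ord0 j else t).

(* n-dimensional Lebesgue volume, defined by iterated (Cavalieri/Fubini)
   one-dimensional Lebesgue integration; R^0 is a point. *)
Fixpoint vol (n : nat) : set 'rV[R]_n -> \bar R :=
  match n with
  | 0 => fun A => if `[< A !=set0 >] then 1%E else 0%E
  | n'.+1 => fun A =>
      (\int[@lebesgue_measure R]_(t in [set: R]) vol [set v | A (row_cons t v)])%E
  end.

Definition msum n (S : {set 'I_n}) (K : 'I_n -> set 'rV[R]_n) : set 'rV[R]_n :=
  [set x | exists y : 'I_n -> 'rV[R]_n,
     (forall i, i \in S -> K i (y i)) /\ x = \sum_(i in S) y i].

(* Mixed volume V(K_1,...,K_n) of compact convex sets, via the polarization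
   (inclusion-exclusion) formula
   V(K_1..K_n) = 1/n! sum_{emptyset <> S} (-1)^(n-|S|) vol(sum_{i in S} K_i);
   with the usual convention V = 0 if one of the sets is empty. *)
Definition mixed_volume n (K : 'I_n -> set 'rV[R]_n) : R :=
  if `[< exists i, K i = set0 >] then 0 else
  (n`!%:R)^-1 * \sum_(S : {set 'I_n} | S != finset.set0)
      (-1) ^+ (n - #|S|) * fine (vol (msum S K)).

Definition join_sets n m (A K : nat -> set 'rV[R]_n) : 'I_n -> set 'rV[R]_n :=
  fun i => if (i < m)%N then A i else K (i - m)%N.

Definition size_functional n m (K : nat -> set 'rV[R]_n) (A : set 'rV[R]_n) : R :=
  mixed_volume (join_sets m (fun=> A) K).

Definition euclid_ball n (r : R) : set 'rV[R]_n :=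
  [set x | \sum_(i < n) (x ord0 i) ^+ 2 <= r ^+ 2].

Definition unit_ball n : set 'rV[R]_n := euclid_ball 1.

Definition sym_set n m (K : nat -> set 'rV[R]_n) (A : set 'rV[R]_n) : set 'rV[R]_n :=
  if `[< A = set0 >] then set0 else
  @euclid_ball n ((size_functional m K A / size_functional m K (@unit_ball n))
                    `^ (m%:R^-1)).

Definition level n (f : 'rV[R]_n -> R) (t : R) : set 'rV[R]_n :=
  [set x | t <= f x].

Definition quasi_concave n (f : 'rV[R]_n -> R) : Prop :=
  forall x y (l : R), 0 <= l <= 1 ->
    Num.min (f x) (f y) <= f (l *: x + (1 - l) *: y).

Definition upper_semicontinuous n (f : 'rV[R]_n -> R) : Prop :=
  forall t : R, closed (level f t).

Definition QC0 n (f : 'rV[R]_n -> R) : Prop :=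
  [/\ forall x, 0 <= f x, upper_semicontinuous f, quasi_concave f,
      f 0 = 1 & forall x, f x <= 1].

Definition compact_levels n (f : 'rV[R]_n -> R) : Prop :=
  forall t : R, 0 < t -> compact (level f t).

(* f^Phi : the function in QC_0 whose level sets are K_t(f)^Phi, t > 0,
   i.e. f^Phi(x) = sup {t > 0 | x in K_t(f)^Phi} (0 if there is no such t) *)
Definition sym_fun n m (K : nat -> set 'rV[R]_n) (f : 'rV[R]_n -> R) : 'rV[R]_n -> R :=
  fun x => sup ([set 0] `|` [set t | 0 < t /\ sym_set m K (level f t) x]).

Definition mixed_integral n (g : 'I_n -> 'rV[R]_n -> R) : \bar R :=
  (\int[@lebesgue_measure R]_(t in `[0%R, +oo[)
      (mixed_volume (fun i => level (g i) t))%:E)%E.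

Definition join_funs n m (f g : nat -> 'rV[R]_n -> R) : 'I_n -> 'rV[R]_n -> R :=
  fun i => if (i < m)%N then f i else g (i - m)%N.

End Defs.

(* Main.v *)
(** The heart of the theorem is the Alexandrov-Fenchel inequality.  For simple
    polytopes [{x | <u_j, x> <= h_j}] of one combinatorial type the mixed volume
    is a multilinear form in the support numbers, obtained by eliminating one
    coordinate at a time along flags of faces.  The inequality for these forms
    follows by induction on the dimension, by the Bochner method of Shenfeld and
    van Handel: the planar case is the Brunn-Minkowski inequality, and from the
    inequality on the facets one gets [A^2 >= A] in a weighted inner product for
    the self-adjoint operator [A] representing the form, so that no eigenvalue
    lies strictly between 0 and 1, while connectedness of the facet graph makes
    the top eigenvalue 1 simple.

    Finitely many convex bodies are approximated at once by polytopes of a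
    common simple type.  Each body is replaced by the hull of nearby points of a
    fine grid; the normals are the rays of the arrangement of hyperplanes
    orthogonal to differences of grid points, so that all support functions are
    linear on each cell.  A small multiple of the zonotope of all these
    differences, together with a generic perturbation of the support numbers,
    makes all the polytopes simple of the same type, and a linear map close to
    the identity puts the normals in general position for the elimination.

    Passing to the limit, mixed volumes of bodies are nonnegative, monotone,
    homogeneous, and satisfy [V(A_1, .., A_m, K)^m >= prod_i V(A_i, .., A_i, K)].
    As [A_i^Phi] is a ball whose radius [r_i] satisfies
    [r_i^m Phi(D) = Phi(A_i)], the right-hand side is [V(A_1^Phi, .., A_m^Phi, K)^m].
    For functions this is applied to each level set: by continuity of [Phi] from
    above, the level sets of [f^Phi] are the symmetrizations of those of [f]. *)
Require Import Defs.
From HB Require Import structures.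
From mathcomp Require Import all_boot all_order all_algebra.
From mathcomp Require Import all_classical all_reals all_analysis.
From mathcomp Require Import measurable_realfun ring lra.
Set Implicit Arguments. Unset Strict Implicit. Unset Printing Implicit Defensive.
Import Order.TTheory GRing.Theory Num.Theory.
Import numFieldNormedType.Exports.
Local Open Scope classical_set_scope.
Local Open Scope ring_scope.

(** * Row vectors and decreasing sequences of compact sets *)

Section RowVectors.
Variable R : realType.

(** The volume is an iterated integral along the axes, and this shapes the polytope part. Facets are
    not measured in their own hyperplanes: a facet is projected along the first axis, which shrinks
    its area by [|hd u_i| / |u_i|], so the derivative of the volume in the support number [h_i] is
    the volume of the projection divided by [|hd u_i|]. Iterated, this gives [mvform] without square
    roots or orthonormal frames. The price is that no non-zero normal met on the way may have a
    vanishing first coordinate; hence [gen_pos] and the final linear map. The polarization formula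
    displays neither positivity nor monotonicity. Both are read off from [mvform], which describes
    volumes only while the combinatorial type is frozen; it is frozen on a convex set of support
    vectors none of which has an excess tight constraint. Quotients and minimisers need strictly
    positive forms, whereas limits of polytopes are only known to be non-negative. So the
    inequalities that divide are settled on polytopes, and a product form of them passes to the
    limit. *)

Lemma rV_norm_leP n (x : 'rV[R]_n) (e : R) : 0 <= e ->
  (`|x| <= e) <-> (forall i, `|x ord0 i| <= e).
Proof.
move=> e0; rewrite [`|x|]/Num.Def.normr /= mx_normrE; split.
  move=> /bigmax_leP[_ H] i; exact: (H (ord0, i)).
by move=> H; apply/bigmax_leP; split=> // -[i j] _ /=; rewrite (ord1 i).
Qed.

Lemma rV_coord_le n (x : 'rV[R]_n) i : `|x ord0 i| <= `|x|.
Proof. exact: (proj1 (rV_norm_leP x (normr_ge0 _)) (lexx _)). Qed.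

Lemma rV_continuous (T : topologicalType) n (f : T -> 'rV[R]_n) :
  (forall i, continuous (fun x => f x ord0 i)) -> continuous f.
Proof.
move=> H x; apply/cvgrPdist_le => e e0.
have : \forall t \near x, forall i, `|f x ord0 i - f t ord0 i| <= e.
  by apply: filter_forall => i; move: (H i x) => /cvgrPdist_le; apply.
apply: filterS => t Ht; apply/rV_norm_leP; first exact: ltW.
by move=> i; rewrite !mxE.
Qed.

Lemma rV_coord_continuous n (i : 'I_n) :
  continuous (fun x : 'rV[R]_n => x ord0 i).
Proof. exact: coord_continuous. Qed.

Definition hd n (x : 'rV[R]_n.+1) : R := x ord0 ord0.
Definition tl n (x : 'rV[R]_n.+1) : 'rV[R]_n := \row_j x ord0 (lift ord0 j).

Lemma hd_cons n t (v : 'rV[R]_n) : hd (row_cons t v) = t.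
Proof. by rewrite /hd mxE unlift_none. Qed.

Lemma row_cons_lift n t (v : 'rV[R]_n) j : row_cons t v ord0 (lift ord0 j) = v ord0 j.
Proof. by rewrite mxE liftK. Qed.

Lemma tl_cons n t (v : 'rV[R]_n) : tl (row_cons t v) = v.
Proof. by apply/rowP => j; rewrite mxE row_cons_lift. Qed.

Lemma cons_hd_tl n (x : 'rV[R]_n.+1) : row_cons (hd x) (tl x) = x.
Proof.
by apply/rowP => j; case: (unliftP ord0 j) => [k|] ->; rewrite ?row_cons_lift ?mxE ?unlift_none.
Qed.

Lemma hd_continuous n : continuous (@hd n).
Proof. exact: rV_coord_continuous. Qed.

Lemma tl_continuous n : continuous (@tl n).
Proof.
apply: rV_continuous => i; rewrite (_ : (fun _ => _) = fun x : 'rV_ _ => x ord0 (lift ord0 i)).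
  exact: rV_coord_continuous.
by apply/funext => x; rewrite mxE.
Qed.

Lemma continuous_compact_image (T U : topologicalType) (f : T -> U) A :
  continuous f -> compact A -> compact (f @` A).
Proof. move=> cf; apply: continuous_compact; exact: continuous_subspaceT. Qed.

Lemma nonincreasing_sets (T : Type) (A : nat -> set T) :
  (forall k, A k.+1 `<=` A k) -> forall k l, (k <= l)%N -> A l `<=` A k.
Proof.
move=> dA k l; elim: l => [|l IH]; first by rewrite leqn0 => /eqP ->.
rewrite leq_eqVlt => /orP[/eqP -> //|]; rewrite ltnS => /IH; apply: subset_trans; exact: dA.
Qed.

Lemma compact_decreasing_nonempty (T : ptopologicalType) (A : nat -> set T) :
  hausdorff_space T -> (forall k, compact (A k)) -> (forall k, A k.+1 `<=` A k) ->
  (forall k, A k !=set0) -> \bigcap_k A k !=set0.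
Proof.
move=> hT cA dA nA.
have := cA 0%N; rewrite compact_In0 => /(_ nat setT A); apply.
  exists A; first by move=> i _; exact: compact_closed.
  by move=> i _; apply/seteqP; split=> [x Ax|x []//]; split=> //; apply: (nonincreasing_sets dA (leq0n i)).
move=> D' _; have [x Ax] := nA (\max_(i <- finmap.enum_fset D') i)%N.
exists x => i iD; apply: (nonincreasing_sets dA _ Ax).
exact: (@leq_bigmax_seq _ _ xpredT (fun i => i)).
Qed.

(** Over a point of the right-hand side the fibres in the [A k] are decreasing non-empty compact
    sets, hence share a point. *)
Lemma image_bigcap_compact (T : ptopologicalType) (U : topologicalType) (f : T -> U) (A : nat -> set T) :
  hausdorff_space T -> hausdorff_space U -> continuous f ->
  (forall k, compact (A k)) -> (forall k, A k.+1 `<=` A k) ->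
  f @` (\bigcap_k A k) = \bigcap_k (f @` A k).
Proof.
move=> hT hU cf cA dA; apply/seteqP; split.
  by move=> _ [x Ax <-] k _; exists x => //; exact: Ax.
move=> y Ay.
have [x Hx] : \bigcap_k (A k `&` f @^-1` [set y]) !=set0.
  apply: compact_decreasing_nonempty => //.
  - move=> k; apply: compact_closedI => //; apply: closed_comp; first by move=> *; exact: cf.
    by apply: compact_closed => //; exact: compact_set1.
  - by move=> k x [Ax fx]; split=> //; exact: dA.
  - by move=> k; have [x Ax fx] := Ay k I; exists x.
exists x; first by move=> k _; exact: (Hx k I).1.
exact: (Hx 0%N I).2.
Qed.

End RowVectors.

(** * One-dimensional integrals: monotonicity and affine substitution *)

Section Integrals.
Variable R : realType.
Local Open Scope ereal_scope.
Notation mu := (@lebesgue_measure R).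
Import HBNNSimple.

(** The integral of a non-negative function is a supremum over the simple functions below it, and
    enlarging the function enlarges that family. This makes [vol] monotone on arbitrary sets. *)
Lemma le_integralT (d : measure_display) (T : measurableType d)
    (m : {measure set T -> \bar R}) (f g : T -> \bar R) :
  (forall x, 0 <= f x) -> (forall x, f x <= g x) ->
  \int[m]_x f x <= \int[m]_x g x.
Proof.
move=> f0 fg; have g0 x : 0 <= g x by exact: le_trans (fg x).
rewrite !ge0_integralTE//; apply: ereal_sup_le => _ [h Hh <-].
by exists h => // x; exact: le_trans (fg x).
Qed.

Lemma measurable_usc (d : measure_display) (T : measurableType d) (f : T -> \bar R) :
  (forall c : R, measurable [set x | f x < c%:E]) -> measurable_fun setT f.
Proof.
move=> H; apply: (measurability _ (ErealGenCInfty.measurableE R)) => //.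
move=> _ [_ [c ->] <-]; rewrite setTI.
rewrite (_ : _ @^-1` _ = ~` [set x | f x < c%:E]); first exact: measurableC.
by apply/seteqP; split=> x /=; rewrite in_itv /= andbT leNgt; move/negP.
Qed.

Lemma measurable_affine (a b : R) : measurable_fun setT (fun x : measurableTypeR R => (a * x + b)%R : measurableTypeR R).
Proof. by apply: measurable_funD => //; exact: measurable_funM. Qed.

(** The push-forward of Lebesgue measure under the affine map, scaled by [|a|], gives half-open
    intervals their length, so it is Lebesgue measure by uniqueness. For [a < 0] the preimage of
    []s, t]] is open at the other end, hence the two cases. *)
Lemma integral_affine (a b : R) (f : R -> \bar R) : (a != 0)%R ->
  measurable_fun setT f -> (forall x, 0 <= f x) ->
  \int[mu]_x f (a * x + b)%R = (`|a|^-1)%:E * \int[mu]_x f x.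
Proof.
move=> a0 mf f0.
pose phi := (fun x : measurableTypeR R => (a * x + b)%R : measurableTypeR R).
have mphi : measurable_fun setT phi := measurable_affine a b.
have a1 : (0 <= `|a|)%R by [].
pose nu := mscale (NngNum a1) (pushforward mu phi).
have mf' : measurable_fun (setT : set (measurableTypeR R)) f by [].
have E : \int[mu]_x f x = \int[nu mphi]_x f x.
  apply: eq_measure_integral => A mA _; apply: lebesgue_measure_unique => // X [[s t] st <-] /=.
  rewrite /nu /mscale /= /pushforward lebesgue_measure_itv/=.
  have [an|ap|a00] := ltgtP a 0%R; last by rewrite a00 eqxx in a0.
    rewrite (_ : phi @^-1` _ = [set` `[(t - b) / a, (s - b) / a[]%R); last first.
      apply/seteqP; split=> x /=; rewrite !in_itv/= /phi ler_ndivrMr// ltr_ndivlMr// [(x * a)%R]mulrC;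
       by rewrite lerBrDr ltrBlDr andbC.
    rewrite lebesgue_measure_itv/= !lte_fin ltr_nM2r ?invr_lt0// ltrBlDr subrK.
    case: ifP => _; rewrite ?mule0// -!EFinB -EFinM; congr (_%:E); rewrite ltr0_norm//; field.
    by rewrite lt_eqF.
  rewrite (_ : phi @^-1` _ = [set` `](s - b) / a, (t - b) / a]]%R); last first.
    apply/seteqP; split=> x /=; rewrite !in_itv/= /phi ler_pdivlMr// ltr_pdivrMr// [(x * a)%R]mulrC;
     by rewrite ltrBlDr lerBrDr.
  rewrite lebesgue_measure_itv/= !lte_fin ltr_pM2r ?invr_gt0// ltrBlDr subrK.
  case: ifP => _; rewrite ?mule0// -!EFinB -EFinM; congr (_%:E); rewrite gtr0_norm//; field.
  by rewrite gt_eqF.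
rewrite E /nu ge0_integral_mscale// ge0_integral_pushforward//= muleA -EFinM mulVf ?normr_eq0// mul1e.
by rewrite preimage_setT.
Qed.

Lemma integral_shift (b : R) (f : R -> \bar R) :
  measurable_fun setT f -> (forall x, 0 <= f x) ->
  \int[mu]_x f (x + b)%R = \int[mu]_x f x.
Proof.
move=> mf f0; have := integral_affine b (oner_neq0 _) mf f0; rewrite normr1 invr1 mul1e => <-.
by apply: eq_integral => x _; rewrite mul1r.
Qed.

End Integrals.

(** * Volume by iterated integration: finiteness, continuity from above, shears *)

Section Volume.
Variable R : realType.
Notation mu := (@lebesgue_measure R).

Definition slice n (A : set 'rV[R]_n.+1) (t : R) : set 'rV[R]_n :=
  [set v | A (row_cons t v)].

Lemma volS n (A : set 'rV[R]_n.+1) : vol A = (\int[mu]_t vol (slice A t))%E.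
Proof. by []. Qed.

Lemma vol_ge0 n (A : set 'rV[R]_n) : (0 <= vol A)%E.
Proof.
elim: n A => [|n IH] A; first by rewrite /=; case: ifP.
by rewrite volS; apply: integral_ge0.
Qed.

Lemma vol_le n (A B : set 'rV[R]_n) : A `<=` B -> (vol A <= vol B)%E.
Proof.
elim: n A B => [|n IH] A B AB.
  rewrite /=; case: asboolP => [[x Ax]|_]; last by case: ifP.
  by case: asboolP => // -[]; exists x; apply: AB.
rewrite !volS; apply: le_integralT => [t|t]; first exact: vol_ge0.
by apply: IH => v; apply: AB.
Qed.

Lemma vol_set0 n : vol (set0 : set 'rV[R]_n) = 0%E.
Proof.
elim: n => [|n IH]; first by rewrite /=; case: asboolP => // -[].
by rewrite volS integral0_eq// => t _; rewrite (_ : slice _ _ = set0).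
Qed.

Lemma sliceE n (A : set 'rV[R]_n.+1) t :
  slice A t = @tl R n @` (A `&` @hd R n @^-1` [set t]).
Proof.
apply/seteqP; split=> [v Av|_ [x [Ax /= <-]] <-]; last by rewrite /slice /= cons_hd_tl.
by exists (row_cons t v); rewrite ?tl_cons//; split=> //=; rewrite hd_cons.
Qed.

Lemma closed_set1R (x : R) : closed [set x].
Proof. apply: compact_closed; [exact: norm_hausdorff|exact: compact_set1]. Qed.

Lemma slice_compact n (A : set 'rV[R]_n.+1) t : compact A -> compact (slice A t).
Proof.
move=> cA; rewrite sliceE; apply: continuous_compact_image; first exact: tl_continuous.
apply: compact_closedI => //; apply: closed_comp; last exact: closed_set1R.
by move=> *; exact: hd_continuous.
Qed.

Let vol_fin n := forall A : set 'rV[R]_n, compact A -> (vol A < +oo)%E.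
(** Continuity from above along compact sets. It is proved together with finiteness by induction on
    the dimension: in dimension [n] it yields the measurability of [t |-> vol (slice A t)] for [A]
    of dimension [n + 1], which dominated convergence then requires. *)
Let vol_cfa n := forall A : nat -> set 'rV[R]_n, (forall k, compact (A k)) ->
  (forall k, A k.+1 `<=` A k) -> forall c : R,
  (vol (\bigcap_k A k) < c%:E)%E -> exists k, (vol (A k) < c%:E)%E.

Let closed_normball (X : normedModType R) (x : X) r : closed [set y | `|x - y| <= r].
Proof.
rewrite (_ : [set _ | _] = (fun y => `|x - y|) @^-1` [set z | z <= r]) //.
apply: closed_comp; last exact: closed_le.
move=> y _; apply: cvg_norm; apply: cvgB; [exact: cvg_cst | exact: cvg_id].
Qed.

(** The fibre over [x] is the decreasing intersection of the parts of [A] over closed balls of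
    radius [e k]. By continuity from above one of these parts is already smaller than [c], and it
    contains all fibres over a neighbourhood of [x]. *)
Let usc_open n (X : normedModType R) m (A : set 'rV[R]_m) (p : 'rV[R]_m -> X)
    (q : 'rV[R]_m -> 'rV[R]_n) (c : R) : vol_cfa n -> compact A ->
  continuous p -> continuous q ->
  open [set x | (vol (q @` (A `&` p @^-1` [set x])) < c%:E)%E].
Proof.
move=> H cA cp cq; rewrite openE => x /= Hx.
pose e k : R := k.+1%:R^-1.
pose B k := q @` (A `&` p @^-1` [set y | `|x - y| <= e k]).
have cAk k : compact (A `&` p @^-1` [set y | `|x - y| <= e k]).
  apply: compact_closedI => //; apply: closed_comp; last exact: closed_normball.
  by move=> *; exact: cp.
have dAk k : A `&` p @^-1` [set y | `|x - y| <= e k.+1] `<=` A `&` p @^-1` [set y | `|x - y| <= e k].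
  move=> y [Ay /= Hy]; split=> //=; apply: le_trans Hy _; rewrite /e lef_pV2 ?posrE//.
  by rewrite ler_nat.
have E : \bigcap_k B k = q @` (A `&` p @^-1` [set x]).
  rewrite /B -image_bigcap_compact//; try exact: norm_hausdorff.
  congr (q @` _); apply/seteqP; split=> [y Hy|y [Ay /= <-] k _]; last by split=> //; rewrite /= subrr normr0 /e invr_ge0.
  split; first exact: (Hy 0%N I).1.
  rewrite /=; apply/esym/eqP; rewrite -subr_eq0 -normr_le0; apply/ler_addgt0Pr => eps eps0.
  have [k Hk] := ltr_add_invr eps0; rewrite add0r in Hk; rewrite add0r; apply: le_trans (ltW Hk).
  exact: (Hy k I).2.
have [k Hk] : exists k, (vol (B k) < c%:E)%E.
  apply: H; last by rewrite E.
  - by move=> k; exact: continuous_compact_image.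
  - by move=> k y [z Hz <-]; exists z => //; exact: dAk.
apply/nbhs_ballP; exists (e k) => /=; first by rewrite /e invr_gt0.
move=> y; rewrite -ball_normE /= => Hy; apply: le_lt_trans Hk; apply: vol_le.
by move=> _ [z [Az /= pz] <-]; exists z => //; split=> //=; rewrite pz; exact: ltW.
Qed.

Let vol_slice_measurable_of n (A : set 'rV[R]_n.+1) : vol_cfa n -> compact A ->
  measurable_fun setT (fun t => vol (slice A t)).
Proof.
move=> H cA; apply: measurable_usc => c; apply: open_measurable.
rewrite (_ : [set _ | _] = [set x | (vol (@tl R n @` (A `&` @hd R n @^-1` [set x])) < c%:E)%E]).
  by apply: usc_open => //; [exact: hd_continuous|exact: tl_continuous].
by apply/funext => t; rewrite /= -sliceE.
Qed.

Let vol_fin_cfa n : vol_fin n /\ vol_cfa n.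
Proof.
elim: n => [|n [IHf IHc]].
  split; first by move=> A _ /=; case: ifP; rewrite ?ltry// lt0y.
  move=> A cA dA c; have [[x Hx]|H] := pselect (\bigcap_k A k !=set0).
    rewrite /=; case: asboolP => [_ H|[]]; last by exists x.
    by exists 0%N; case: ifP => // _; apply: le_lt_trans H; rewrite lee_fin.
  move=> Hc; have [k Hk] : exists k, ~ (A k !=set0).
    apply: contrapT => Hk; apply: H; apply: compact_decreasing_nonempty => //.
    by move=> k; apply: contrapT => HH; apply: Hk; exists k.
  by exists k; move: Hc; rewrite /=; case: asboolP => // _; case: asboolP.
have Hf : vol_fin n.+1.
  move=> A cA; have [r [_ Hr]] := compact_bounded cA.
  have {}Hr x : A x -> `|x| <= r + 1 by move=> Ax; apply: Hr => //; rewrite ltrDl.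
  pose C := vol (@tl R n @` A).
  have Cf : (C < +oo)%E by apply: IHf; apply: continuous_compact_image => //; exact: tl_continuous.
  have C0 : (0 <= C)%E := vol_ge0 _.
  pose g := (cst C \_ `[- (r + 1), r + 1]) : R -> \bar R.
  apply: (@le_lt_trans _ _ (\int[mu]_t g t)%E).
    rewrite volS; apply: le_integralT => t; first exact: vol_ge0.
    rewrite /g patchE; case: ifPn => [_|]; first by apply: vol_le; rewrite sliceE; apply: image_subset => x [].
    rewrite notin_setE /= in_itv /= => H; rewrite (_ : slice A t = set0) ?vol_set0//.
    apply/seteqP; split=> // v /= /Hr Hv; apply: H; rewrite -ler_norml.
    by apply: le_trans Hv; rewrite -[X in `|X|](hd_cons t v); exact: rV_coord_le.
  rewrite /g -integral_mkcond integral_cst//= lebesgue_measure_itv/= lte_fin.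
  case: ifP => _; last by rewrite mule0 ltry.
  by rewrite -EFinB lte_mul_pinfty// ?ge0_fin_numE ?ltry.
split=> // A cA dA c Hc.
pose f_ k t := vol (slice (A k) t); pose f t := vol (slice (\bigcap_k A k) t).
have cAI : compact (\bigcap_k A k).
  apply: (subclosed_compact _ (cA 0%N)); last by move=> x /(_ 0%N); apply.
  by apply: closed_bigI => k _; apply: compact_closed => //; exact: norm_hausdorff.
have mf_ k : measurable_fun setT (f_ k) by exact: vol_slice_measurable_of.
have mf : measurable_fun setT f by exact: vol_slice_measurable_of.
have sl t : slice (\bigcap_k A k) t = \bigcap_k slice (A k) t by [].
have cv t : f_ ^~ t @ \oo --> f t.
  have dec : nonincreasing_seq (f_ ^~ t).
    by move=> k l kl; apply: vol_le => v; exact: (nonincreasing_sets dA kl).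
  rewrite (_ : f t = ereal_inf (range (f_ ^~ t))); first exact: ereal_nonincreasing_cvgn.
  apply/le_anti/andP; split.
    by apply: le_ereal_inf_tmp => _ [k _ <-]; apply: vol_le => v; apply.
  have ff : (f t < +oo)%E by apply: IHf; exact: slice_compact.
  have f0 : (0 <= f t)%E := vol_ge0 _.
  move E : (f t) ff f0 => [s| |] // _ _.
  apply/lee_addgt0Pr => eps eps0.
  have [k Hk] : exists k, (vol (slice (A k) t) < (s + eps)%:E)%E.
    apply: IHc; first by move=> k; exact: slice_compact.
      by move=> k v; exact: dA.
    by rewrite -sl -/(f t) E lte_fin ltrDl.
  by apply: le_trans (ltW Hk); apply: ereal_inf_lbound; exists k.
have ig : mu.-integrable setT (f_ 0%N).
  apply/integrableP; split; first exact: mf_.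
  under eq_integral => t _ do rewrite gee0_abs ?vol_ge0//.
  exact: Hf.
have ae1 : \forall t \ae mu, setT t -> f_ ^~ t @ \oo --> f t by apply: aeW => t _; exact: cv.
have ae2 : \forall t \ae mu, forall k, setT t -> (`|f_ k t| <= f_ 0%N t)%E.
  apply: aeW => t k _; rewrite gee0_abs ?vol_ge0//; apply: vol_le => v.
  exact: (nonincreasing_sets dA (leq0n k)).
have [_ _] := @dominated_convergence _ (measurableTypeR R) R mu setT measurableT f_ f (f_ 0%N)
  mf_ mf ae1 ig ae2.
have nn : nonincreasing_seq (fun k => vol (A k)).
  by move=> k l kl; apply: vol_le; exact: (nonincreasing_sets dA kl).
move=> /cvg_lim; rewrite (cvg_lim _ (ereal_nonincreasing_cvgn nn)) // => /(_ (@ereal_hausdorff _)) E.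
move: Hc; rewrite volS -/f -E => /ereal_inf_lt[_ [k _ <-] Hk].
by exists k.
Qed.

Lemma vol_lty n (A : set 'rV[R]_n) : compact A -> (vol A < +oo)%E.
Proof. exact: (vol_fin_cfa n).1. Qed.

Lemma vol_fin_num n (A : set 'rV[R]_n) : compact A -> vol A \is a fin_num.
Proof. by move=> cA; rewrite ge0_fin_numE ?vol_ge0 ?vol_lty. Qed.

Lemma vol_decreasing n (A : nat -> set 'rV[R]_n) (c : R) :
  (forall k, compact (A k)) -> (forall k, A k.+1 `<=` A k) ->
  (vol (\bigcap_k A k) < c%:E)%E -> exists k, (vol (A k) < c%:E)%E.
Proof. by move=> cA dA; apply: (vol_fin_cfa n).2. Qed.

Lemma vol_slice_measurable n (A : set 'rV[R]_n.+1) : compact A ->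
  measurable_fun setT (fun t => vol (slice A t)).
Proof. exact: vol_slice_measurable_of (vol_fin_cfa n).2. Qed.

Lemma vol_slice_usc n (A : set 'rV[R]_n.+1) (c : R) : compact A ->
  open [set t | (vol (slice A t) < c%:E)%E].
Proof.
move=> cA; rewrite (_ : [set _ | _] = [set x | (vol (@tl R n @` (A `&` @hd R n @^-1` [set x])) < c%:E)%E]).
  by apply: usc_open => //; [exact: (vol_fin_cfa n).2|exact: hd_continuous|exact: tl_continuous].
by apply/funext => t; rewrite /= -sliceE.
Qed.

(** An open set is the countable union of the rational squares that it contains. *)
Lemma open_measurable2 (O : set (R * R)) : open O -> measurable O.
Proof.
move=> oO.
pose B (x : rat * rat * nat) : set (R * R) :=
  [set y | `|ratr x.1.1 - y.1| < x.2.+1%:R^-1] `&` [set y | `|ratr x.1.2 - y.2| < x.2.+1%:R^-1].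
rewrite (_ : O = \bigcup_(x in [set x | B x `<=` O]) B x); last first.
  apply/seteqP; split=> [y Oy|y [x /= Hx Bx]]; last exact: Hx.
  have /nbhs_ballP[e /= e0 He] : nbhs y O by exact: open_nbhs_nbhs.
  have e20 : 0 < e / 2 by lra.
  have [k Hk] := ltr_add_invr e20; rewrite add0r in Hk.
  have k0 : (0 : R) < k.+1%:R^-1 by rewrite invr_gt0.
  set dk : R := k.+1%:R^-1 in Hk k0.
  have rk (z : R) : exists q : rat, `|ratr q - z| < dk.
    have : z - dk < z + dk by lra.
    move=> /rat_in_itvoo[q]; rewrite in_itv /= => /andP[q1 q2]; exists q.
    rewrite ltr_norml; apply/andP; split; lra.
  have [q1 Hq1] := rk y.1; have [q2 Hq2] := rk y.2.
  exists (q1, q2, k); last by [].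
  move=> z [/=]; rewrite -/dk => Hz1 Hz2; apply: He; split=> /=.
    rewrite /ball /= ; move: Hz1 Hq1; rewrite !ltr_norml => /andP[? ?] /andP[? ?]; apply/andP; split; lra.
  rewrite /ball /= ; move: Hz2 Hq2; rewrite !ltr_norml => /andP[? ?] /andP[? ?]; apply/andP; split; lra.
rewrite bigcup_mkcond; apply: countable_bigcupT_measurable => // -[[q1 q2] k]; case: ifP => // _; apply: measurableI.
  rewrite (_ : [set _ | _] = fst @^-1` [set z | `|ratr q1 - z| < k.+1%:R^-1])//.
  rewrite -[X in measurable X]setTI; apply: measurable_fst => //; apply: open_measurable.
  rewrite (_ : [set _ | _] = ball (ratr q1 : R) k.+1%:R^-1) //; exact: ball_open.
rewrite (_ : [set _ | _] = snd @^-1` [set z | `|ratr q2 - z| < k.+1%:R^-1])//.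
rewrite -[X in measurable X]setTI; apply: measurable_snd => //; apply: open_measurable.
rewrite (_ : [set _ | _] = ball (ratr q2 : R) k.+1%:R^-1) //; exact: ball_open.
Qed.

Lemma vol_slice2_measurable n (A : set 'rV[R]_n.+2) : compact A ->
  measurable_fun setT (fun z : R * R => vol (slice (slice A z.1) z.2)).
Proof.
move=> cA; apply: measurable_usc => c; apply: open_measurable2.
pose p (x : 'rV[R]_n.+2) := (hd x, hd (tl x)).
rewrite (_ : [set _ | _] = [set z | (vol ((@tl R n \o @tl R n.+1) @` (A `&` p @^-1` [set z])) < c%:E)%E]).
  apply: (@usc_open n (R * R)%type _ A p (@tl R n \o @tl R n.+1) c (vol_fin_cfa n).2) => //.
    move=> x; have H1 : hd y @[y --> x] --> hd x by exact: hd_continuous.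
    have H2 : hd (tl y) @[y --> x] --> hd (tl x).
      by apply: (@continuous_comp _ _ _ (@tl R n.+1) (@hd R n)); [exact: tl_continuous|exact: hd_continuous].
    exact: cvg_pair H1 H2.
  by move=> x; apply: continuous_comp; exact: tl_continuous.
apply/funext => z /=; congr (vol _ < _)%E; apply/seteqP; split.
  move=> v Av; exists (row_cons z.1 (row_cons z.2 v)); last by rewrite /= !tl_cons.
  by split=> //=; rewrite /p !tl_cons !hd_cons -surjective_pairing.
move=> _ [x [Ax /= <-] <-]; by rewrite /slice /= !cons_hd_tl.
Qed.

Lemma vol_swap n (A : set 'rV[R]_n.+2) : compact A ->
  vol A = (\int[mu]_s \int[mu]_t vol (slice (slice A t) s))%E.
Proof.
move=> cA; rewrite volS.
exact: (@fubini_tonelli _ _ (measurableTypeR R) (measurableTypeR R) R mu mu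
  (fun z : R * R => vol (slice (slice A z.1) z.2)) (vol_slice2_measurable cA) (fun z => vol_ge0 _)).
Qed.

Lemma hdZ n (a : R) (x : 'rV[R]_n.+1) : hd (a *: x) = a * hd x.
Proof. by rewrite /hd mxE. Qed.

Lemma tlZ n (a : R) (x : 'rV[R]_n.+1) : tl (a *: x) = a *: tl x.
Proof. by apply/rowP => j; rewrite !mxE. Qed.

Lemma hdD n (x y : 'rV[R]_n.+1) : hd (x + y) = hd x + hd y.
Proof. by rewrite /hd mxE. Qed.

Lemma tlD n (x y : 'rV[R]_n.+1) : tl (x + y) = tl x + tl y.
Proof. by apply/rowP => j; rewrite !mxE. Qed.

Lemma row_consZ n (a t : R) (v : 'rV[R]_n) : a *: row_cons t v = row_cons (a * t) (a *: v).
Proof. by rewrite -[LHS]cons_hd_tl hdZ tlZ hd_cons tl_cons. Qed.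

Lemma row_consD n (s t : R) (v w : 'rV[R]_n) :
  row_cons s v + row_cons t w = row_cons (s + t) (v + w).
Proof. by rewrite -[LHS]cons_hd_tl hdD tlD !hd_cons !tl_cons. Qed.

Lemma vol_scale n (a : R) (A : set 'rV[R]_n) : 0 < a -> compact A ->
  vol [set x | A (a *: x)] = ((a ^+ n)^-1%:E * vol A)%E.
Proof.
move=> a0; elim: n A => [|n IH] A cA.
  rewrite expr0 invr1 mul1e /=; congr (if _ then _ else _); apply: asbool_equiv_eq.
  by split=> -[x Ax]; exists x; move: Ax => /=; rewrite ?(thinmx0 x) ?scaler0.
rewrite volS.
transitivity (\int[mu]_t ((a ^+ n)^-1%:E * vol (slice A (a * t))))%E.
  apply: eq_integral => t _; rewrite -IH; last exact: slice_compact.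
  by congr vol; apply/funext => v; rewrite /slice /= row_consZ.
have mA := vol_slice_measurable cA.
have mf : measurable_fun setT (fun t => vol (slice A (a * t))).
  apply: (measurableT_comp mA); exact: measurable_funM.
rewrite ge0_integralZl//; last 2 first.
  - by move=> t _; exact: vol_ge0.
  - by rewrite lee_fin invr_ge0 exprn_ge0// ltW.
have -> : (\int[mu]_t vol (slice A (a * t)) = (a^-1)%:E * vol A)%E.
  have := integral_affine 0 (lt0r_neq0 a0) mA (fun t => vol_ge0 _).
  rewrite gtr0_norm// volS => <-.
  by apply: eq_integral => t _; rewrite addr0.
rewrite muleA -EFinM; congr (_%:E * _)%E.
by rewrite exprS invfM mulrC.
Qed.

Definition dotp n (u v : 'rV[R]_n) : R := \sum_(i < n) u ord0 i * v ord0 i.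

Lemma dotp_cons n (u : 'rV[R]_n.+1) t (v : 'rV[R]_n) :
  dotp u (row_cons t v) = hd u * t + dotp (tl u) v.
Proof.
rewrite /dotp big_ord_recl -[row_cons t v ord0 ord0]/(hd (row_cons t v)) hd_cons; congr (_ + _).
by apply: eq_bigr => j _; rewrite row_cons_lift mxE.
Qed.

Lemma row_cons0 n t (v : 'rV[R]_n) : row_cons t v ord0 ord0 = t.
Proof. exact: hd_cons. Qed.

Lemma dotpZl n a (u v : 'rV[R]_n) : dotp (a *: u) v = a * dotp u v.
Proof. by rewrite /dotp mulr_sumr; apply: eq_bigr => i _; rewrite mxE mulrA. Qed.

Lemma dotpC n (u v : 'rV[R]_n) : dotp u v = dotp v u.
Proof. by apply: eq_bigr => i _; rewrite mulrC. Qed.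

Lemma dotpZr n a (u v : 'rV[R]_n) : dotp u (a *: v) = a * dotp u v.
Proof. by rewrite dotpC dotpZl dotpC. Qed.

Lemma dotpDl n (u v w : 'rV[R]_n) : dotp (u + v) w = dotp u w + dotp v w.
Proof. by rewrite /dotp -big_split; apply: eq_bigr => i _; rewrite mxE mulrDl. Qed.

Lemma dotpDr n (u v w : 'rV[R]_n) : dotp u (v + w) = dotp u v + dotp u w.
Proof. by rewrite dotpC dotpDl !(dotpC u). Qed.

Lemma dotpNl n (u v : 'rV[R]_n) : dotp (- u) v = - dotp u v.
Proof. by rewrite -scaleN1r dotpZl mulN1r. Qed.

Lemma dotpNr n (u v : 'rV[R]_n) : dotp u (- v) = - dotp u v.
Proof. by rewrite dotpC dotpNl dotpC. Qed.

Lemma dotpBl n (u v w : 'rV[R]_n) : dotp (u - v) w = dotp u w - dotp v w.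
Proof. by rewrite dotpDl dotpNl. Qed.

Lemma dotpBr n (u v w : 'rV[R]_n) : dotp u (v - w) = dotp u v - dotp u w.
Proof. by rewrite dotpDr dotpNr. Qed.

Lemma dotp0l n (v : 'rV[R]_n) : dotp 0 v = 0.
Proof. by rewrite -(scale0r 0) dotpZl mul0r. Qed.

Lemma dotp0r n (v : 'rV[R]_n) : dotp v 0 = 0.
Proof. by rewrite dotpC dotp0l. Qed.

Lemma dotp_suml n I (r : seq I) P (F : I -> 'rV[R]_n) v :
  dotp (\sum_(i <- r | P i) F i) v = \sum_(i <- r | P i) dotp (F i) v.
Proof. by rewrite (big_morph (fun x => dotp x v) (fun x y => @dotpDl _ x y v) (dotp0l v)). Qed.

Lemma dotp_sumr n I (r : seq I) P (F : I -> 'rV[R]_n) v :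
  dotp v (\sum_(i <- r | P i) F i) = \sum_(i <- r | P i) dotp v (F i).
Proof. by rewrite (big_morph (dotp v) (@dotpDr _ v) (dotp0r v)). Qed.

Lemma continuous_sum (T : topologicalType) I (r : seq I) (F : I -> T -> R) :
  (forall i, continuous (F i)) -> continuous (fun x => \sum_(i <- r) F i x).
Proof.
move=> cF; elim: r => [|i r IH] x.
  by under eq_fun do rewrite big_nil; exact: cvg_cst.
by under eq_fun do rewrite big_cons; apply: cvgD; [exact: cF|exact: IH].
Qed.

Lemma dotp_continuous n (u : 'rV[R]_n) : continuous (dotp u).
Proof.
apply: continuous_sum => i x.
by apply: (@continuousM _ _ (fun=> u ord0 i) (fun x : 'rV[R]_n => x ord0 i)); [exact: cst_continuous|exact: rV_coord_continuous].
Qed.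

Lemma shear_compact n (A : set 'rV[R]_n.+1) (b : 'rV[R]_n) (c : R) : compact A ->
  compact [set x | A (row_cons (hd x + dotp b (tl x) + c) (tl x))].
Proof.
move=> cA; rewrite (_ : [set _ | _] = (fun x => row_cons (hd x - dotp b (tl x) - c) (tl x)) @` A).
  apply: continuous_compact_image => //; apply: rV_continuous => i.
  case: (unliftP ord0 i) => [j|] ->.
    under eq_fun do rewrite row_cons_lift mxE.
    exact: rV_coord_continuous.
  under eq_fun do rewrite row_cons0.
  move=> x; apply: (@continuousB _ _ _ (fun x => hd x - dotp b (tl x)) (fun=> c)); last exact: cst_continuous.
  apply: (@continuousB _ _ _ (@hd R n) (fun x => dotp b (tl x))); first exact: hd_continuous.
  by apply: (@continuous_comp _ _ _ (@tl R n) (dotp b)); [exact: tl_continuous|exact: dotp_continuous].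
apply/seteqP; split=> [x Ax|_ [x Ax <-]]; last first.
  rewrite /= hd_cons tl_cons (_ : _ + _ + _ = hd x); last by ring.
  by rewrite cons_hd_tl.
exists (row_cons (hd x + dotp b (tl x) + c) (tl x)) => //.
rewrite hd_cons tl_cons (_ : _ - _ - _ = hd x); last by ring.
by rewrite cons_hd_tl.
Qed.

(** Exchanging the first two integrals and freezing the second coordinate [s] leaves a shear in one
    dimension less: [hd b * s] joins the constant and [tl b] is the new direction. In dimension one
    the shear is a translation. *)
Lemma vol_shear n (A : set 'rV[R]_n.+1) (b : 'rV[R]_n) (c : R) : compact A ->
  vol [set x | A (row_cons (hd x + dotp b (tl x) + c) (tl x))] = vol A.
Proof.
elim: n A b c => [|n IH] A b c cA.
  rewrite !volS -[RHS](integral_shift c (vol_slice_measurable cA)); last by move=> t; exact: vol_ge0.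
  apply: eq_integral => t _; congr vol; apply/funext => v.
  by rewrite /slice /= hd_cons tl_cons /dotp big_ord0 addr0.
rewrite (vol_swap cA) vol_swap; last exact: shear_compact.
apply: eq_integral => s _.
pose As : set 'rV[R]_n.+1 := [set x | A (row_cons (hd x) (row_cons s (tl x)))].
have cAs : compact As.
  pose rho (x : 'rV[R]_n.+2) := row_cons (hd x) (tl (tl x)).
  rewrite (_ : As = rho @` (A `&` (fun x => hd (tl x)) @^-1` [set s])).
    apply: continuous_compact_image.
      apply: rV_continuous => i; case: (unliftP ord0 i) => [j|] ->.
        under eq_fun do rewrite row_cons_lift.
          move=> x; apply: (@continuous_comp _ _ _ (fun x => tl (tl x)) (fun x => x ord0 j)).
            by apply: (@continuous_comp _ _ _ (@tl R n.+1) (@tl R n)); exact: tl_continuous.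
          exact: rV_coord_continuous.
      under eq_fun do rewrite row_cons0.
      exact: hd_continuous.
    apply: compact_closedI => //; apply: closed_comp; last exact: closed_set1R.
    move=> x _; apply: (@continuous_comp _ _ _ (@tl R n.+1) (@hd R n)); [exact: tl_continuous|exact: hd_continuous].
  apply/seteqP; split=> [x Ax|_ [x [Ax /= xs] <-]]; last first.
    by rewrite /As /rho /= hd_cons tl_cons -xs !cons_hd_tl.
  exists (row_cons (hd x) (row_cons s (tl x))); last by rewrite /rho !hd_cons !tl_cons cons_hd_tl.
  by split=> //=; rewrite tl_cons hd_cons.
have E1 t : slice (slice A t) s = slice As t.
  by apply/funext => v; rewrite /slice /As /= hd_cons tl_cons.
under [RHS]eq_integral => t _ do rewrite E1.
rewrite -volS -(IH As (tl b) (hd b * s + c) cAs) volS.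
apply: eq_integral => t _; congr vol; apply/funext => v.
rewrite /slice /As /= !(hd_cons, tl_cons) dotp_cons; congr (A (row_cons _ _)); ring.
Qed.

(** Slicing by the hyperplanes [a * x_0 + <b, tl x> = r] instead of [x_0 = t]. A slice is described
    by its remaining coordinates, so after a shear only the factor [1 / |a|] is left. *)
Lemma vol_slice_dir n (A : set 'rV[R]_n.+1) (a : R) (b : 'rV[R]_n) : a != 0 -> compact A ->
  vol A = (`|a|^-1%:E * \int[mu]_r vol [set v | A (row_cons ((r - dotp b v) / a) v)])%E.
Proof.
move=> a0 cA.
pose B := [set x | A (row_cons (hd x + dotp (- a^-1 *: b) (tl x) + 0) (tl x))].
have cB : compact B by exact: shear_compact.
have mB := vol_slice_measurable cB.
rewrite -(vol_shear (- a^-1 *: b) 0 cA) -/B.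
transitivity (`|a|^-1%:E * \int[mu]_r vol (slice B (a^-1 * r + 0)))%E.
  rewrite (integral_affine 0 _ mB) ?invr_eq0//; last by move=> t; exact: vol_ge0.
  by rewrite muleA -EFinM normfV invrK mulVf ?normr_eq0// mul1e.
congr (_ * _)%E; apply: eq_integral => r _; congr vol; apply/funext => v.
rewrite /slice /B /= hd_cons tl_cons dotpZl; congr (A (row_cons _ _)); ring.
Qed.

End Volume.

(** * One small parameter for finitely many conditions *)

Section SmallParameters.
Variable R : realType.

Lemma exists_small (I : finType) (P : I -> R -> Prop) :
  (forall i, exists2 e : R, 0 < e & forall t, 0 < t < e -> P i t) ->
  exists2 e : R, 0 < e & forall t, 0 < t < e -> forall i, P i t.
Proof.
move=> H; have /choice[e He] : forall i, exists e : R, 0 < e /\ forall t, 0 < t < e -> P i t.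
  by move=> i; have [e e0 He] := H i; exists e.
exists (\big[Num.min/1]_i e i); first by apply: (big_ind (fun x => 0 < x)) => // [x y x0 y0|i _]; [rewrite lt_min x0|exact: (He i).1].
move=> t /andP[t0 te] i; apply: (He i).2; rewrite t0 /=; apply: lt_le_trans te _.
exact: bigmin_le_cond.
Qed.

Lemma small_slack (I : finType) (P : pred I) (a b c : I -> R) :
  (forall j, P j -> a j < b j) ->
  exists2 e : R, 0 < e & forall t, 0 < t < e -> forall j, P j -> a j + t * c j < b j.
Proof.
move=> H; have [i|e e0 He] := @exists_small I (fun j t => P j -> a j + t * c j < b j).
  have [Pi|] := boolP (P i); last by exists 1.
  have ab := H _ Pi; have c0 := normr_ge0 (c i).
  exists ((b i - a i) / (`|c i| + 1)); first by rewrite divr_gt0// ?subr_gt0// ltr_pwDr.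
  move=> t /andP[t0]; rewrite ltr_pdivlMr; last by rewrite ltr_pwDr.
  by have := ler_norm (c i) => H1 H2 _; nra.
by exists e.
Qed.

End SmallParameters.

(** * Polyhedra, elimination along flags, and chambers of constant combinatorial type *)

Section Polyhedra.
Variables (R : realType) (N : nat).
Implicit Types (h : 'rV[R]_N) (xs ys : seq 'rV[R]_N) (D : {set 'I_N}).

Definition hpoly d (u : 'I_N -> 'rV[R]_d) h : set 'rV[R]_d :=
  [set x | forall j, dotp (u j) x <= h ord0 j].

(* Eliminating the first coordinate with the equation [<u_i, x> = h_i] turns the
   other constraints into constraints on the remaining coordinates: [red] gives
   the new normals and [lred] the new right-hand sides. *)
Definition red d (u : 'I_N -> 'rV[R]_d.+1) (i : 'I_N) : 'I_N -> 'rV[R]_d :=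
  fun j => tl (u j) - (hd (u j) / hd (u i)) *: tl (u i).

Definition lred d (u : 'I_N -> 'rV[R]_d.+1) (i : 'I_N) (x : 'rV[R]_N) : 'rV[R]_N :=
  \row_j (x ord0 j - hd (u j) / hd (u i) * x ord0 i).

Definition shiftv d (u : 'I_N -> 'rV[R]_d) (v : 'rV[R]_d) : 'rV[R]_N :=
  \row_j dotp (u j) v.

(* [d`!] times the mixed volume form of the simple polytopes of the
   combinatorial type of [hpoly u h], as a sum over flags of faces: [h] is only
   used to decide which vertices are present. *)
Fixpoint mvform d : ('I_N -> 'rV[R]_d) -> 'rV[R]_N -> seq 'rV[R]_N -> R :=
  match d with
  | 0 => fun u h xs => if [forall j, 0 <= h ord0 j] then 1 else 0
  | d'.+1 => fun u h xs =>
      \sum_i head 0 xs ord0 i * `|hd (u i)|^-1 *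
        mvform (red u i) (lred u i h) (map (lred u i) (behead xs))
  end.

(** Every pivot met along a flag is invertible. Zero normals are tolerated because elimination
    produces them: [red u i j] vanishes exactly when [u j] is a multiple of [u i]. *)
Fixpoint gen_pos d : ('I_N -> 'rV[R]_d) -> Prop :=
  match d with
  | 0 => fun u => True
  | d'.+1 => fun u => forall i, u i <> 0 -> hd (u i) != 0 /\ gen_pos (red u i)
  end.

(** Positive spanning: the recession cone of [hpoly u h] is trivial, so these polyhedra are
    bounded. *)
Definition spans d (u : 'I_N -> 'rV[R]_d) : Prop :=
  forall v, (forall j, dotp (u j) v <= 0) -> v = 0.

(* [D] collects the constraints already used for elimination. *)
Fixpoint regular d : {set 'I_N} -> ('I_N -> 'rV[R]_d) -> 'rV[R]_N -> Prop :=
  match d with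
  | 0 => fun D u h => (forall j, 0 <= h ord0 j) -> forall j, j \notin D -> 0 < h ord0 j
  | d'.+1 => fun D u h => forall i, hd (u i) != 0 ->
       regular (i |: D) (red u i) (lred u i h)
  end.

(** A convex family of support vectors of one simple type. Convexity allows any two members to be
    joined by a segment, and regularity along the segment prevents a vertex from appearing or
    disappearing. *)
Record chamber d (D : {set 'I_N}) (u : 'I_N -> 'rV[R]_d) (U : set 'rV[R]_N) : Prop := Chamber {
  chamber_gen : gen_pos u;
  chamber_spans : spans u;
  chamber_dead : forall j, j \in D -> u j = 0;
  chamber_convex : Defs.convex_set U;
  chamber_reg : forall h, U h -> regular D u h;
  chamber_zero : forall h, U h -> forall j, j \in D -> h ord0 j = 0 }.

Lemma lredD d (u : 'I_N -> 'rV[R]_d.+1) i x y : lred u i (x + y) = lred u i x + lred u i y.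
Proof. by apply/rowP => j; rewrite !mxE; ring. Qed.

Lemma lredZ d (u : 'I_N -> 'rV[R]_d.+1) i a x : lred u i (a *: x) = a *: lred u i x.
Proof. by apply/rowP => j; rewrite !mxE; ring. Qed.

Lemma lred_shiftv d (u : 'I_N -> 'rV[R]_d.+1) i v : hd (u i) != 0 ->
  lred u i (shiftv u v) = shiftv (red u i) (tl v).
Proof.
move=> a0; apply/rowP => j; rewrite !mxE -{1 2}(cons_hd_tl v) !dotp_cons /red dotpBl dotpZl.
by field.
Qed.

Lemma dotp_red d (u : 'I_N -> 'rV[R]_d.+1) i j t (v : 'rV[R]_d) : hd (u i) != 0 ->
  dotp (red u i j) v =
  dotp (u j) (row_cons ((t - dotp (tl (u i)) v) / hd (u i)) v) - hd (u j) / hd (u i) * t.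
Proof. by move=> a0; rewrite dotp_cons /red dotpBl dotpZl; field. Qed.

Lemma poly_red d (u : 'I_N -> 'rV[R]_d.+1) h i v : hd (u i) != 0 ->
  hpoly (red u i) (lred u i h) v <->
  hpoly u h (row_cons ((h ord0 i - dotp (tl (u i)) v) / hd (u i)) v).
Proof.
move=> a0; split=> H j; have := H j; rewrite (dotp_red j (h ord0 i) v a0) mxE; lra.
Qed.

Lemma poly_red_tl d (u : 'I_N -> 'rV[R]_d.+1) h i x : hd (u i) != 0 ->
  hpoly u h x -> dotp (u i) x = h ord0 i -> hpoly (red u i) (lred u i h) (tl x).
Proof.
move=> a0 Px xi; apply/poly_red => //; rewrite -xi -{1}(cons_hd_tl x) dotp_cons.
by rewrite (_ : _ / _ = hd x) ?cons_hd_tl//; field.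
Qed.

Lemma spans_red d (u : 'I_N -> 'rV[R]_d.+1) i : hd (u i) != 0 -> spans u -> spans (red u i).
Proof.
move=> a0 su v Hv.
have /(congr1 (@tl R d)) : row_cons ((0 - dotp (tl (u i)) v) / hd (u i)) v = 0.
  by apply: su => j; have := Hv j; rewrite (dotp_red j 0 v a0) mulr0 subr0.
by rewrite tl_cons => ->; apply/rowP => j; rewrite !mxE.
Qed.

Lemma gen_pos_hd d (u : 'I_N -> 'rV[R]_d.+1) i : gen_pos u -> hd (u i) = 0 -> u i = 0.
Proof. by move=> gu a0; apply: contrapT => /gu[]; rewrite a0 eqxx. Qed.

Lemma gen_pos_red d (u : 'I_N -> 'rV[R]_d.+1) i : gen_pos u -> hd (u i) != 0 -> gen_pos (red u i).
Proof. by move=> gu a0; apply: (gu i _).2 => u0; move: a0; rewrite u0 /hd mxE eqxx. Qed.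

Lemma hd_dead d D (u : 'I_N -> 'rV[R]_d.+1) i : (forall j, j \in D -> u j = 0) ->
  i \in D -> hd (u i) = 0.
Proof. by move=> Hu /Hu ->; rewrite /hd mxE. Qed.

Lemma red_dead d D (u : 'I_N -> 'rV[R]_d.+1) i : hd (u i) != 0 ->
  (forall j, j \in D -> u j = 0) -> forall j, j \in i |: D -> red u i j = 0.
Proof.
move=> a0 Hu j; rewrite in_setU1 => /orP[/eqP ->|jD].
  by rewrite /red divff// scale1r subrr.
by rewrite /red (Hu j jD) /hd mxE mul0r scale0r subr0; apply/rowP => k; rewrite !mxE.
Qed.

Lemma lred_zero d D (u : 'I_N -> 'rV[R]_d.+1) i (x : 'rV[R]_N) : hd (u i) != 0 ->
  (forall j, j \in D -> u j = 0) -> (forall j, j \in D -> x ord0 j = 0) ->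
  forall j, j \in i |: D -> lred u i x ord0 j = 0.
Proof.
move=> a0 Hu Hx j; rewrite in_setU1 mxE => /orP[/eqP ->|jD].
  by rewrite divff// mul1r subrr.
by rewrite (Hu j jD) /hd mxE mul0r mul0r Hx// subrr.
Qed.

Lemma chamber_red d D (u : 'I_N -> 'rV[R]_d.+1) U i : chamber D u U -> hd (u i) != 0 ->
  chamber (i |: D) (red u i) (lred u i @` U).
Proof.
move=> cU a0; split.
- exact: gen_pos_red (chamber_gen cU) a0.
- exact: spans_red a0 (chamber_spans cU).
- exact: red_dead a0 (chamber_dead cU).
- move=> _ _ [x Ux <-] [y Uy <-] l Hl; exists (l *: x + (1 - l) *: y).
    exact: (chamber_convex cU).
  by rewrite lredD !lredZ.
- by move=> _ [x Ux <-]; exact: (chamber_reg cU Ux).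
- by move=> _ [x Ux <-]; exact: (lred_zero a0 (chamber_dead cU) (chamber_zero cU Ux)).
Qed.

Lemma poly0 (u : 'I_N -> 'rV[R]_0) h v : hpoly u h v <-> forall j, 0 <= h ord0 j.
Proof.
by split=> H j; have := H j; rewrite /dotp ?big_ord0.
Qed.

(** On the way from [h'] to [h], stop when the last negative entry reaches 0 (the maximum of [th]).
    All entries are then non-negative and one outside [D] is zero, which regularity forbids. *)
Lemma chamber_feas D (u : 'I_N -> 'rV[R]_0) U h h' : chamber D u U -> U h -> U h' ->
  (forall j, 0 <= h ord0 j) -> forall j, 0 <= h' ord0 j.
Proof.
move=> cU Uh Uh' Hh j0; rewrite leNgt; apply/negP => Hj0.
pose th j := - h' ord0 j / (h ord0 j - h' ord0 j).
pose P j := h' ord0 j < 0.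
have [j Pj Hj] := @arg_maxP _ _ _ j0 P th Hj0.
have dj k : P k -> 0 < h ord0 k - h' ord0 k by rewrite /P => Hk; have := Hh k; lra.
have th01 k : P k -> 0 <= th k <= 1.
  move=> Pk; have := dj _ Pk => d0; apply/andP; split.
    by apply: divr_ge0; [move: Pk; rewrite /P; lra|exact: ltW].
  by rewrite /th ler_pdivrMr// mul1r; have := Hh k; lra.
have Uz := chamber_convex cU Uh Uh' (th01 _ Pj).
have zE k : (th j *: h + (1 - th j) *: h') ord0 k = h' ord0 k + th j * (h ord0 k - h' ord0 k).
  by rewrite !mxE; ring.
have zj : h' ord0 j + th j * (h ord0 j - h' ord0 j) = 0.
  by rewrite /th divfK ?subrr ?gt_eqF ?dj// addrN.
suff : 0 < (th j *: h + (1 - th j) *: h') ord0 j by rewrite zE zj ltxx.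
apply: (chamber_reg cU Uz).
  move=> k; rewrite zE; have [Pk|] := boolP (P k).
    have := Hj _ Pk; rewrite /th => Hk; have dk := dj _ Pk.
    by rewrite addrC -lerBlDr sub0r -ler_pdivrMr.
  rewrite /P -leNgt => Hk; have := th01 _ Pj => /andP[t0 t1]; have := Hh k; nra.
by apply/negP => jD; move: Pj; rewrite /P (chamber_zero cU Uh' jD) ltxx.
Qed.

Lemma mvform_const d D (u : 'I_N -> 'rV[R]_d) U h h' xs : chamber D u U -> U h -> U h' ->
  mvform u h xs = mvform u h' xs.
Proof.
elim: d D u U h h' xs => [|d IH] D u U h h' xs cU Uh Uh' /=.
  congr (if _ then _ else _); apply/forallP/forallP; exact: chamber_feas cU _ _.
apply: eq_bigr => i _; have [->|a0] := eqVneq (hd (u i)) 0.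
  by rewrite normr0 invr0 mulr0 !mul0r.
by congr (_ * _); apply: (IH _ _ _ _ _ _ (chamber_red cU a0)); apply: imageP.
Qed.

(** The ray from [x] along the first axis in the direction [s] leaves the polyhedron through a facet
    [i], the constraint it meets first; [tl x] does not change on the way. *)
Lemma facet_dir d (u : 'I_N -> 'rV[R]_d.+1) h (s : R) x : s != 0 -> spans u -> hpoly u h x ->
  exists i, 0 < s * hd (u i) /\ hpoly (red u i) (lred u i h) (tl x).
Proof.
move=> s0 su Px; pose e : 'rV[R]_d.+1 := row_cons s 0.
have de j : dotp (u j) e = s * hd (u j) by rewrite dotp_cons dotp0r addr0 mulrC.
have [j0 Hj0] : exists j, 0 < s * hd (u j).
  apply: contrapT => H; suff : e = 0.
    by move=> /(congr1 (@hd R d)); rewrite hd_cons /hd mxE => /eqP; rewrite (negbTE s0).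
  by apply: su => j; rewrite de leNgt; apply/negP => Hj; apply: H; exists j.
pose th j := (h ord0 j - dotp (u j) x) / (s * hd (u j)).
have [i Pi Hi] := @arg_minP _ _ _ j0 (fun j => 0 < s * hd (u j)) th Hj0.
exists i; split=> //.
have th0 : 0 <= th i by apply: divr_ge0; [rewrite subr_ge0; exact: Px|exact: ltW].
have xe : tl (x + th i *: e) = tl x by rewrite tlD tlZ tl_cons scaler0 addr0.
rewrite -xe; apply: poly_red_tl.
- by apply/eqP => a0; move: Pi; rewrite a0 mulr0 ltxx.
- move=> j; rewrite dotpDr dotpZr de; have := Px j.
  have [Pj|] := boolP (0 < s * hd (u j)); last by rewrite -leNgt; nra.
  have := Hi _ Pj; rewrite {2}/th ler_pdivlMr// ; lra.
- by rewrite dotpDr dotpZr de /th divfK ?gt_eqF//; ring.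
Qed.

Lemma facet_nonempty d (u : 'I_N -> 'rV[R]_d.+1) h : spans u -> hpoly u h !=set0 ->
  exists2 i, hd (u i) != 0 & hpoly (red u i) (lred u i h) !=set0.
Proof.
move=> su [x Px]; have [i [a0 Pi]] := facet_dir (oner_neq0 _) su Px.
exists i; last by exists (tl x).
by apply/eqP => a00; move: a0; rewrite a00 mulr0 ltxx.
Qed.

Lemma poly_red_nonempty d (u : 'I_N -> 'rV[R]_d.+1) h i : hd (u i) != 0 ->
  hpoly (red u i) (lred u i h) !=set0 -> hpoly u h !=set0.
Proof. by move=> a0 [v /(poly_red _ _ a0) Hv]; eexists; exact: Hv. Qed.

Lemma nonempty_const d D (u : 'I_N -> 'rV[R]_d) U h h' : chamber D u U -> U h -> U h' ->
  hpoly u h !=set0 -> hpoly u h' !=set0.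
Proof.
elim: d D u U h h' => [|d IH] D u U h h' cU Uh Uh'.
  move=> [x /poly0 Hx]; exists 0; apply/poly0; exact: chamber_feas cU Uh Uh' Hx.
move=> /(facet_nonempty (chamber_spans cU))[i a0 Hi]; apply: (poly_red_nonempty a0).
by apply: (IH _ _ _ _ _ (chamber_red cU a0)) Hi; apply: imageP.
Qed.

(** A relative interior point of a facet is lifted and pushed inwards slightly: the other live
    constraints are strict by induction and keep their slack, while the constraint of the facet
    becomes strict. *)
Lemma regular_interior d D (u : 'I_N -> 'rV[R]_d) h :
  gen_pos u -> spans u -> (forall j, j \in D -> u j = 0) -> regular D u h ->
  hpoly u h !=set0 -> exists x, forall j, j \notin D -> dotp (u j) x < h ord0 j.
Proof.
elim: d D u h => [|d IH] D u h gu su du ru.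
  move=> [x /poly0 Hx]; exists 0 => j jD; rewrite /dotp big_ord0; exact: ru.
move=> /(facet_nonempty su)[i a0 Hi].
have [v Hv] := IH _ _ _ (gen_pos_red gu a0) (spans_red a0 su) (red_dead a0 du) (ru i a0) Hi.
pose x := row_cons ((h ord0 i - dotp (tl (u i)) v) / hd (u i)) v.
have xi : dotp (u i) x = h ord0 i by rewrite dotp_cons; field.
pose e : 'rV[R]_d.+1 := row_cons (- hd (u i)) 0.
have [|t t0 Ht] := @small_slack R _ (fun j => (j \notin D) && (j != i)) (fun j => dotp (u j) x)
   (fun j => h ord0 j) (fun j => dotp (u j) e).
  move=> j /andP[jD ji]; have /Hv : j \notin i |: D by rewrite in_setU1 negb_or ji.
  by rewrite (dotp_red j (h ord0 i) v a0) mxE; rewrite -/x; lra.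
exists (x + (t / 2) *: e) => j jD; rewrite dotpDr dotpZr; have [->|ji] := eqVneq j i.
  rewrite xi dotp_cons dotp0r addr0 mulrN -expr2; have : 0 < hd (u i) ^+ 2 by rewrite exprn_even_gt0.
  by move=> H; have := mulr_gt0 t0 H; lra.
by apply: Ht; [lra|rewrite jD].
Qed.

Lemma chamber_interior d D (u : 'I_N -> 'rV[R]_d) U h : chamber D u U -> U h ->
  hpoly u h !=set0 -> exists x, forall j, j \notin D -> dotp (u j) x < h ord0 j.
Proof.
move=> cU Uh; apply: regular_interior (chamber_reg cU Uh);
 [exact: chamber_gen cU|exact: chamber_spans cU|exact: chamber_dead cU].
Qed.

End Polyhedra.

(** * Symmetry, translation invariance and positivity of the mixed form *)

Section MixedForms.
Variables (R : realType) (N : nat).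
Implicit Types (h : 'rV[R]_N) (xs ys : seq 'rV[R]_N) (D : {set 'I_N}).

Lemma mvformS d (u : 'I_N -> 'rV[R]_d.+1) h x xs : mvform u h (x :: xs) =
  \sum_i x ord0 i * `|hd (u i)|^-1 * mvform (red u i) (lred u i h) (map (lred u i) xs).
Proof. by []. Qed.

Lemma mvform_lin d (u : 'I_N -> 'rV[R]_d) h xs ys a x y : (size xs < d)%N ->
  mvform u h (xs ++ (a *: x + y) :: ys) =
  a * mvform u h (xs ++ x :: ys) + mvform u h (xs ++ y :: ys).
Proof.
elim: d u h xs ys x y => [//|d IH] u h [|z xs] ys x y sx.
  rewrite /= mulr_sumr -big_split; apply: eq_bigr => i _ /=; rewrite !mxE; ring.
rewrite /= mulr_sumr -big_split; apply: eq_bigr => i _ /=.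
rewrite !map_cat !map_cons lredD lredZ IH ?size_map//; ring.
Qed.

Lemma mvform_headD d (u : 'I_N -> 'rV[R]_d.+1) h x y xs :
  mvform u h (x + y :: xs) = mvform u h (x :: xs) + mvform u h (y :: xs).
Proof. by have := @mvform_lin d.+1 u h [::] xs 1 x y isT; rewrite scale1r mul1r. Qed.

Lemma mvform_head0 d (u : 'I_N -> 'rV[R]_d.+1) h xs : mvform u h (0 :: xs) = 0.
Proof. by rewrite /= big1// => i _; rewrite mxE !mul0r. Qed.

Lemma mvform_headZ d (u : 'I_N -> 'rV[R]_d.+1) h a x xs :
  mvform u h (a *: x :: xs) = a * mvform u h (x :: xs).
Proof.
by have := @mvform_lin d.+1 u h [::] xs a x 0 isT; rewrite !cat0s addr0 mvform_head0 addr0.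
Qed.

Lemma mvform_scale d (u : 'I_N -> 'rV[R]_d) h a xs : size xs = d ->
  mvform u h (map (fun x => a *: x) xs) = a ^+ d * mvform u h xs.
Proof.
elim: d u h xs => [|d IH] u h [|x xs] //= sx; first by rewrite expr0 mul1r.
rewrite mulr_sumr; apply: eq_bigr => i _; rewrite mxE.
rewrite (_ : map _ _ = map (fun x => a *: x) (map (lred u i) xs)); last first.
  by rewrite -!map_comp; apply: eq_map => y /=; rewrite lredZ.
by rewrite IH ?size_map; [rewrite exprS; ring|case: sx].
Qed.

Lemma hd_red d (u : 'I_N -> 'rV[R]_d.+2) i j :
  hd (red u i j) = hd (tl (u j)) - hd (u j) / hd (u i) * hd (tl (u i)).
Proof. by rewrite /red /hd !mxE. Qed.

Lemma red_coord d (u : 'I_N -> 'rV[R]_d.+1) i j l :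
  red u i j ord0 l = tl (u j) ord0 l - hd (u j) / hd (u i) * tl (u i) ord0 l.
Proof. by rewrite /red !mxE. Qed.

(** Two eliminations expand the form into a double sum with weights [W i j] and a correction visibly
    symmetric in the two vectors. The weights are symmetric because eliminating [i] then [j] gives
    the same system as [j] then [i], and both products of pivots are, up to sign, the minor [de]. *)
Lemma mvform_swap d (u : 'I_N -> 'rV[R]_d.+2) h x y xs : gen_pos u ->
  mvform u h (x :: y :: xs) = mvform u h (y :: x :: xs).
Proof.
move=> gu.
pose T i j := mvform (red (red u i) j) (lred (red u i) j (lred u i h))
   (map (lred (red u i) j) (map (lred u i) xs)).
pose W i j := `|hd (u i)|^-1 * `|hd (red u i j)|^-1 * T i j.
have W0 i j : hd (u i) = 0 -> W i j = 0 /\ W j i = 0.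
  move=> a0; split; first by rewrite /W a0 normr0 invr0 !mul0r.
  have t0 : hd (tl (u i)) = 0 by rewrite (gen_pos_hd gu a0) /hd !mxE.
  by rewrite /W hd_red a0 t0 !mul0r subr0 normr0 invr0 mulr0 mul0r.
have WC i j : W i j = W j i.
  have [a0|ai] := eqVneq (hd (u i)) 0; first by have [-> ->] := W0 _ j a0.
  have [a0|aj] := eqVneq (hd (u j)) 0; first by have [-> ->] := W0 _ i a0.
  pose de := hd (u i) * hd (tl (u j)) - hd (u j) * hd (tl (u i)).
  have E1 : hd (red u i j) = de / hd (u i) by rewrite hd_red /de; field.
  have E2 : hd (red u j i) = - de / hd (u j) by rewrite hd_red /de; field.
  have [d0|d0] := eqVneq de 0.
    by rewrite /W E1 E2 d0 oppr0 !mul0r normr0 invr0 !mulr0 !mul0r.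
  have nz : (hd (tl (u j)) - hd (u j) / hd (u i) * hd (tl (u i)) != 0) /\
            (hd (tl (u i)) - hd (u i) / hd (u j) * hd (tl (u j)) != 0).
    by rewrite -!hd_red E1 E2 !mulf_neq0 ?invr_eq0 ?oppr_eq0.
  have d0' : hd (u i) * hd (tl (u j)) - hd (u j) * hd (tl (u i)) != 0 by [].
  have d0'' : hd (u j) * hd (tl (u i)) - hd (u i) * hd (tl (u j)) != 0 by rewrite -opprB oppr_eq0.
  have redC : red (red u i) j = red (red u j) i.
    apply/funext => k; apply/rowP => l; rewrite !red_coord ![tl (red _ _ _) _ _]mxE !red_coord !hd_red.
    by field; rewrite ai aj /=; apply/andP; split; rewrite (mulrC (hd (tl _))) // mulrC.
  have lredC z : lred (red u i) j (lred u i z) = lred (red u j) i (lred u j z).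
    apply/rowP => l; rewrite !mxE !hd_red.
    by field; rewrite ai aj /=; apply/andP; split; rewrite (mulrC (hd (tl _))) // mulrC.
  rewrite /W /T redC lredC -!map_comp (eq_map lredC) E1 E2; congr (_ * _).
  rewrite !normrM normrN !normfV !invfM !invrK; field.
  by rewrite !normr_eq0 ai aj d0.
have E z w : mvform u h (z :: w :: xs) = \sum_i \sum_j z ord0 i * w ord0 j * W i j -
   \sum_i z ord0 i * w ord0 i * \sum_j hd (u j) / hd (u i) * W i j.
  rewrite /= -sumrB; apply: eq_bigr => i _; rewrite !mulr_sumr -sumrB; apply: eq_bigr => j _.
  rewrite mxE -/(T i j) /W; ring.
rewrite !E; congr (_ - _); last by apply: eq_bigr => i _; rewrite [x _ _ * _]mulrC.
rewrite exchange_big; apply: eq_bigr => i _; apply: eq_bigr => j _; rewrite WC; ring.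
Qed.

Lemma mvform_perm d (u : 'I_N -> 'rV[R]_d) h xs ys : gen_pos u -> size xs = d ->
  perm_eq xs ys -> mvform u h xs = mvform u h ys.
Proof.
elim: d u h xs ys => [//|d IH] u h [//|x xs] ys gu sx pxy.
have tail z (as_ bs : seq 'rV[R]_N) : size as_ = d -> perm_eq as_ bs ->
    mvform u h (z :: as_) = mvform u h (z :: bs).
  move=> sa pab /=; apply: eq_bigr => i _; have [->|a0] := eqVneq (hd (u i)) 0.
    by rewrite normr0 invr0 mulr0 !mul0r.
  congr (_ * _); apply: IH; [exact: gen_pos_red|by rewrite size_map|exact: perm_map].
case: sx => sx.
have xy : x \in ys by rewrite -(perm_mem pxy) mem_head.
case/splitPr: xy pxy => [[|a0 a] b] pxy.
  by apply: tail => //; move: pxy; rewrite /= perm_cons.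
have pxs : perm_eq xs (a0 :: a ++ b).
  rewrite -(perm_cons x); apply: perm_trans pxy _; rewrite -cat_cons.
  by rewrite perm_sym -(cat1s x) perm_catCA.
have sab : size (a ++ b) = d.-1 by have := perm_size pxs; rewrite sx /= => ->.
case: d u h gu IH tail sx sab => [|d] u h gu IH tail sx sab.
  by have := perm_size pxs; rewrite sx.
rewrite (tail _ _ _ sx pxs) mvform_swap//=.
have := tail a0 (x :: a ++ b) (a ++ x :: b); rewrite /= => -> //; first by rewrite sab.
by rewrite -(cat1s x) -(cat1s x b) perm_catCA.
Qed.

(** Translation invariance, the analogue of Minkowski's relation for facet areas. In the last slot a
    shift vector stays a shift vector under elimination, so everything reduces to dimension one,
    where the two endpoints of an interval cancel. *)
Lemma mvform_shiftv_last d (u : 'I_N -> 'rV[R]_d.+1) D h xs v :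
  gen_pos u -> spans u -> (forall j, j \in D -> u j = 0) -> regular D u h ->
  size xs = d -> mvform u h (rcons xs (shiftv u v)) = 0.
Proof.
elim: d u D h xs v => [|d IH] u D h xs v gu su du ru sx; last first.
  case: xs sx => [//|x xs] [sx]; rewrite rcons_cons mvformS big1// => i _.
  have [->|a0] := eqVneq (hd (u i)) 0; first by rewrite normr0 invr0 mulr0 !mul0r.
  rewrite map_rcons lred_shiftv// (IH _ (i |: D)) ?mulr0 ?size_map//.
  - exact: gen_pos_red.
  - exact: spans_red.
  - exact: red_dead.
  - exact: ru.
move/size0nil : sx => -> /=.
have dv j : dotp (u j) v = hd (u j) * hd v by rewrite -{1}(cons_hd_tl v) dotp_cons /dotp big_ord0 addr0.
pose F i := [forall j, 0 <= lred u i h ord0 j].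
(* Regularity leaves at most one active endpoint on either side. *)
have uniqF i j : F i -> F j -> 0 < hd (u i) * hd (u j) -> i = j.
  move=> /forallP Fi /forallP Fj aij; apply/eqP; apply/negP => /negP ij.
  have ai : hd (u i) != 0 by apply/eqP => a0; rewrite a0 mul0r ltxx in aij.
  have aj : hd (u j) != 0 by apply/eqP => a0; rewrite a0 mulr0 ltxx in aij.
  have : 0 < lred u i h ord0 j.
    apply: (ru i ai Fi); rewrite in_setU1 negb_or eq_sym ij /=.
    by apply/negP => /(hd_dead du) /eqP; rewrite (negbTE aj).
  have := Fj i; rewrite !mxE => H1 H2.
  have q0 : 0 < hd (u j) / hd (u i).
    rewrite (_ : _ / _ = hd (u i) * hd (u j) / hd (u i) ^+ 2); last by field.
    by rewrite divr_gt0// exprn_even_gt0.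
  have : 0 <= hd (u j) / hd (u i) * (h ord0 i - hd (u i) / hd (u j) * h ord0 j).
    by rewrite mulr_ge0// ltW.
  rewrite mulrBr (_ : hd (u j) / hd (u i) * (hd (u i) / hd (u j) * h ord0 j) = h ord0 j); last by field; rewrite ai aj.
  lra.
have [/existsP[i0 /andP[a0 Fi0]]|none] := boolP [exists i, (hd (u i) != 0) && F i]; last first.
  rewrite big1// => i _; have [->|a0] := eqVneq (hd (u i)) 0; first by rewrite normr0 invr0 mulr0 mul0r.
  case: ifP => Fi; last by rewrite mulr0.
  by move/existsP : none; case; exists i; rewrite a0.
have Px : hpoly u h !=set0.
  by apply: (poly_red_nonempty a0); exists 0; apply/poly0; exact/forallP.
have [x {}Px] := Px.
have [ip [Hp /poly0 Fp]] := facet_dir (oner_neq0 R) su Px.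
have N10 : (-1 : R) != 0 by rewrite oppr_eq0 oner_neq0.
have [im [Hm /poly0 Fm]] := facet_dir N10 su Px.
rewrite mul1r in Hp; rewrite mulN1r oppr_gt0 in Hm.
have {}Fp : F ip by exact/forallP.
have {}Fm : F im by exact/forallP.
have pm : im != ip by apply/eqP => E; rewrite E in Hm; lra.
rewrite (bigD1 ip)//= (bigD1 im)//= big1 ?addr0.
  rewrite !mxE !dv -!/(F _) Fp Fm gtr0_norm// ltr0_norm// invrN; field.
  by rewrite (gt_eqF Hp) (lt_eqF Hm).
move=> i /andP[iip iim]; rewrite -/(F i); case: ifP => Fi; last by rewrite mulr0.
rewrite mulr1 mxE dv; have [ai|ai|->] := ltgtP (hd (u i)) 0.
- by move: iim; rewrite (uniqF i im Fi Fm) ?eqxx// nmulr_rgt0.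
- by move: iip; rewrite (uniqF i ip Fi Fp) ?eqxx// mulr_gt0.
- by rewrite !mul0r.
Qed.

Lemma mvform_shiftv d (u : 'I_N -> 'rV[R]_d.+1) D U h xs v :
  chamber D u U -> U h -> size xs = d -> mvform u h (shiftv u v :: xs) = 0.
Proof.
move=> cU Uh sx.
have -> : mvform u h (shiftv u v :: xs) = mvform u h (rcons xs (shiftv u v)).
  by apply: mvform_perm; [exact: chamber_gen cU|rewrite /= sx|rewrite perm_sym perm_rcons].
exact: (mvform_shiftv_last _ (chamber_gen cU) (chamber_spans cU) (chamber_dead cU) (chamber_reg cU Uh)).
Qed.

Lemma mvform_empty d (u : 'I_N -> 'rV[R]_d) h xs : ~ (hpoly u h !=set0) -> mvform u h xs = 0.
Proof.
elim: d u h xs => [|d IH] u h xs Hn /=.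
  case: ifP => // /forallP H; case: Hn; exists 0; exact/poly0.
rewrite big1// => i _; have [->|a0] := eqVneq (hd (u i)) 0; first by rewrite normr0 invr0 mulr0 !mul0r.
by rewrite IH ?mulr0// => /(poly_red_nonempty a0).
Qed.

(** Translating the first polytope so that an interior point becomes the origin does not change the
    form and makes its support numbers positive on all live facets; the expansion then has
    non-negative terms, one of them positive, by induction. *)
Lemma mvform_gt0 d D (u : 'I_N -> 'rV[R]_d) U h ps : chamber D u U -> U h ->
  hpoly u h !=set0 -> (forall p, p \in ps -> U p) -> size ps = d -> 0 < mvform u h ps.
Proof.
elim: d D u U h ps => [|d IH] D u U h ps cU Uh.
  by move=> [x /poly0 Px] _ _ /=; case: ifP => // /negP[]; apply/forallP.
case: ps => [//|p ps] Ph Ups [sp].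
have Up : U p by apply: Ups; rewrite mem_head.
have [x Hx] := chamber_interior cU Up (nonempty_const cU Uh Up Ph).
have -> : mvform u h (p :: ps) = mvform u h (p - shiftv u x :: ps).
  by rewrite mvform_headD -scaleN1r mvform_headZ (mvform_shiftv _ cU)// mulr0 addr0.
have term i : hd (u i) != 0 -> 0 < (p - shiftv u x) ord0 i * `|hd (u i)|^-1.
  move=> a0; apply: mulr_gt0; last by rewrite invr_gt0 normr_gt0.
  rewrite !mxE subr_gt0; apply: Hx; apply/negP => /(hd_dead (chamber_dead cU)) /eqP.
  by rewrite (negbTE a0).
have pos i : hd (u i) != 0 -> hpoly (red u i) (lred u i h) !=set0 ->
    0 < mvform (red u i) (lred u i h) (map (lred u i) ps).
  move=> a0 Pi; apply: (IH _ _ _ _ _ (chamber_red cU a0)) => //.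
  - by move=> _ /mapP[q qp ->]; exists q => //; apply: Ups; rewrite in_cons qp orbT.
  - by rewrite size_map.
have [i a0 Pi] := facet_nonempty (chamber_spans cU) Ph.
rewrite /= (bigD1 i)//=; apply: ltr_pwDl; first by rewrite mulr_gt0 ?term ?pos.
apply: sumr_ge0 => j _; have [->|aj] := eqVneq (hd (u j)) 0; first by rewrite normr0 invr0 mulr0 mul0r.
rewrite mulr_ge0 ?(ltW (term _ _))//.
have [Pj|Pj] := pselect (hpoly (red u j) (lred u j h) !=set0); first by rewrite ltW ?pos.
by rewrite mvform_empty.
Qed.

Lemma mvform_ge0 d D (u : 'I_N -> 'rV[R]_d) U h ps : chamber D u U -> U h ->
  (forall p, p \in ps -> U p) -> size ps = d -> 0 <= mvform u h ps.
Proof.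
move=> cU Uh Ups sp; have [Ph|Ph] := pselect (hpoly u h !=set0).
  by apply: ltW; exact: (mvform_gt0 cU).
by rewrite mvform_empty.
Qed.

Lemma mvform_head_ge0 d D (u : 'I_N -> 'rV[R]_d.+1) U h (x : 'rV[R]_N) ps : chamber D u U -> U h ->
  (forall j, j \notin D -> 0 <= x ord0 j) ->
  (forall p, p \in ps -> U p) -> size ps = d -> 0 <= mvform u h (x :: ps).
Proof.
move=> cU Uh x0 Ups sp; rewrite /=; apply: sumr_ge0 => i _.
have [->|a0] := eqVneq (hd (u i)) 0; first by rewrite normr0 invr0 mulr0 mul0r.
rewrite !mulr_ge0 ?invr_ge0//.
  by apply: x0; apply/negP => /(hd_dead (chamber_dead cU)) /eqP; rewrite (negbTE a0).
apply: (mvform_ge0 (chamber_red cU a0)); first by exists h.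
  by move=> _ /mapP[q qp ->]; exists q => //; apply: Ups.
by rewrite size_map.
Qed.

End MixedForms.

(** * The volume of a simple polytope as a diagonal value of the mixed form *)

Section VolumeFormula.
Variables (R : realType) (N : nat).
Implicit Types (h : 'rV[R]_N) (xs ys : seq 'rV[R]_N) (D : {set 'I_N}).
Notation mu := (@lebesgue_measure R).
Notation evec i := (delta_mx ord0 i : 'rV[R]_N).

(** [g] is twice the sum of the positive parts of the [<u_j, v>]; positive spanning and compactness
    give it a positive minimum on the unit sphere, and on [hpoly u h] it is at most twice the sum of
    the [|h_j|]. *)
Lemma spans_bound d (u : 'I_N -> 'rV[R]_d) : spans u ->
  exists2 C : R, 0 <= C & forall h x, hpoly u h x -> `|x| <= C * \sum_j `|h ord0 j|.
Proof.
move=> su; pose S := [set v : 'rV[R]_d | `|v| = 1].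
pose g (v : 'rV[R]_d) := \sum_j (dotp (u j) v + `|dotp (u j) v|).
have cg : continuous g.
  apply: continuous_sum => j x.
  apply: (@continuousD _ _ _ (dotp (u j)) (fun v => `|dotp (u j) v|)); first exact: dotp_continuous.
  by apply: (@continuous_comp _ _ _ (dotp (u j)) Num.norm); [exact: dotp_continuous|exact: norm_continuous].
have sum0 h : 0 <= \sum_j `|h ord0 j| by exact: sumr_ge0.
have [S0|S0] := pselect (S !=set0); last first.
  exists 0 => // h x _; rewrite mul0r; have [->|x0] := eqVneq x 0; first by rewrite normr0.
  case: S0; exists (`|x|^-1 *: x); rewrite /S /= normrZ ger0_norm ?invr_ge0//.
  by rewrite mulVf// normr_eq0.
have cS : compact S.
  apply: bounded_closed_compact; first by exists 1; split=> // y y1 v /= ->; exact: ltW.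
  apply: (@closed_comp _ _ (fun v : 'rV[R]_d => `|v|) [set 1]); last exact: closed_set1R.
  by move=> *; exact: norm_continuous.
have [v /[!inE] Sv Hv] := EVT_min_rV S0 cS (continuous_subspaceT cg).
have m0 : 0 < g v.
  rewrite lt_neqAle sumr_ge0 ?andbT; last by move=> j _; have := ler_norm (- dotp (u j) v); rewrite normrN; lra.
  apply/eqP => /esym g0; suff v0 : v = 0 by move: Sv; rewrite /S /= v0 normr0 => /eqP; rewrite eq_sym oner_eq0.
  apply: su => j; move/eqP: g0; rewrite psumr_eq0; last first.
    by move=> k _; have := ler_norm (- dotp (u k) v); rewrite normrN; lra.
  by move=> /allP/(_ j (mem_index_enum _))/eqP; have := normr_ge0 (dotp (u j) v); lra.
exists (2 / g v); first by rewrite divr_ge0// ltW.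
move=> h x Px; have [->|x0] := eqVneq x 0; first by rewrite normr0 mulr_ge0// divr_ge0// ltW.
have nx : 0 < `|x| by rewrite normr_gt0.
have Sx : S (`|x|^-1 *: x) by rewrite /S /= normrZ ger0_norm ?invr_ge0// mulVf// gt_eqF.
have := Hv _ (mem_set Sx).
have -> : g (`|x|^-1 *: x) = `|x|^-1 * g x.
  rewrite /g mulr_sumr; apply: eq_bigr => j _; rewrite dotpZr normrM ger0_norm ?invr_ge0//; ring.
have gx : g x <= 2 * \sum_j `|h ord0 j|.
  rewrite /g mulr_sumr; apply: ler_sum => j _; have := Px j; have := ler_norm (h ord0 j).
  have := normr_ge0 (h ord0 j); have [xj|xj] := leP 0 (dotp (u j) x).
    by rewrite (ger0_norm xj); lra.
  by rewrite (ltr0_norm xj); lra.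
rewrite mulrC ler_pdivlMr// => H; rewrite mulrAC ler_pdivlMr// mulrC.
exact: le_trans H gx.
Qed.

Lemma hpoly_closed d (u : 'I_N -> 'rV[R]_d) h : closed (hpoly u h).
Proof.
rewrite (_ : hpoly u h = \bigcap_(j : 'I_N) (dotp (u j) @^-1` [set r | r <= h ord0 j])).
  apply: closed_bigI => j _; apply: closed_comp; last exact: closed_le.
  by move=> *; exact: dotp_continuous.
by apply/seteqP; split=> x Hx j; [move=> _; exact: Hx|exact: (Hx j I)].
Qed.

Lemma hpoly_compact d (u : 'I_N -> 'rV[R]_d) h : spans u -> compact (hpoly u h).
Proof.
move=> su; apply: bounded_closed_compact; last exact: hpoly_closed.
have [C C0 HC] := spans_bound su; exists (C * \sum_j `|h ord0 j|); split; first by rewrite num_real.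
by move=> y Hy x /HC Hx; apply: le_trans Hx (ltW Hy).
Qed.

Lemma lredB d (u : 'I_N -> 'rV[R]_d.+1) i x y : lred u i (x - y) = lred u i x - lred u i y.
Proof. by apply/rowP => j; rewrite !mxE; ring. Qed.

Lemma lred_norm d (u : 'I_N -> 'rV[R]_d.+1) i :
  exists2 C : R, 0 < C & forall x, `|lred u i x| <= C * `|x|.
Proof.
exists (1 + \sum_j `|hd (u j) / hd (u i)|); first by rewrite ltr_pwDl// sumr_ge0.
move=> x; apply/rV_norm_leP => [|j]; first by rewrite mulr_ge0// addr_ge0// sumr_ge0.
rewrite mxE; apply: le_trans (ler_normB _ _) _; rewrite normrM mulrDl mul1r; apply: lerD.
  exact: rV_coord_le.
apply: ler_pM => //; last exact: rV_coord_le.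
by rewrite (bigD1 j)//= lerDl sumr_ge0.
Qed.

Lemma regular_open d D (u : 'I_N -> 'rV[R]_d) h : (forall j, j \in D -> u j = 0) ->
  (forall j, j \in D -> h ord0 j = 0) -> regular D u h ->
  exists2 e : R, 0 < e & forall h' : 'rV[R]_N, `|h - h'| < e ->
    (forall j, j \in D -> h' ord0 j = 0) -> regular D u h'.
Proof.
elim: d D u h => [|d IH] D u h du dh ru.
  have cv (h' : 'rV[R]_N) e j : `|h - h'| < e -> h ord0 j - e < h' ord0 j < h ord0 j + e.
    move=> /(le_lt_trans (rV_coord_le _ j)); rewrite !mxE ltr_norml => /andP[? ?].
    by apply/andP; split; lra.
  have [feas|/existsNP[j /negP]] := pselect (forall j, 0 <= h ord0 j); last first.
    rewrite -ltNge => hj; exists (- h ord0 j); first by lra.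
    move=> h' /(cv _ _ j)/andP[_ h1] _ Hf; have := Hf j; lra.
  have [j|e e0 He] := @exists_small R _ (fun j t => forall h' : 'rV[R]_N, `|h - h'| < t -> j \notin D -> 0 < h' ord0 j).
    have [jD|jD] := boolP (j \in D); first by exists 1.
    exists (h ord0 j); first exact: ru.
    by move=> t /andP[t0 th] h' /(cv _ _ j)/andP[h1 _] _; lra.
  exists (e / 2); first by lra.
  by move=> h' Hh' _ _ j; apply: (He (e / 2)) => //; lra.
have [i|e e0 He] := @exists_small R _ (fun i t => forall h' : 'rV[R]_N, `|h - h'| < t ->
    hd (u i) != 0 -> (forall j, j \in i |: D -> lred u i h' ord0 j = 0) ->
    regular (i |: D) (red u i) (lred u i h')).
  have [a0|a0] := eqVneq (hd (u i)) 0; first by exists 1 => // t _ h' _; rewrite a0 eqxx.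
  have [e e0 He] := IH _ _ _ (red_dead a0 du) (lred_zero a0 du dh) (ru i a0).
  have [C C0 HC] := lred_norm u i; exists (e / C); first by rewrite divr_gt0.
  move=> t /andP[t0 te] h' Hh' _; apply: He; rewrite -lredB; apply: le_lt_trans (HC _) _.
  by rewrite mulrC -ltr_pdivlMr// (lt_trans Hh').
exists (e / 2); first by lra.
move=> h' Hh' dh' i a0; apply: (He (e / 2)) => //; first by lra.
exact: lred_zero.
Qed.

(** The derivative of the diagonal of a symmetric multilinear form along a line, with a polynomial
    as witness so that the fundamental theorem of calculus applies. *)
Lemma mvform_line d (u : 'I_N -> 'rV[R]_d) h (x y : 'rV[R]_N) : gen_pos u ->
  exists p : {poly R}, (forall s, p.[s] = mvform u h (nseq d (x + s *: y))) /\
   (forall s, p^`().[s] = d%:R * mvform u h (y :: nseq d.-1 (x + s *: y))).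
Proof.
elim: d u h x y => [|d IH] u h x y gu.
  by exists (mvform u h [::])%:P; split=> s; rewrite ?derivC hornerE// mul0r.
have /choice[p Hp] : forall i, exists p : {poly R}, hd (u i) != 0 ->
   (forall s, p.[s] = mvform (red u i) (lred u i h) (nseq d (lred u i x + s *: lred u i y))) /\
   (forall s, p^`().[s] = d%:R * mvform (red u i) (lred u i h)
      (lred u i y :: nseq d.-1 (lred u i x + s *: lred u i y))).
  move=> i; have [a0|a0] := eqVneq (hd (u i)) 0; first by exists 0 => /negP[]; exact/eqP.
  by have [p Hp] := IH (red u i) (lred u i h) (lred u i x) (lred u i y) (gen_pos_red gu a0); exists p.
exists (\sum_i ((x ord0 i)%:P + y ord0 i *: 'X) * (`|hd (u i)|^-1 *: p i)).
have mapE i s k : map (lred u i) (nseq k (x + s *: y)) = nseq k (lred u i x + s *: lred u i y).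
  by rewrite map_nseq lredD lredZ.
split=> s.
  rewrite horner_sum /=; apply: eq_bigr => i _; rewrite !hornerE /=.
  have [->|a0] := eqVneq (hd (u i)) 0; first by rewrite normr0 invr0 !(mul0r,mulr0).
  rewrite (Hp i a0).1 mapE !mxE; ring.
rewrite linear_sum /= horner_sum.
transitivity (mvform u h (y :: nseq d (x + s *: y)) +
   d%:R * mvform u h (x + s *: y :: y :: nseq d.-1 (x + s *: y))).
  rewrite !mvformS mulr_sumr -big_split; apply: eq_bigr => i _ /=.
  rewrite derivM derivD derivC derivZ derivX derivZ !hornerE /=.
  have [->|a0] := eqVneq (hd (u i)) 0; first by rewrite normr0 invr0 !(mul0r,mulr0,addr0).
  rewrite (Hp i a0).1 (Hp i a0).2 !mapE !mxE; ring.
case: d u h x y gu IH p Hp mapE => [|d] u h x y gu IH p Hp mapE; first by rewrite mul0r addr0 mul1r.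
by rewrite [mvform u h (_ :: y :: _)]mvform_swap// -[d.+2%:R]natr1 mulrDl mul1r [RHS]addrC.
Qed.

Lemma poly_FTC (p : {poly R}) (a b : R) : a < b ->
  (\int[mu]_(x in `]a, b]) (p^`().[x])%:E = (p.[b] - p.[a])%:E)%E.
Proof.
move=> ab; rewrite integral_itv_obnd_cbnd; last first.
  apply/measurable_EFinP; apply: measurable_funTS; apply: continuous_measurable_fun.
  exact: continuous_horner.
rewrite (@continuous_FTC2 _ (horner p^`()) (horner p)) //.
- by apply: continuous_subspaceT; exact: continuous_horner.
- split; first by move=> x _; exact: derivable_horner.
    by apply: cvg_at_right_filter; exact: continuous_horner.
  by apply: cvg_at_left_filter; exact: continuous_horner.
- by move=> x _; rewrite derive1E; apply: derive_val.
Qed.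

(** Slice by the hyperplanes [<u_i, x> = h_i + r]. On such a slice the [i]-th constraint only says
    [r <= s], and the rest is the projected facet of the polytope whose [i]-th support number is
    [h_i + r]. *)
Lemma vol_facet d (u : 'I_N -> 'rV[R]_d.+1) h i (s : R) : spans u -> hd (u i) != 0 -> 0 < s ->
  let G := fun r => vol (hpoly (red u i) (lred u i (h + r *: evec i))) in
  measurable_fun `]0, s] G /\
  vol (hpoly u (h + s *: evec i)) =
  (vol (hpoly u h) + `|hd (u i)|^-1%:E * \int[mu]_(r in `]0%R, s]) G r)%E.
Proof.
move=> su a0 s0 G.
pose A t := hpoly u (h + t *: evec i).
have cA t : compact (A t) by exact: hpoly_compact.
pose g t r := vol [set v | A t (row_cons ((r + h ord0 i - dotp (tl (u i)) v) / hd (u i)) v)].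
have gE t : g t = G \_ `]-oo, t].
  apply/funext => r; rewrite patchE /g; case: ifPn => [|]; rewrite ?notin_setE ?inE /= in_itv /= => Hr.
    congr vol; apply/funext => v; apply/propext.
    have Er : (h + r *: evec i) ord0 i = r + h ord0 i by rewrite !mxE !eqxx mulr1 addrC.
    apply: (iff_trans _ (iff_sym (poly_red (h + r *: evec i) v a0))); rewrite Er.
    split=> H j; have := H j; rewrite !mxE /=; have [->|ji] := eqVneq j i; rewrite /= ?mulr0 ?mulr1//.
      by move=> _; rewrite dotp_cons; rewrite [X in X <= _](_ : _ = r + h ord0 i) 1?addrC//; field.
    by move=> /le_trans; apply; rewrite lerD2l.
  rewrite (_ : [set v | _] = set0) ?vol_set0//; apply/seteqP; split=> // v /= /(_ i).
  rewrite dotp_cons !mxE !eqxx mulr1 (_ : _ + dotp _ _ = r + h ord0 i); last by field.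
  by rewrite addrC lerD2r.
have mg t : measurable_fun setT (g t).
  pose B := [set x | A t (row_cons (hd x + dotp (- (hd (u i))^-1 *: tl (u i)) (tl x) + 0) (tl x))].
  have cB : compact B by exact: shear_compact.
  rewrite (_ : g t = fun r => vol (slice B ((hd (u i))^-1 * r + (hd (u i))^-1 * h ord0 i))).
    apply: (measurableT_comp (vol_slice_measurable cB)); exact: measurable_affine.
  apply/funext => r; congr vol; apply/funext => v; rewrite /slice /B /= hd_cons tl_cons dotpZl.
  congr (A t (row_cons _ _)); ring.
have mG (t : R) : measurable_fun `]-oo, t] G.
  by have := mg t; rewrite gE => H; exact: (measurable_restrictT G (measurable_itv _)).2 H.
have volA t : vol (A t) = (`|hd (u i)|^-1%:E * \int[mu]_(r in `]-oo, t]) G r)%E.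
  rewrite (vol_slice_dir (tl (u i)) a0 (cA t)); congr (_ * _)%E; rewrite [RHS]integral_mkcond -gE.
  have := @integral_shift R (h ord0 i)
    (fun r => vol [set v | A t (row_cons ((r - dotp (tl (u i)) v) / hd (u i)) v)]).
  move=> <- //; last by move=> r; exact: vol_ge0.
  rewrite (_ : (fun r => _) = fun r => g t (r - h ord0 i)); last first.
    by apply/funext => r; rewrite /g; congr vol; apply/funext => v; rewrite subrK.
  apply: (measurableT_comp (mg t)); exact: measurable_funB.
split; first by apply: measurable_funS (mG s) => //; exact: subset_itvr.
have -> : hpoly u h = A 0 by rewrite /A scale0r addr0.
rewrite -/(A s) !volA -ge0_muleDr; last 2 first.
- by apply: integral_ge0 => r _; exact: vol_ge0.
- by apply: integral_ge0 => r _; exact: vol_ge0.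
congr (_ * _)%E.
have E : `]-oo, s]%classic = `]-oo, 0%R] `|` `]0%R, s] :> set R.
  by rewrite -itv_bndbnd_setU// bnd_simp ltW.
rewrite E ge0_integral_setU//.
- by rewrite -E; exact: mG.
- by move=> r _; exact: vol_ge0.
- apply/disj_setPS => r [/=]; rewrite !in_itv /= => r1 /andP[r2 _]; lra.
Qed.

(** Reduces the comparison of [h] and [h'] to moves of a single support number, the case in which
    the volume changes by an integral over one facet. *)
Lemma coordinate_moves (B : set 'rV[R]_N) (T : Type) (f : 'rV[R]_N -> T) h h' :
  (forall z : 'rV[R]_N, (forall j, z ord0 j = h ord0 j \/ z ord0 j = h' ord0 j) -> B z) ->
  (forall z i s, B z -> B (z + s *: evec i) -> z ord0 i <> (z + s *: evec i) ord0 i -> 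
     z ord0 i = h ord0 i -> (z + s *: evec i) ord0 i = h' ord0 i -> f (z + s *: evec i) = f z) ->
  f h' = f h.
Proof.
move=> HB Hf; pose z k : 'rV[R]_N := \row_j (if (j < k)%N then h' ord0 j else h ord0 j).
have Bz k : B (z k) by apply: HB => j; rewrite mxE; case: ifP => _; [right|left].
suff H k : (k <= N)%N -> f (z k) = f h.
  by rewrite -(H N (leqnn _)); congr f; apply/rowP => j; rewrite mxE ltn_ord.
elim: k => [_|k IH kN]; first by congr f; apply/rowP => j; rewrite mxE.
rewrite -(IH (ltnW kN)); pose i := Ordinal kN.
have E : z k.+1 = z k + (h' ord0 i - h ord0 i) *: evec i.
  apply/rowP => j; rewrite !mxE /=; have [->|ji] := eqVneq j i.
    by rewrite ltnSn ltnn mulr1 addrC subrK.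
  rewrite mulr0 addr0 ltnS leq_eqVlt (_ : (j == k :> nat) = false)//.
  by apply/negbTE; apply: contra ji => /eqP ji; apply/eqP/val_inj.
have [e|ne] := eqVneq (h' ord0 i) (h ord0 i); first by rewrite E e subrr scale0r addr0.
rewrite E; apply: Hf => //; rewrite -?E //; rewrite !mxE /= ?ltnn ?ltnSn//.
by apply/eqP; rewrite eq_sym.
Qed.

(** The defect [f] between the volume and the form does not change when one support number moves,
    since both then vary by the same facet integral, known by induction. So [f (a *: h) = f h] for
    some [a > 1], while [f] is homogeneous of positive degree; hence it vanishes. *)
Lemma vol_hpoly d D (u : 'I_N -> 'rV[R]_d) h :
  gen_pos u -> spans u -> (forall j, j \in D -> u j = 0) ->
  (forall j, j \in D -> h ord0 j = 0) -> regular D u h ->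
  vol (hpoly u h) = (mvform u h (nseq d h) / d`!%:R)%:E.
Proof.
elim: d D u h => [|d IH] D u h gu su du dh ru.
  rewrite /= fact0 divr1; case: asboolP => [[x /poly0 Hx]|Hn].
    by case: ifP => // /negP[]; apply/forallP.
  by case: ifP => // /forallP Hx; case: Hn; exists 0; apply/poly0.
have [e e0 He] := regular_open du dh ru.
pose B := [set h' : 'rV[R]_N | `|h - h'| < e /\ forall j, j \in D -> h' ord0 j = 0].
have cB : chamber D u B.
  split=> //; last by move=> x [].
    move=> x y [x1 x2] [y1 y2] l /andP[l0 l1]; split; last by move=> j jD; rewrite !mxE x2// y2// !mulr0 addr0.
    have -> : h - (l *: x + (1 - l) *: y) = l *: (h - x) + (1 - l) *: (h - y).
      by apply/rowP => j; rewrite !mxE; ring.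
    apply: le_lt_trans (ler_normD _ _) _; rewrite !normrZ ger0_norm// ger0_norm ?subr_ge0//.
    have [->|l2] := eqVneq l 0; first by rewrite mul0r add0r subr0 mul1r.
    have : 0 < l by rewrite lt_neqAle eq_sym l2.
    by have := normr_ge0 (h - x); have := normr_ge0 (h - y); nra.
  by move=> x [x1 x2]; exact: He.
have Bh : B h by split=> //; rewrite subrr normr0.
pose f (h' : 'rV[R]_N) := fine (vol (hpoly u h')) - mvform u h (nseq d.+1 h') / d.+1`!%:R.
have step z i s : 0 < s -> B z -> B (z + s *: evec i) -> f (z + s *: evec i) = f z.
  move=> s0 Bz Bzs; have [p [p1 p2]] := mvform_line h z (evec i) gu.
  have p10 : p.[0] = mvform u h (nseq d.+1 z) by rewrite p1 scale0r addr0.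
  have [a0|a0] := eqVneq (hd (u i)) 0.
    (* A zero normal only tests the sign of its support number, which is positive outside [D] for a
       non-empty polytope of the chamber; the polytope stays the same. *)
    have ui := gen_pos_hd gu a0; rewrite /f.
    have -> : hpoly u (z + s *: evec i) = hpoly u z.
      have [Pz|Pz] := pselect (hpoly u z !=set0).
        have [x Hx] := chamber_interior cB Bz Pz; have [y Hy] := chamber_interior cB Bzs (nonempty_const cB Bz Bzs Pz).
        apply/seteqP; split=> w Hw j; have := Hw j; rewrite !mxE /=; have [->|ji] := eqVneq j i; rewrite /= ?mulr0 ?addr0//.
          have [iD|iD] := boolP (i \in D); first by rewrite (Bz.2 i iD) ui dotp0l.
          by move=> _; have := Hx i iD; rewrite ui !dotp0l; exact: ltW.
        by rewrite ui !dotp0l mulr1 => zi; rewrite addr_ge0// ltW.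
      have Pzs : ~ (hpoly u (z + s *: evec i) !=set0) by move=> /(nonempty_const cB Bzs Bz).
      by apply/seteqP; split=> w Hw; [case: Pzs|case: Pz]; exists w.
    congr (_ - _ / _); rewrite -p1 -p10.
    (* The derivative has the zero normal in its first slot and vanishes at every point, so already
       the points [0, 1, ...] are more roots than its degree allows. *)
    have pc : p^`() = 0.
      apply/eqP/negPn/negP => np.
      have := @max_poly_roots R p^`() [seq k%:R | k <- iota 0 (size p^`())] np.
      rewrite size_map size_iota ltnn => H; suff : false by []; apply: H.
        apply/allP => _ /mapP[k _ ->]; rewrite /root p2 mvformS (bigD1 i)//= big1.
          by rewrite mxE !eqxx a0 normr0 invr0 mulr0 mul0r addr0 mulr0.
        by move=> j ji; rewrite mxE (negbTE ji) !mul0r.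
      by rewrite map_inj_uniq ?iota_uniq//; exact: mulrIn (oner_neq0 _).
    have : (\int[mu]_(x in `]0%R, s]) (p^`().[x])%:E = 0)%E by rewrite pc; apply: integral0_eq => x _; rewrite horner0.
    by rewrite poly_FTC// => -[] /eqP; rewrite subr_eq0 => /eqP.
  have [mG E] := vol_facet z su a0 s0.
  pose q := (`|hd (u i)| / d.+1`!%:R) *: p.
  have dq : q^`() = (`|hd (u i)| / d.+1`!%:R) *: p^`() by rewrite derivZ.
  have na : `|hd (u i)| != 0 by rewrite normr_eq0.
  have nf : d.+1`!%:R != 0 :> R by rewrite pnatr_eq0 -lt0n fact_gt0.
  have int : (\int[mu]_(r in `]0%R, s]) vol (hpoly (red u i) (lred u i (z + r *: evec i))) =
      (q.[s] - q.[0])%:E)%E.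
    rewrite -poly_FTC//; apply: eq_integral => r; rewrite inE /= in_itv /= => /andP[r0 rs].
    have Br : B (z + r *: evec i).
      have -> : z + r *: evec i = (r / s) *: (z + s *: evec i) + (1 - r / s) *: z.
        by apply/rowP => j; rewrite !mxE; field; rewrite gt_eqF.
      by apply: (chamber_convex cB) => //; apply/andP; split; [exact: divr_ge0 (ltW r0) (ltW s0)|rewrite ler_pdivrMr// mul1r].
    have cBi := chamber_red cB a0.
    rewrite (IH (i |: D)).
    - rewrite dq hornerZ p2 mvformS (bigD1 i)//= big1 ?addr0; last first.
        by move=> j ji; rewrite mxE (negbTE ji) !mul0r.
      rewrite mxE !eqxx mul1r map_nseq (mvform_const _ cBi (h' := lred u i h)); last 2 first.
        by exists (z + r *: evec i).
        by exists h.
      congr (_%:E); rewrite factS natrM; field.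
      by rewrite na pnatr_eq0 -lt0n fact_gt0 /= addrC natr1 pnatr_eq0.
    - exact: chamber_gen cBi.
    - exact: chamber_spans cBi.
    - exact: chamber_dead cBi.
    - by apply: (chamber_zero cBi); exists (z + r *: evec i).
    - by apply: (chamber_reg cBi); exists (z + r *: evec i).
  have fz : vol (hpoly u z) \is a fin_num by apply: vol_fin_num; exact: hpoly_compact.
  rewrite /f E int -EFinM fineD//.
  rewrite -p1 -p10; set F0 := fine (vol _); rewrite /= !hornerZ.
  by field; rewrite nf na.
have step' z i s : s != 0 -> B z -> B (z + s *: evec i) -> f (z + s *: evec i) = f z.
  move=> s0 Bz Bzs; have [sn|sp|/eqP] := ltgtP s 0; last by rewrite (negbTE s0).
    have zE : z = z + s *: evec i + (- s) *: evec i by rewrite scaleNr addrK.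
    by have := step (z + s *: evec i) i (- s); rewrite -zE oppr_gt0 => ->.
  exact: step.
(* Makes [t * |h| < e], so that the box between [h] and [(1 + t) *: h] lies in [B]; the [+ 1] covers
   [h = 0]. *)
pose t := e / (2 * (`|h| + 1)).
have h1 : 0 < `|h| + 1 by rewrite ltr_wpDl.
have t0 : 0 < t by rewrite divr_gt0// mulr_gt0.
have th : t * `|h| < e.
  rewrite /t mulrAC ltr_pdivrMr ?mulr_gt0//; have := normr_ge0 h; nra.
pose a := 1 + t.
have fa : f (a *: h) = f h.
  apply: (@coordinate_moves B).
    move=> z Hz; split; last by move=> j jD; case: (Hz j) => ->; rewrite ?mxE dh// mulr0.
    apply: le_lt_trans th; apply/rV_norm_leP => [|j]; first by rewrite mulr_ge0// ltW.
    rewrite !mxE; case: (Hz j) => ->; first by rewrite subrr normr0 mulr_ge0// ltW.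
    rewrite mxE; have -> : h ord0 j - a * h ord0 j = - (t * h ord0 j) by rewrite /a; ring.
    rewrite normrN normrM.
    by rewrite (gtr0_norm t0) ler_pM2l// rV_coord_le.
  move=> z i s Bz Bzs zi _ _; apply: step' => //; apply/eqP => s0.
  by apply: zi; rewrite s0 scale0r addr0.
have a0 : 0 < a by rewrite /a; lra.
have fs : f (a *: h) = a ^+ d.+1 * f h.
  rewrite /f mulrBr; congr (_ - _); last first.
    rewrite mulrA; congr (_ / _); rewrite -mvform_scale ?size_nseq//.
    by rewrite map_nseq.
  rewrite (_ : hpoly u (a *: h) = [set x | hpoly u h (a^-1 *: x)]); last first.
    by apply/funext => x; apply/propext; split=> H j; have := H j; rewrite mxE dotpZr ler_pdivrMl.
  rewrite vol_scale ?invr_gt0//; last exact: hpoly_compact.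
  have fh : vol (hpoly u h) \is a fin_num by apply: vol_fin_num; exact: hpoly_compact.
  by rewrite fineM//; congr (_ * _); rewrite /= exprVn invrK.
have f0 : f h = 0.
  move: fs; rewrite fa => /eqP; rewrite -subr_eq0 -{1}[f h]mul1r -mulrBl mulf_eq0 => /orP[|/eqP//].
  have a1 : 1 < a by rewrite /a; lra.
  have a2 : 1 < a ^+ d.+1 by rewrite exprn_egt1.
  by rewrite subr_eq0 => /eqP E; rewrite -E ltxx in a2.
by move/eqP: f0; rewrite /f subr_eq0 => /eqP <-; rewrite fineK//; apply: vol_fin_num; exact: hpoly_compact.
Qed.

End VolumeFormula.

(** * Hyperbolicity of a quadratic form from a Bochner inequality and connectedness *)

Section Hyperbolicity.
Variables (R : realType) (N : nat) (A : 'I_N -> 'I_N -> R).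
Implicit Types x y z : 'rV[R]_N.

Definition qform x y : R := \sum_i \sum_j A i j * x ord0 i * y ord0 j.

Lemma qformDl x y z : qform (x + y) z = qform x z + qform y z.
Proof.
rewrite /qform -big_split; apply: eq_bigr => i _; rewrite -big_split; apply: eq_bigr => j _.
rewrite /= mxE; ring.
Qed.

Lemma qformZl a x y : qform (a *: x) y = a * qform x y.
Proof.
rewrite /qform mulr_sumr; apply: eq_bigr => i _; rewrite mulr_sumr; apply: eq_bigr => j _.
rewrite /= mxE; ring.
Qed.

Lemma qform0l y : qform 0 y = 0.
Proof. by rewrite /qform big1// => i _; rewrite big1// => j _; rewrite mxE mulr0 mul0r. Qed.

Hypothesis symA : forall i j, A i j = A j i.

Lemma qformC x y : qform x y = qform y x.
Proof.
rewrite /qform exchange_big; apply: eq_bigr => i _; apply: eq_bigr => j _.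
by rewrite symA; ring.
Qed.

Lemma qformDr x y z : qform z (x + y) = qform z x + qform z y.
Proof. by rewrite qformC qformDl !(qformC z). Qed.

Lemma qformZr a x y : qform x (a *: y) = a * qform x y.
Proof. by rewrite qformC qformZl qformC. Qed.

Lemma qform_continuous : continuous (fun x => qform x x).
Proof.
apply: continuous_sum => i; apply: continuous_sum => j x.
apply: (@continuousM _ _ (fun x : 'rV[R]_N => A i j * x ord0 i) (fun x : 'rV[R]_N => x ord0 j));
  last exact: rV_coord_continuous.
by apply: (@continuousM _ _ (fun=> A i j) (fun x : 'rV[R]_N => x ord0 i));
  [exact: cst_continuous|exact: rV_coord_continuous].
Qed.

Variables (J : {set 'I_N}) (p : 'rV[R]_N).
Hypothesis A_J : forall i j, i \notin J -> A i j = 0.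
Hypothesis A_ge0 : forall i j, i != j -> 0 <= A i j.
Hypothesis p_gt0 : forall i, i \in J -> 0 < p ord0 i.
Let r i := \sum_j A i j * p ord0 j.
Hypothesis r_gt0 : forall i, i \in J -> 0 < r i.
Hypothesis bochner : forall x,
  qform x x <= \sum_(i in J) p ord0 i / r i * (\sum_j A i j * x ord0 j) ^+ 2.
Hypothesis conn : forall S : {set 'I_N}, S \subset J -> S != finset.set0 -> S != J ->
  exists i j, [/\ i \in S, j \in J, j \notin S & 0 < A i j].

(** With these weights the operator [(A x)_i / w_i] represents the form in the inner product [ip],
    has [p] as an eigenvector of eigenvalue 1, and turns [bochner] into the comparison of its first
    and second powers. *)
Let w i := r i / p ord0 i.
Let ip x y := \sum_(i in J) w i * x ord0 i * y ord0 i.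
Let w_gt0 i : i \in J -> 0 < w i.
Proof. by move=> iJ; rewrite divr_gt0 ?r_gt0 ?p_gt0. Qed.

Let qform_p x : qform x p = ip x p.
Proof.
rewrite /ip [RHS]big_mkcond /=; apply: eq_bigr => i _; case: ifPn => iJ.
  rewrite /w (_ : _ * _ = x ord0 i * r i); last by field; rewrite gt_eqF ?p_gt0.
  by rewrite /r mulr_sumr; apply: eq_bigr => j _; ring.
by rewrite big1// => j _; rewrite A_J// !mul0r.
Qed.

Let supp x := forall i, i \notin J -> x ord0 i = 0.

Let ip_continuous y : continuous (fun x => ip x y).
Proof.
rewrite /ip; under eq_fun do rewrite big_mkcond.
apply: continuous_sum => i; case: (i \in J); last by move=> x; exact: cst_continuous.
move=> x; apply: (@continuousM _ _ (fun x : 'rV[R]_N => w i * x ord0 i) (fun=> y ord0 i)); last exact: cst_continuous.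
by apply: (@continuousM _ _ (fun=> w i) (fun x : 'rV[R]_N => x ord0 i));
  [exact: cst_continuous|exact: rV_coord_continuous].
Qed.

Let ip2_continuous : continuous (fun x => ip x x).
Proof.
rewrite /ip; under eq_fun do rewrite big_mkcond.
apply: continuous_sum => i; case: (i \in J); last by move=> x; exact: cst_continuous.
move=> x; apply: (@continuousM _ _ (fun x : 'rV[R]_N => w i * x ord0 i) (fun x : 'rV[R]_N => x ord0 i)); last exact: rV_coord_continuous.
by apply: (@continuousM _ _ (fun=> w i) (fun x : 'rV[R]_N => x ord0 i));
  [exact: cst_continuous|exact: rV_coord_continuous].
Qed.

Let ipDl x y z : ip (x + y) z = ip x z + ip y z.
Proof. by rewrite /ip -big_split; apply: eq_bigr => i _; rewrite /= mxE; ring. Qed.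
Let ipZl a x y : ip (a *: x) y = a * ip x y.
Proof. by rewrite /ip mulr_sumr; apply: eq_bigr => i _; rewrite /= mxE; ring. Qed.
Let ip0l y : ip 0 y = 0.
Proof. by rewrite /ip big1// => i _; rewrite mxE mulr0 mul0r. Qed.
Let ipC x y : ip x y = ip y x.
Proof. by apply: eq_bigr => i _; ring. Qed.

Let ip_ge0 x : 0 <= ip x x.
Proof. by apply: sumr_ge0 => i iJ; rewrite -mulrA -expr2 mulr_ge0 ?sqr_ge0// ltW// w_gt0. Qed.

Let ip_eq0 x : supp x -> ip x x = 0 -> x = 0.
Proof.
move=> sx /eqP; rewrite psumr_eq0; last first.
  by move=> i iJ; rewrite -mulrA -expr2 mulr_ge0 ?sqr_ge0// ltW// w_gt0.
move=> /allP H; apply/rowP => i; rewrite mxE; have [iJ|/sx//] := boolP (i \in J).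
have := H i (mem_index_enum _); rewrite iJ /= -mulrA -expr2 mulf_eq0 (gt_eqF (w_gt0 iJ)) /=.
by rewrite sqrf_eq0 => /eqP.
Qed.

(** The gap between [ip] and [qform] is a Dirichlet energy of [x / p] on the graph with edge weights
    [A i j * p_i * p_j]; the diagonal terms match because [p] has eigenvalue 1. *)
Let perron x : supp x -> qform x x = ip x x -
  2^-1 * \sum_i \sum_j A i j * p ord0 i * p ord0 j * (x ord0 i / p ord0 i - x ord0 j / p ord0 j) ^+ 2.
Proof.
move=> sx.
have term i j : A i j * p ord0 i * p ord0 j * (x ord0 i / p ord0 i - x ord0 j / p ord0 j) ^+ 2 =
  A i j * p ord0 j * (x ord0 i ^+ 2 / p ord0 i) + A j i * p ord0 i * (x ord0 j ^+ 2 / p ord0 j)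
   - 2 * (A i j * x ord0 i * x ord0 j).
  have [iJ|iJ] := boolP (i \in J); last by rewrite (symA j i) A_J// !mul0r; ring.
  have [jJ|jJ] := boolP (j \in J); last by rewrite (symA i j) A_J// !mul0r; ring.
  by rewrite (symA j i); field; rewrite !gt_eqF ?p_gt0.
under eq_bigr => i _ do (under eq_bigr => j _ do rewrite term; rewrite sumrB big_split /=).
rewrite sumrB big_split /= [X in _ + X - _]exchange_big /=.
have -> : \sum_i \sum_j A i j * p ord0 j * (x ord0 i ^+ 2 / p ord0 i) = ip x x.
  rewrite /ip [RHS]big_mkcond /=; apply: eq_bigr => i _; case: ifPn => iJ.
    rewrite -mulr_suml -/(r i) /w; ring.
  by rewrite big1// => j _; rewrite A_J// !mul0r.
have -> : \sum_i \sum_j 2 * (A i j * x ord0 i * x ord0 j) = 2 * qform x x.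
  by rewrite /qform mulr_sumr; apply: eq_bigr => i _; rewrite mulr_sumr.
by field.
Qed.

Let hyperbolic_ortho x : qform x p = 0 -> qform x x <= 0.
Proof.
move=> xp; rewrite leNgt; apply/negP => qx.
(* The form ignores the coordinates outside [J], and [ip] is definite only on vectors supported in
   [J]. *)
pose restr x : 'rV[R]_N := \row_i (if i \in J then x ord0 i else 0).
have restrE z y : qform (restr z) y = qform z y.
  apply: eq_bigr => i _; apply: eq_bigr => j _; rewrite mxE; case: ifPn => // iJ.
  by rewrite A_J// !mul0r.
have srestr z : supp (restr z) by move=> i iJ; rewrite mxE (negbTE iJ).
pose K := [set z | [/\ supp z, ip z p = 0 & ip z z = 1]].
have [K0 qK] : K !=set0 /\ exists2 z, K z & 0 < qform z z.
  have n0 : 0 < ip (restr x) (restr x).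
    rewrite lt_neqAle ip_ge0 andbT eq_sym; apply/eqP => /(ip_eq0 (srestr x)) x0.
    by move: qx; rewrite -restrE qformC -restrE x0 qform0l ltxx.
  pose c := (Num.sqrt (ip (restr x) (restr x)))^-1.
  have c0 : 0 < c by rewrite invr_gt0 sqrtr_gt0.
  have Kc : K (c *: restr x).
    split; first by move=> i iJ; rewrite mxE srestr// mulr0.
      by rewrite ipZl -qform_p restrE xp mulr0.
    rewrite ipZl ipC ipZl mulrA -expr2 /c exprVn sqr_sqrtr ?ip_ge0// mulVf// gt_eqF//.
  split; exists (c *: restr x) => //.
  by rewrite qformZl qformZr restrE qformC restrE !mulr_gt0.
have cK : compact K.
  apply: bounded_closed_compact.
    exists (1 + \sum_(i in J) (w i)^-1); split; first by rewrite num_real.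
    move=> y Hy z [sz _ zz].
    have s0 : 0 <= \sum_(i in J) (w i)^-1 by apply: sumr_ge0 => i iJ; rewrite invr_ge0 ltW// w_gt0.
    apply: le_trans (ltW Hy); apply/rV_norm_leP => [|i]; first by rewrite addr_ge0.
    have [iJ|/sz ->] := boolP (i \in J); last by rewrite normr0 addr_ge0.
    have wi := w_gt0 iJ.
    have H1 : (z ord0 i) ^+ 2 <= (w i)^-1.
      rewrite -[leRHS]mulr1 ler_pdivlMl// -zz /ip (bigD1 i)//= -mulrA -expr2 lerDl.
      by apply: sumr_ge0 => j /andP[jJ _]; rewrite -mulrA -expr2 mulr_ge0 ?sqr_ge0// ltW// w_gt0.
    have H2 : (w i)^-1 <= \sum_(i in J) (w i)^-1.
      by rewrite (bigD1 i)//= lerDl; apply: sumr_ge0 => j /andP[jJ _]; rewrite invr_ge0 ltW// w_gt0.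
    have := sqr_ge0 (`|z ord0 i| - 1); rewrite -real_normK ?num_real// in H1; have := normr_ge0 (z ord0 i); nra.
  rewrite (_ : K = (\bigcap_(i in [set i | i \notin J]) ((fun z => z ord0 i) @^-1` [set 0])) `&`
     ((fun z => ip z p) @^-1` [set 0] `&` (fun z => ip z z) @^-1` [set 1])); last first.
    by apply/seteqP; split=> [z [? ? ?]|z [? [? ?]]]; [split|split].
  apply: closedI; [apply: closed_bigI => i _|apply: closedI]; apply: closed_comp;
    try exact: closed_set1R; move=> z _;
    [exact: rV_coord_continuous|exact: ip_continuous|exact: ip2_continuous].
have [z /[!inE] Kz Hz] := EVT_max_rV K0 cK (continuous_subspaceT qform_continuous).
pose m := qform z z.
have m0 : 0 < m by have [y Ky qy] := qK; apply: lt_le_trans (Hz _ (mem_set Ky)).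
have [sz zp zz] := Kz.
have hom y : supp y -> ip y p = 0 -> qform y y <= m * ip y y.
  move=> sy yp; have [y0|n0] := eqVneq (ip y y) 0.
    by rewrite (ip_eq0 sy y0) qform0l ip0l mulr0.
  have {}n0 : 0 < ip y y by rewrite lt_neqAle eq_sym n0 ip_ge0.
  pose c := (Num.sqrt (ip y y))^-1.
  have c2 : c ^+ 2 = (ip y y)^-1 by rewrite /c exprVn sqr_sqrtr ?ip_ge0.
  have Kc : K (c *: y).
    split; first by move=> i iJ; rewrite mxE sy// mulr0.
      by rewrite ipZl yp mulr0.
    by rewrite ipZl ipC ipZl mulrA -expr2 c2 mulVf// gt_eqF.
  have := Hz _ (mem_set Kc); rewrite qformZl qformZr mulrA -expr2 c2 -/m mulrC ler_pdivrMr//.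
(* First variation at the maximiser: [2 t b + t^2 c] is non-negative for all [t], and the choice
   [t = - b / c], or [t = - b] when [c = 0], forces [b = 0]. *)
have euler y : supp y -> ip y p = 0 -> qform z y = m * ip z y.
  move=> sy yp.
  pose b := m * ip z y - qform z y; pose c := m * ip y y - qform y y.
  have ineq t : 0 <= 2 * t * b + t ^+ 2 * c.
    have sty : supp (z + t *: y) by move=> i iJ; rewrite !mxE sz// sy// mulr0 addr0.
    have := hom _ sty; rewrite ipDl ipZl zp yp mulr0 addr0 => /(_ erefl).
    rewrite !qformDl !qformDr !qformZl !qformZr (qformC y z) -/m.
    rewrite !ipDl !ipZl (ipC z) (ipC y) !ipDl !ipZl (ipC y z) zz /b /c; nra.
  have c0 : 0 <= c by have := hom y sy yp; rewrite /c; lra.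
  have : b = 0; last by rewrite /b; lra.
  have [c00|cn] := eqVneq c 0.
    have := ineq (- b); rewrite c00 mulr0 addr0; nra.
  have cp : 0 < c by rewrite lt_neqAle eq_sym cn c0.
  have := ineq (- b / c).
  rewrite (_ : 2 * _ * _ + _ = - (b ^+ 2 / c)); last by field.
  rewrite oppr_ge0 pmulr_lle0 ?invr_gt0// => b2; apply/eqP; rewrite -sqrf_eq0 eq_le b2 sqr_ge0//.
have pp : 0 < ip p p.
  have [i iJ] : exists i, i \in J.
    apply: contrapT => H; suff z0 : z = 0 by move: zz; rewrite z0 ip0l => /eqP; rewrite eq_sym oner_eq0.
    by apply/rowP => i; rewrite mxE; apply: sz; apply/negP => iJ; apply: H; exists i.
  rewrite /ip (bigD1 i)//; apply: ltr_pwDl.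
    exact: mulr_gt0 (mulr_gt0 (w_gt0 iJ) (p_gt0 iJ)) (p_gt0 iJ).
  apply: sumr_ge0 => j /andP[jJ _]; apply: ltW.
  exact: mulr_gt0 (mulr_gt0 (w_gt0 jJ) (p_gt0 jJ)) (p_gt0 jJ).
(* The Euler equation holds only orthogonally to [p], so it is tested on the basis vector minus its
   [p]-component; that component contributes nothing, as [z] is orthogonal to [p]. *)
have eig i : i \in J -> \sum_j A i j * z ord0 j = m * w i * z ord0 i.
  move=> iJ; pose e : 'rV[R]_N := delta_mx ord0 i.
  have eE y : ip e y = w i * y ord0 i.
    rewrite /ip (bigD1 i)//= big1 ?addr0; first by rewrite mxE !eqxx mulr1.
    by move=> j /andP[_ ji]; rewrite mxE (negbTE ji) mulr0 mul0r.
  have qE y : qform e y = \sum_j A i j * y ord0 j.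
    rewrite /qform (bigD1 i)//= [X in _ + X]big1 ?addr0.
      by apply: eq_bigr => j _; rewrite mxE !eqxx mulr1.
    by move=> k ki; rewrite big1// => j _; rewrite mxE (negbTE ki) mulr0 mul0r.
  pose rp := restr p.
  have iprp y : ip y rp = ip y p by apply: eq_bigr => j jJ; rewrite mxE jJ.
  pose al := ip e p / ip p p.
  have qrp : qform z rp = 0 by rewrite qformC restrE qformC qform_p.
  have irp : ip rp z = 0 by rewrite ipC iprp.
  have ize : ip z (e + (- al) *: rp) = w i * z ord0 i.
    by rewrite ipC ipDl ipZl irp mulr0 addr0 eE.
  have := euler (e + (- al) *: rp).
  rewrite ize qformDr qformZr qrp mulr0 addr0 (qformC z e) qE => ->.
  - by rewrite mulrA.
  - move=> j jJ; rewrite !mxE (negbTE jJ) mulr0 addr0 /=; case: eqP => // ji.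
    by move: jJ; rewrite ji iJ.
  - by rewrite ipDl ipZl (ipC rp) iprp /al; field; rewrite gt_eqF.
(* On an eigenvector [bochner] reads [m <= m ^+ 2]. *)
have m1 : 1 <= m.
  have := bochner z; rewrite -/m (eq_bigr (fun i => m ^+ 2 * (w i * z ord0 i * z ord0 i))); last first.
    move=> i iJ; rewrite eig// /w; field.
    by rewrite !gt_eqF ?p_gt0 ?r_gt0.
  by rewrite -mulr_sumr -/(ip z z) zz mulr1 expr2 -{1}[m]mulr1 ler_pM2l.
have := perron sz; rewrite -/m zz => pe.
have tge0 i j : 0 <= A i j * p ord0 i * p ord0 j * (z ord0 i / p ord0 i - z ord0 j / p ord0 j) ^+ 2.
  have [->|ij] := eqVneq i j; first by rewrite subrr expr0n mulr0.
  have [iJ|iJ] := boolP (i \in J); last by rewrite A_J// !mul0r.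
  have [jJ|jJ] := boolP (j \in J); last by rewrite symA A_J// !mul0r.
  exact: mulr_ge0 (mulr_ge0 (mulr_ge0 (A_ge0 ij) (ltW (p_gt0 iJ))) (ltW (p_gt0 jJ))) (sqr_ge0 _).
(* The energy is [2 (1 - m) <= 0], hence zero: [z / p] is constant along edges, thus on all of [J]
   by connectedness, and a multiple of [p] orthogonal to [p] is zero. *)
have sum0 : \sum_i \sum_j A i j * p ord0 i * p ord0 j * (z ord0 i / p ord0 i - z ord0 j / p ord0 j) ^+ 2 = 0.
  apply/eqP; rewrite eq_le; apply/andP; split; first by lra.
  by apply: sumr_ge0 => i _; apply: sumr_ge0.
have t0 i j : A i j * p ord0 i * p ord0 j * (z ord0 i / p ord0 i - z ord0 j / p ord0 j) ^+ 2 = 0.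
  move/eqP: sum0; rewrite psumr_eq0; last by move=> k _; apply: sumr_ge0.
  move=> /allP/(_ i (mem_index_enum _)) /=; rewrite psumr_eq0//.
  by move=> /allP/(_ j (mem_index_enum _)) /= /eqP.
have [i0 i0J] : exists i, i \in J.
  apply: contrapT => H; move: pp; rewrite /ip big1 ?ltxx// => i iJ.
  by case: H; exists i.
pose S : {set 'I_N} := finset (fun i => (i \in J) && (z ord0 i / p ord0 i == z ord0 i0 / p ord0 i0)).
have SJ : S = J.
  apply/eqP/negPn/negP => SnJ.
  have [|||i [j [iS jJ jS Aij]]] := @conn S.
  - by apply/fintype.subsetP => i; rewrite inE => /andP[].
  - by apply/finset.set0Pn; exists i0; rewrite inE i0J eqxx.
  - exact: SnJ.
  move: iS jS; rewrite !inE jJ /= => /andP[iJ /eqP ei] /negP[].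
  move/eqP: (t0 i j); rewrite !mulf_eq0 (gt_eqF Aij) (gt_eqF (p_gt0 iJ)) (gt_eqF (p_gt0 jJ)) /=.
  by rewrite orbb subr_eq0 ei eq_sym.
have zE i : i \in J -> z ord0 i = z ord0 i0 / p ord0 i0 * p ord0 i.
  by move=> iJ; move: (iJ); rewrite -SJ inE => /andP[_ /eqP <-]; rewrite divfK// gt_eqF// p_gt0.
have : ip z p = z ord0 i0 / p ord0 i0 * ip p p.
  by rewrite /ip mulr_sumr; apply: eq_bigr => i iJ; rewrite zE//; ring.
rewrite zp => /esym/eqP; rewrite mulf_eq0 (gt_eqF pp) orbF => /eqP y0.
have z0 : z = 0 by apply/rowP => i; rewrite mxE; have [/zE ->|/sz//] := boolP (i \in J); rewrite y0 mul0r.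
by move: zz; rewrite z0 ip0l => /eqP; rewrite eq_sym oner_eq0.
Qed.

(* The maximiser of [qform] on the unit sphere of [ip], orthogonally to [p], is an
   eigenvector; [bochner] forces its eigenvalue to be at least 1 and the
   Perron-Frobenius argument forces it to be less than 1. *)
Lemma qform_hyperbolic x : qform x x * qform p p <= qform x p ^+ 2.
Proof.
have qp : 0 <= qform p p by rewrite qform_p ip_ge0.
have [p0|pn] := eqVneq (qform p p) 0; first by rewrite p0 mulr0 sqr_ge0.
have pp : 0 < qform p p by rewrite lt_neqAle eq_sym pn.
pose c := - (qform x p / qform p p).
have := @hyperbolic_ortho (x + c *: p).
rewrite qformDl qformZl !qformDl !qformDr !qformZl !qformZr (qformC p x) => H.
have : qform x x + c * qform x p + (c * qform x p + c * (c * qform p p)) <= 0.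
  by apply: H; rewrite /c; field.
rewrite (_ : _ + _ = qform x x - qform x p ^+ 2 / qform p p); last by rewrite /c; field.
by rewrite subr_le0 ler_pdivlMr.
Qed.

End Hyperbolicity.

(** * Connectedness of the facet graph *)

Section FacetGraph.
Variables (R : realType) (N : nat).
Implicit Types (h : 'rV[R]_N) (D : {set 'I_N}).

Lemma continuous_bigmax (T : topologicalType) I (r : seq I) (F : I -> T -> R) (F0 : T -> R) :
  continuous F0 -> (forall i, continuous (F i)) ->
  continuous (fun x => \big[Num.max/F0 x]_(i <- r) F i x).
Proof.
move=> cF0 cF; elim: r => [|i r IH] x.
  by under eq_fun do rewrite big_nil; exact: cF0.
under eq_fun do rewrite big_cons.
by apply: (@continuous_max _ _ (F i) (fun x => \big[Num.max/F0 x]_(i <- r) F i x)); [exact: cF|exact: IH].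
Qed.

Lemma bigmax_attained (I : finType) (P : {set I}) (F : I -> R) i0 : i0 \in P ->
  exists2 i, i \in P & \big[Num.max/F i0]_(i <- enum P) F i = F i.
Proof.
move=> Pi0; have : {subset enum P <= P} by move=> i; rewrite mem_enum.
elim: (enum P) => [|i s IH] sP; first by exists i0; rewrite ?big_nil.
have [|j Pj Ej] := IH; first by move=> j js; apply: sP; rewrite in_cons js orbT.
rewrite big_cons Ej; have [le|lt] := leP (F i) (F j); first by exists j.
by exists i => //; apply: sP; rewrite mem_head.
Qed.

Lemma bigmax_ge_enum (I : finType) (P : {set I}) (F : I -> R) x i : i \in P ->
  F i <= \big[Num.max/x]_(j <- enum P) F j.
Proof. by move=> Pi; apply: le_bigmax_seq => //; rewrite mem_enum. Qed.

Definition facets d (u : 'I_N -> 'rV[R]_d.+1) h : {set 'I_N} :=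
  finset (fun i => (hd (u i) != 0) && `[< hpoly (red u i) (lred u i h) !=set0 >]).

Lemma facetsP d (u : 'I_N -> 'rV[R]_d.+1) h i :
  i \in facets u h <-> hd (u i) != 0 /\ hpoly (red u i) (lred u i h) !=set0.
Proof. by rewrite inE; split=> [/andP[? /asboolP]|[-> /asboolP ->]]. Qed.

Lemma facet_lift d (u : 'I_N -> 'rV[R]_d.+1) h i v : hd (u i) != 0 ->
  hpoly (red u i) (lred u i h) v ->
  exists x, [/\ hpoly u h x, dotp (u i) x = h ord0 i & tl x = v].
Proof.
move=> a0 /(poly_red _ _ a0) Hv; eexists; split; first exact: Hv.
  by rewrite dotp_cons; field.
by rewrite tl_cons.
Qed.

(* The boundary of a polytope of dimension at least 2 is connected: a segment
   between points of two facets that avoids an interior point is projected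
   radially to the boundary. *)
Lemma facets_connected d D (u : 'I_N -> 'rV[R]_d.+2) U h (S : {set 'I_N}) :
  chamber D u U -> U h -> S \subset facets u h -> S != finset.set0 -> S != facets u h ->
  exists i j, [/\ i \in S, j \in facets u h, j \notin S, hd (red u i j) != 0 &
    hpoly (red (red u i) j) (lred (red u i) j (lred u i h)) !=set0].
Proof.
move=> cU Uh SJ S0 SnJ; set J := facets u h in SJ SnJ *.
have [i0 i0S] : exists i, i \in S by exact/finset.set0Pn.
have [j0 j0J j0S] : exists2 j, j \in J & j \notin S.
  by have /fintype.properP[_ [j jJ jS]] : S \proper J by [rewrite finset.properEneq SnJ]; exists j.
have i0J : i0 \in J by apply: (fintype.subsetP SJ).
have [a0 Pi0] := (facetsP _ _ _).1 i0J.
have Ph : hpoly u h !=set0 by exact: poly_red_nonempty a0 Pi0.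
have [og Ho] := chamber_interior cU Uh Ph.
have notD i : i \in J -> i \notin D.
  by move=> /facetsP[ai _]; apply/negP => /(hd_dead (chamber_dead cU)) /eqP; rewrite (negbTE ai).
have [v Hv] : exists v, forall j, j \notin i0 |: D -> dotp (red u i0 j) v < lred u i0 h ord0 j.
  apply: (chamber_interior (chamber_red cU a0) _ Pi0); exact: imageP.
(* Two points [a] and [a'] of the facet [i0] are prepared. If the segments from both to [b] passed
   through [og], they would be the same point: the line through [b] and [og] meets the hyperplane of
   [i0] once. *)
pose e1 : 'rV[R]_d.+1 := row_cons 1 0.
have [t t0 Ht] := @small_slack R _ (fun j => j \notin i0 |: D) (fun j => dotp (red u i0 j) v)
   (fun j => lred u i0 h ord0 j) (fun j => dotp (red u i0 j) e1) Hv.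
have Pv s : s = 0 \/ 0 < s < t -> hpoly (red u i0) (lred u i0 h) (v + s *: e1).
  move=> Hs j; rewrite dotpDr dotpZr; have [jD|jD] := boolP (j \in i0 |: D).
    rewrite (red_dead a0 (chamber_dead cU) jD) !dotp0l mulr0 addr0.
    by rewrite (lred_zero a0 (chamber_dead cU) (chamber_zero cU Uh) jD).
  by case: Hs => [->|Hs]; [rewrite mul0r addr0 ltW ?Hv|rewrite ltW ?Ht].
have [a [Pa ai0 ta]] := facet_lift a0 (Pv 0 (or_introl erefl)).
have tt : 0 < t / 2 < t by apply/andP; split; lra.
have [a' [Pa' ai0' ta']] := facet_lift a0 (Pv (t / 2) (or_intror tt)).
have aa' : a <> a'.
  move=> E; move: ta; rewrite E ta' scale0r addr0 => /eqP; rewrite addrC -subr_eq0 addrK => /eqP.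
  move=> /(congr1 (@hd R d)); rewrite hdZ hd_cons mulr1 /hd mxE; lra.
have [b0 [vb Pvb]] := (facetsP _ _ _).1 j0J.
have [b [Pb bj0 _]] := facet_lift b0 Pvb.
have bo : b != og.
  by apply/eqP => E; have := Ho j0 (notD _ j0J); rewrite -bj0 E ltxx.
have [c [Pc ci0 Hc]] : exists c, [/\ hpoly u h c, dotp (u i0) c = h ord0 i0 &
     forall s : R, 0 <= s <= 1 -> (1 - s) *: (c - og) + s *: (b - og) <> 0].
  have [Ha|/existsNP[s /not_implyP[/andP[s0 s1] /contrapT Es]]] := pselect (forall s : R, 0 <= s <= 1 -> (1 - s) *: (a - og) + s *: (b - og) <> 0).
    by exists a.
  exists a'; split=> // s' /andP[s0' s1'] Es'.
  have sn1 (z : R) x : (1 - z) *: x + z *: (b - og) = 0 -> z != 1.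
    move=> E; apply/eqP => z1; move: E; rewrite z1 subrr scale0r add0r scale1r => /eqP.
    by rewrite subr_eq0 (negbTE bo).
  have n1 := sn1 _ _ Es; have n1' := sn1 _ _ Es'.
  have m1 : 1 - s != 0 by rewrite subr_eq0 eq_sym.
  have m1' : 1 - s' != 0 by rewrite subr_eq0 eq_sym.
  have Ea : a - og = - (s / (1 - s)) *: (b - og).
    apply: (scalerI m1); rewrite scalerA mulrN mulrC divfK// scaleNr.
    by apply/eqP; rewrite -addr_eq0 Es.
  have Ea' : a' - og = - (s' / (1 - s')) *: (b - og).
    apply: (scalerI m1'); rewrite scalerA mulrN mulrC divfK// scaleNr.
    by apply/eqP; rewrite -addr_eq0 Es'.
  have ho := Ho i0 (notD _ i0J).
  have := congr1 (dotp (u i0)) Ea; have := congr1 (dotp (u i0)) Ea'.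
  rewrite !dotpBr !dotpZr ai0 ai0' => Q' Q.
  have be : dotp (u i0) (b - og) != 0.
    by apply/eqP => E; move: Q; rewrite E mulr0; lra.
  have /eqP : - (s / (1 - s)) * dotp (u i0) (b - og) = - (s' / (1 - s')) * dotp (u i0) (b - og) by rewrite -Q -Q'.
  rewrite -subr_eq0 -mulrBl mulf_eq0 (negbTE be) orbF subr_eq0 => /eqP ss.
  by apply: aa'; apply/eqP; rewrite -subr_eq0 -(subrK og a) -(subrK og a') Ea Ea' ss subrr.
pose q j := h ord0 j - dotp (u j) og.
have q0 j : j \notin D -> 0 < q j by move=> jD; rewrite subr_gt0 Ho.
pose w s := (1 - s) *: (c - og) + s *: (b - og).
(* The [j]-th constraint as seen from [og]: the maximum over live [j] is the gauge of the polytope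
   at [w s], attained at the facets that the ray along [w s] hits. *)
pose F j (s : R) := dotp (u j) (w s) / q j.
have FE j s : F j s = ((1 - s) * dotp (u j) (c - og) + s * dotp (u j) (b - og)) / q j.
  by rewrite /F /w [dotp _ (_ *: _ + _)]dotpDr !dotpZr.
have cF j : continuous (F j).
  rewrite (_ : F j = horner (((dotp (u j) (b - og) - dotp (u j) (c - og)) / q j)%:P * 'X + (dotp (u j) (c - og) / q j)%:P)).
    exact: continuous_horner.
  by apply/funext => s; rewrite FE !hornerE /=; ring.
pose S' := J :\: S.
have j0S' : j0 \in S' by rewrite inE j0S.
(* At [s = 0] the ray hits the facet [i0] in [S], at [s = 1] the facet [j0] outside; where the two
   maxima agree, it hits facets of both kinds at once. *)
pose g1 s := \big[Num.max/F i0 s]_(i <- enum S) F i s.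
pose g2 s := \big[Num.max/F j0 s]_(i <- enum S') F i s.
have cg s : {for s, continuous (fun s => g1 s - g2 s)}.
  by apply: (@continuousB _ _ _ g1 g2); apply: continuous_bigmax.
have F1 j x : j \notin D -> hpoly u h x -> dotp (u j) (x - og) / q j <= 1.
  by move=> jD Px; rewrite ler_pdivrMr ?q0// mul1r dotpBr /q lerD2r.
have w0 : w 0 = c - og by rewrite /w subr0 scale1r scale0r addr0.
have w1 : w 1 = b - og by rewrite /w subrr scale1r scale0r add0r.
have g10 : g2 0 <= g1 0.
  have [j jS Ej] := bigmax_attained (fun j => F j 0) j0S'; rewrite /g2 Ej.
  apply: (@le_trans _ _ (F i0 0)); last exact: bigmax_ge_enum.
  rewrite {2}/F w0 dotpBr ci0 -/(q i0) divff ?gt_eqF ?q0 ?notD// /F w0; apply: F1 => //.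
  by apply: notD; move: jS; rewrite inE => /andP[].
have g11 : g1 1 <= g2 1.
  have [j jS Ej] := bigmax_attained (fun j => F j 1) i0S; rewrite /g1 Ej.
  apply: (@le_trans _ _ (F j0 1)); last exact: bigmax_ge_enum.
  rewrite {2}/F w1 dotpBr bj0 -/(q j0) divff ?gt_eqF ?q0 ?notD// /F w1; apply: F1 => //.
  by apply: notD; apply: (fintype.subsetP SJ).
have [s s01 Es] : exists2 s, s \in `[0, 1] & g1 s - g2 s = 0.
  apply: IVT => //; first by apply: continuous_subspaceT => s; exact: cg.
  apply/andP; split; rewrite ?ge_min ?le_max; apply/orP.
    by right; rewrite subr_le0.
  by left; rewrite subr_ge0.
move/eqP: Es; rewrite subr_eq0 => /eqP Es.
have [i iS Ei] := bigmax_attained (fun j => F j s) i0S.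
have [j jS' Ej] := bigmax_attained (fun j => F j s) j0S'.
have wn0 : w s <> 0 by apply: Hc; move: s01; rewrite in_itv.
have [k0 Hk0] : exists k, 0 < dotp (u k) (w s).
  apply: contrapT => H; apply: wn0; apply: (chamber_spans cU) => k; rewrite leNgt.
  by apply/negP => Hk; apply: H; exists k.
have k0D : k0 \notin D by apply/negP => /(chamber_dead cU) E; move: Hk0; rewrite E dotp0l ltxx.
have k0D' : k0 \in ~: D by rewrite finset.in_setC.
have [k] := bigmax_attained (fun j => F j s) k0D'; rewrite finset.in_setC => kD Ek.
have Fle k' : k' \notin D -> F k' s <= F k s.
  by move=> k'D; rewrite -Ek; apply: (bigmax_ge_enum (fun j => F j s)); rewrite finset.in_setC.
have Fk : 0 < F k s by apply: lt_le_trans (Fle _ k0D); rewrite divr_gt0 ?q0.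
(* The radial projection of [w s] to the boundary. *)
pose x := og + (F k s)^-1 *: w s.
have dx k' : dotp (u k') x = dotp (u k') og + (F k s)^-1 * dotp (u k') (w s) by rewrite dotpDr dotpZr.
have Px : hpoly u h x.
  move=> k'; have [k'D|k'D] := boolP (k' \in D).
    by rewrite (chamber_dead cU k'D) dotp0l (chamber_zero cU Uh k'D).
  rewrite dx -lerBrDl -/(q k') ler_pdivrMl// mulrC -ler_pdivrMl ?q0// mulrC; exact: Fle.
have act k' : k' \notin D -> F k' s = F k s -> dotp (u k') x = h ord0 k'.
  move=> k'D Ek'; rewrite dx -Ek' /F invf_div divfK; first by rewrite /q addrC subrK.
  by apply/eqP => E; move: Fk; rewrite -Ek' /F E mul0r ltxx.
have alive k' : k' \notin D -> F k' s = F k s -> k' \in J.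
  move=> k'D Ek'; apply/facetsP; have hk' : hd (u k') != 0.
    apply/eqP => /(gen_pos_hd (chamber_gen cU)) E; move: Fk; rewrite -Ek' /F E dotp0l mul0r ltxx//.
  by split=> //; exists (tl x); apply: poly_red_tl => //; exact: act.
have iJ : i \in J := fintype.subsetP SJ _ iS.
have [jJ jS] : j \in J /\ j \notin S by move: jS'; rewrite inE => /andP[].
have Eij : F i s = F j s by rewrite -Ei -Ej.
have Ek' : F k s = F i s.
  have kJ := alive k kD erefl; apply/eqP; rewrite eq_le Fle ?notD// andbT.
  have [kS|kS] := boolP (k \in S); first by rewrite -Ei; exact: bigmax_ge_enum.
  by rewrite Eij -Ej; apply: bigmax_ge_enum; rewrite inE kS.
have ai := ((facetsP _ _ _).1 iJ).1.
have xi : dotp (u i) x = h ord0 i by apply: act; rewrite ?notD.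
have xj : dotp (u j) x = h ord0 j by apply: act; rewrite ?notD// -Eij.
have Ptx : hpoly (red u i) (lred u i h) (tl x) by exact: poly_red_tl.
have xjr : dotp (red u i j) (tl x) = lred u i h ord0 j.
  have Ex : row_cons ((h ord0 i - dotp (tl (u i)) (tl x)) / hd (u i)) (tl x) = x.
    by rewrite -xi -{1}(cons_hd_tl x) dotp_cons (_ : _ / _ = hd x) ?cons_hd_tl//; field.
  by rewrite (dotp_red j (h ord0 i) (tl x) ai) Ex mxE xj.
have ij : j \notin i |: D.
  by rewrite in_setU1 negb_or notD// andbT; apply/eqP => E; move: jS; rewrite E iS.
(* Otherwise [red u i j] is zero, and the tight constraint [j] would hold with equality even at a
   relative interior point of the facet [i]. *)
have hij : hd (red u i j) != 0.
  apply/eqP => /(gen_pos_hd (gen_pos_red (chamber_gen cU) ai)) E.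
  have [v' Hv'] : exists v, forall j, j \notin i |: D -> dotp (red u i j) v < lred u i h ord0 j.
    by apply: (chamber_interior (chamber_red cU ai)); [exact: imageP|exists (tl x)].
  by have := Hv' j ij; rewrite -xjr E !dotp0l ltxx.
exists i, j; split=> //; exists (tl (tl x)); exact: poly_red_tl.
Qed.

End FacetGraph.

(** * The Brunn-Minkowski inequality in the line and in the plane *)

Section PlanarBrunnMinkowski.
Variable R : realType.
Notation mu := (@lebesgue_measure R).

Lemma lebesgue_shift (X : set R) (b : R) : measurable X ->
  mu [set z | X (z + b)] = mu X.
Proof.
move=> mX; have mX' : measurable [set z | X (z + b)].
  rewrite -[X in measurable X]setTI; apply: (_ : measurable_fun setT (fun z : R => z + b)) => //.
  exact: measurable_funD.
have E (Y : set R) : measurable Y -> (\int[mu]_x (\1_Y x)%:E = mu Y)%E.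
  by move=> mY; rewrite integral_indic// setIT.
rewrite -(E _ mX) -(E _ mX') -[RHS](integral_shift b); last 2 first.
- by apply/measurable_EFinP; exact: measurable_indic.
- by move=> x; rewrite lee_fin.
by apply: eq_integral => z _; rewrite !indicE.
Qed.

(** The translates of [X] by [min Y] and of [Y] by [max X] both lie in [Z] and share at most the
    point [pt]. *)
Lemma lebesgue_minkowski (X Y Z : set R) : compact X -> compact Y -> X !=set0 -> Y !=set0 ->
  measurable Z -> (forall x y, X x -> Y y -> Z (x + y)) -> (mu X + mu Y <= mu Z)%E.
Proof.
move=> cX cY X0 Y0 mZ XYZ.
have mX : measurable X by exact: compact_measurable.
have mY : measurable Y by exact: compact_measurable.
have cid A : {within A, continuous (fun x : R => x)} by apply: continuous_subspaceT => x; exact: cvg_id.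
have [x1 /[!inE] Xx1 Hx1] := compact_EVT_max X0 cX (cid X).
have [y0 /[!inE] Yy0 Hy0] := compact_EVT_min Y0 cY (cid Y).
pose pt : R := x1 + y0.
pose A := [set z | X (z + - y0)]; pose B := [set z | Y (z + - x1)].
have mA : measurable A.
  rewrite -[X in measurable X]setTI; apply: (_ : measurable_fun setT (fun z : R => z + - y0)) => //.
  exact: measurable_funD.
have mB : measurable B.
  rewrite -[X in measurable X]setTI; apply: (_ : measurable_fun setT (fun z : R => z + - x1)) => //.
  exact: measurable_funD.
rewrite -(lebesgue_shift (- y0) mX) -(lebesgue_shift (- x1) mY) -/A -/B.
have <- : mu (B `\` [set pt]) = mu B.
  have m1 : measurable [set pt] by exact: measurable_set1.
  have : (mu (B `&` [set pt]) <= mu [set pt])%E.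
    by apply: le_measure; rewrite ?inE//; exact: measurableI.
  rewrite lebesgue_measure_set1 measure_le0 => /eqP E.
  by rewrite [RHS](measureDI mu mB m1) E adde0.
have mB' : measurable (B `\` [set pt]) by apply: measurableD.
rewrite -measureU//; last first.
  apply/seteqP; split=> // z [/= Az [Bz zn]]; apply: zn.
  by have := Hx1 _ (mem_set Az); have := Hy0 _ (mem_set Bz); rewrite /pt /=; lra.
apply: le_measure; rewrite ?inE//; first exact: measurableU.
move=> z [Az|[Bz _]].
  by have := XYZ _ _ Az Yy0; rewrite subrK.
by have := XYZ _ _ Xx1 Bz; rewrite addrC subrK.
Qed.

Lemma row0E (v : 'rV[R]_0) : v = 0.
Proof. by apply/rowP => -[]. Qed.

Lemma line_compact (A : set 'rV[R]_1) : compact A -> compact [set t | A (row_cons t 0)].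
Proof.
move=> cA; rewrite (_ : [set t | _] = @hd R 0 @` A).
  by apply: continuous_compact_image => //; exact: hd_continuous.
apply/seteqP; split=> [t At|_ [x Ax <-]]; first by exists (row_cons t 0); rewrite ?hd_cons.
by rewrite /= -(row0E (tl x)) cons_hd_tl.
Qed.

Lemma vol1E (A : set 'rV[R]_1) : compact A -> vol A = mu [set t | A (row_cons t 0)].
Proof.
move=> cA; have mA : measurable [set t | A (row_cons t 0)] by apply: compact_measurable; exact: line_compact.
rewrite -[RHS](_ : (\int[mu]_x (\1_([set t | A (row_cons t 0)]) x)%:E = _)%E); last by rewrite integral_indic// setIT.
rewrite volS; apply: eq_integral => t _; rewrite /= indicE.
case: asboolP => [[v Av]|H].
  by rewrite mem_set//=; move: Av; rewrite /slice /= (row0E v).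
by rewrite memNset//= => At; apply: H; exists 0.
Qed.

Lemma vol1_minkowski (A B C : set 'rV[R]_1) : compact A -> compact B -> compact C ->
  A !=set0 -> B !=set0 -> (forall x y, A x -> B y -> C (x + y)) -> (vol A + vol B <= vol C)%E.
Proof.
move=> cA cB cC [x Ax] [y By] H; rewrite !vol1E//; apply: lebesgue_minkowski.
- exact: line_compact.
- exact: line_compact.
- by exists (hd x); rewrite /= -(row0E (tl x)) cons_hd_tl.
- by exists (hd y); rewrite /= -(row0E (tl y)) cons_hd_tl.
- by apply: compact_measurable; exact: line_compact.
- by move=> s t As Bt; have := H _ _ As Bt; rewrite row_consD addr0.
Qed.

Let under_graph (f : R -> R) (M : R) : set (R * R) :=
  [set z | 0 < z.2 < 1 /\ z.2 * M <= f z.1].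

Let under_graph_measurable f M : measurable_fun setT f -> measurable (under_graph f M).
Proof.
move=> mf; rewrite (_ : under_graph f M = (snd @^-1` `]0, 1[%classic) `&`
   (setT `&` [set z : R * R | ((z.2 * M)%:E <= (f z.1)%:E)%E])); last first.
  by apply/seteqP; split=> [z [/= ? ?]|z [/= ? [_ ?]]]; split=> //=; rewrite ?in_itv ?lee_fin.
apply: measurableI.
  by rewrite -[X in measurable X]setTI; apply: measurable_snd => //.
apply: measurable_lee => //; apply/measurable_EFinP.
  by apply: measurable_funM => //; exact: measurable_snd.
by apply: (measurableT_comp mf); exact: measurable_fst.
Qed.

Let levelm (f : R -> R) (M tau : R) : \bar R := (\int[mu]_t (\1_(under_graph f M) (t, tau))%:E)%E.

Let levelm_measurable f M : measurable_fun setT f -> measurable_fun setT (levelm f M).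
Proof.
move=> mf; apply: (@measurable_fun_fubini_tonelli_G _ _ (measurableTypeR R) (measurableTypeR R) R mu
  (fun z => (\1_(under_graph f M) z)%:E)) => //.
by apply/measurable_EFinP; apply: measurable_indic; exact: under_graph_measurable.
Qed.

Let levelmE f M tau : measurable_fun setT f ->
  levelm f M tau = mu [set t | 0 < tau < 1 /\ tau * M <= f t].
Proof.
move=> mf; rewrite -[RHS](_ : (\int[mu]_x (\1_([set t | 0 < tau < 1 /\ tau * M <= f t]) x)%:E = _)%E).
  by apply: eq_integral => t _; rewrite !indicE.
rewrite integral_indic// ?setIT//.
rewrite (_ : [set t | _] = ysection (under_graph f M) tau).
  by apply: measurable_ysection; exact: under_graph_measurable.
by apply/seteqP; split=> t; rewrite /ysection /= inE.
Qed.

Let layer_cake (f : R -> R) (M : R) : measurable_fun setT f -> (forall t, 0 <= f t) -> 0 < M ->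
  (\int[mu]_t (Num.min (f t / M) 1)%:E = \int[mu]_tau levelm f M tau)%E.
Proof.
move=> mf f0 M0.
rewrite -[RHS](@fubini_tonelli _ _ (measurableTypeR R) (measurableTypeR R) R mu mu
  (fun z => (\1_(under_graph f M) z)%:E)); last 2 first.
- by apply/measurable_EFinP; apply: measurable_indic; exact: under_graph_measurable.
- by move=> z; rewrite lee_fin.
apply: eq_integral => t _.
transitivity (\int[mu]_tau (\1_([set tau | 0 < tau < 1 /\ tau * M <= f t]) tau)%:E)%E; last first.
  by apply: eq_integral => tau _; rewrite !indicE.
have fM : 0 <= f t / M by rewrite divr_ge0// ltW.
have [fM1|fM1] := ltP (f t / M) 1.
  rewrite (_ : [set tau | _] = `]0%R, (f t / M)]%classic); last first.
    apply/seteqP; split=> tau /=; rewrite in_itv /= -ler_pdivlMr//; first by move=> [/andP[-> _] ->].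
    by move=> /andP[t0 t1]; split=> //; rewrite t0 /=; lra.
  rewrite integral_indic//= setIT lebesgue_measure_itv/= lte_fin; case: ltP => H; first by rewrite sube0.
  by congr (_%:E); apply/eqP; rewrite eq_le H fM.
rewrite (_ : [set tau | _] = `]0%R, 1%R[%classic); last first.
  apply/seteqP; split=> tau /=; rewrite in_itv /=; first by case.
  move=> /andP[t0 t1]; split; first by rewrite t0.
  by rewrite -ler_pdivlMr//; lra.
by rewrite integral_indic//= setIT lebesgue_measure_itv/= lte_fin ltr01 sube0.
Qed.

Let weighted_sum_le (a b c ma mb : R) : 0 < ma -> 0 < mb ->
  ((ma^-1 * a)%:E + (mb^-1 * b)%:E <= ((ma + mb)^-1 * c)%:E)%E ->
  exists2 k : R, 0 < k & (1 + k) * a + (1 + k^-1) * b <= c.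
Proof.
move=> ma0 mb0; rewrite -EFinD lee_fin ler_pdivlMl ?addr_gt0// => H.
exists (mb / ma); first by rewrite divr_gt0.
apply: le_trans H; rewrite le_eqVlt; apply/orP; left; apply/eqP; field.
by rewrite !gt_eqF.
Qed.

(** Slice lengths are normalised by their suprema [M A] and [M B]. The one-dimensional inequality
    puts the sum of the level sets at relative height [tau] into the level set of [C] at height
    [tau * (M A + M B)]; integrating over [tau] gives [vol A / M A + vol B / M B <= vol C / (M A + M
    B)], which is the claim for [k = M B / M A]. Minimising over [k] would give the form with square
    roots. *)
Lemma brunn_minkowski2 (A B C : set 'rV[R]_2) : compact A -> compact B -> compact C ->
  (forall x y, A x -> B y -> C (x + y)) -> (0 < vol A)%E -> (0 < vol B)%E ->
  exists2 k : R, 0 < k & (1 + k) * fine (vol A) + (1 + k^-1) * fine (vol B) <= fine (vol C).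
Proof.
move=> cA cB cC ABC A0 B0.
pose f (X : set 'rV[R]_2) t := fine (vol (slice X t)).
have fE X t : compact X -> vol (slice X t) = (f X t)%:E.
  by move=> cX; rewrite fineK//; apply: vol_fin_num; exact: slice_compact.
have f0 X t : 0 <= f X t by apply: fine_ge0; exact: vol_ge0.
have mf X : compact X -> measurable_fun setT (f X).
  move=> cX; apply/measurable_EFinP; rewrite (_ : EFin \o _ = (fun t => vol (slice X t))).
    exact: vol_slice_measurable.
  by apply/funext => t; rewrite /= -fE.
have volE X : compact X -> vol X = (\int[mu]_t (f X t)%:E)%E.
  by move=> cX; rewrite volS; apply: eq_integral => t _; exact: fE.
pose M X := sup (range (f X)).
have fub X : compact X -> has_sup (range (f X)).
  move=> cX; split; first by exists (f X 0); exists 0.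
  have ct : compact (@tl R 1 @` X) by apply: continuous_compact_image => //; exact: tl_continuous.
  exists (fine (vol (@tl R 1 @` X))) => _ [t _ <-]; apply: fine_le.
  - by apply: vol_fin_num; exact: slice_compact.
  - exact: vol_fin_num.
  - by apply: vol_le; rewrite sliceE; apply: image_subset => x [].
have fM X t : compact X -> f X t <= M X.
  by move=> cX; apply: sup_upper_bound; [exact: fub|exists t].
have M0 X : compact X -> (0 < vol X)%E -> 0 < M X.
  move=> cX vX; rewrite ltNge; apply/negP => MX; move: vX; rewrite volE// integral0_eq ?ltxx// => t _.
  congr (_%:E); apply/eqP; rewrite eq_le f0 andbT; exact: le_trans (fM _ _ cX) MX.
have MA := M0 _ cA A0; have MB := M0 _ cB B0.
have lev X tau : compact X -> 0 < M X -> 0 < tau < 1 ->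
    compact [set t | tau * M X <= f X t] /\ [set t | tau * M X <= f X t] !=set0.
  move=> cX MX /andP[t0 t1]; split; last first.
    have e0 : 0 < (1 - tau) * M X by rewrite mulr_gt0// subr_gt0.
    have [_ [t _ <-] Ht] := sup_adherent e0 (fub _ cX).
    by exists t; rewrite /=; move: Ht; rewrite -/(M X); lra.
  have ch : compact (@hd R 1 @` X) by apply: continuous_compact_image => //; exact: hd_continuous.
  apply: (subclosed_compact _ ch).
    rewrite (_ : [set t | _] = ~` [set t | (vol (slice X t) < (tau * M X)%:E)%E]).
      by apply: open_closedC; exact: vol_slice_usc.
    apply/funext => t; apply/propext; rewrite /setC /mkset (fE _ _ cX) lte_fin leNgt.
    by split=> /negP.
  move=> t Ht; have [v Xv] : slice X t !=set0.
    apply/set0P/negP => /eqP E; move: Ht; rewrite /mkset /f E vol_set0.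
    by rewrite leNgt mulr_gt0.
  by exists (row_cons t v); rewrite ?hd_cons.
have MAB : 0 < M A + M B by rewrite addr_gt0.
have key tau : (levelm (f A) (M A) tau + levelm (f B) (M B) tau <= levelm (f C) (M A + M B) tau)%E.
  rewrite !levelmE//; try exact: mf.
  have [Ht|Ht] := pselect (0 < tau < 1); last first.
    have E X m : [set t | 0 < tau < 1 /\ tau * m <= f X t] = set0.
      by apply/seteqP; split=> t // [].
    by rewrite !E !measure0 adde0.
  have E X m : [set t | 0 < tau < 1 /\ tau * m <= f X t] = [set t | tau * m <= f X t].
    by apply/seteqP; split=> t; [case|split].
  rewrite !E.
  have [cLA nLA] := lev _ _ cA MA Ht; have [cLB nLB] := lev _ _ cB MB Ht.
  apply: lebesgue_minkowski => //.
    rewrite (_ : [set t | _] = f C @^-1` `[tau * (M A + M B), +oo[).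
      by rewrite -[X in measurable X]setTI; apply: mf.
    by apply/seteqP; split=> t /=; rewrite in_itv /= andbT.
  move=> s t; rewrite /mkset => Hs Htt; move/andP: Ht => [t0 t1].
  have ne X r : 0 < M X -> tau * M X <= f X r -> slice X r !=set0.
    move=> MX Hr; apply/set0P/negP => /eqP E0; by move: Hr; rewrite /f E0 vol_set0 leNgt mulr_gt0.
  have : (vol (slice A s) + vol (slice B t) <= vol (slice C (s + t)))%E.
    apply: vol1_minkowski; try exact: slice_compact; [exact: ne|exact: ne|].
    by move=> x y Ax By; rewrite /slice /= -row_consD; exact: ABC.
  rewrite !fE// -EFinD lee_fin => H; apply: le_trans H; rewrite mulrDr; exact: lerD.
have full X : compact X -> 0 < M X -> (((M X)^-1 * fine (vol X))%:E <= \int[mu]_tau levelm (f X) (M X) tau)%E.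
  move=> cX MX; rewrite -layer_cake//; last exact: mf.
  rewrite le_eqVlt; apply/orP; left; apply/eqP; apply: esym.
  transitivity (\int[mu]_t ((M X)^-1%:E * (f X t)%:E))%E.
    apply: eq_integral => t _; rewrite -EFinM; congr (_%:E); rewrite [RHS]mulrC; apply: min_l.
    by rewrite ler_pdivrMr// mul1r fM.
  rewrite ge0_integralZl//.
  - by rewrite -volE// EFinM fineK//; exact: vol_fin_num.
  - by apply/measurable_EFinP; exact: mf.
  - by move=> t _; rewrite lee_fin.
  - by rewrite lee_fin invr_ge0 ltW.
(* [M A + M B] need not bound the slices of [C]; the truncation at 1 only loses volume of [C], which
   is the harmless direction. *)
have part : (\int[mu]_tau levelm (f C) (M A + M B) tau <= ((M A + M B)^-1 * fine (vol C))%:E)%E.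
  rewrite -layer_cake//; last exact: mf.
  apply: (@le_trans _ _ (\int[mu]_t ((M A + M B)^-1%:E * (f C t)%:E))%E).
    apply: le_integralT => t; first by rewrite lee_fin le_min ler01 andbT; apply: divr_ge0; [exact: f0|exact: ltW].
    by rewrite -EFinM lee_fin mulrC ge_min lexx.
  rewrite ge0_integralZl//.
  - by rewrite -volE// EFinM fineK//; exact: vol_fin_num.
  - by apply/measurable_EFinP; exact: mf.
  - by move=> t _; rewrite lee_fin.
  - by rewrite lee_fin invr_ge0 ltW.
have tot : (\int[mu]_tau (levelm (f A) (M A) tau + levelm (f B) (M B) tau) <=
            \int[mu]_tau levelm (f C) (M A + M B) tau)%E.
  apply: le_integralT => tau; last exact: key.
  by rewrite adde_ge0// levelmE//; exact: mf.
have tot2 : (\int[mu]_tau levelm (f A) (M A) tau + \int[mu]_tau levelm (f B) (M B) tau <=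
            \int[mu]_tau levelm (f C) (M A + M B) tau)%E.
  apply: le_trans tot; rewrite le_eqVlt; apply/orP; left; apply/eqP/esym/ge0_integralD => //.
  - by move=> tau _; rewrite levelmE//; exact: mf.
  - by apply: levelm_measurable; exact: mf.
  - by move=> tau _; rewrite levelmE//; exact: mf.
  - by apply: levelm_measurable; exact: mf.
have {tot tot2 part} := le_trans (leeD (full A cA MA) (full B cB MB)) (le_trans tot2 part).
exact: weighted_sum_le MA MB.
Qed.

End PlanarBrunnMinkowski.

(** * The planar case of Alexandrov-Fenchel and the change of reference body *)

Section AlexandrovFenchelPolytopes.
Variables (R : realType) (N : nat).
Implicit Types (h p z : 'rV[R]_N) (xs ps : seq 'rV[R]_N) (D : {set 'I_N}).
Notation evec i := (delta_mx ord0 i : 'rV[R]_N).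

Lemma vol_hpoly_scale d (u : 'I_N -> 'rV[R]_d) h (a : R) : spans u -> 0 < a ->
  vol (hpoly u (a *: h)) = ((a ^+ d)%:E * vol (hpoly u h))%E.
Proof.
move=> su a0; rewrite (_ : hpoly u (a *: h) = [set x | hpoly u h (a^-1 *: x)]); last first.
  by apply/funext => x; apply/propext; split=> H j; have := H j; rewrite mxE dotpZr ler_pdivrMl.
rewrite vol_scale ?invr_gt0//; last exact: hpoly_compact.
by rewrite exprVn invrK.
Qed.

Lemma chamber_vol d D (u : 'I_N -> 'rV[R]_d) U h p : chamber D u U -> U h -> U p ->
  vol (hpoly u p) = (mvform u h (nseq d p) / d`!%:R)%:E.
Proof.
move=> cU Uh Up; rewrite (mvform_const _ cU Uh Up).
exact: vol_hpoly (chamber_gen cU) (chamber_spans cU) (chamber_dead cU) (chamber_zero cU Up) (chamber_reg cU Up).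
Qed.

(** [x + p] may leave [U], but it is twice the midpoint [y], so its volume is still given by the
    form. Brunn-Minkowski then reads [k a + b / k <= 2 c], and the arithmetic-geometric mean
    inequality removes [k]. *)
Lemma planar_AF D (u : 'I_N -> 'rV[R]_2) U h x p : chamber D u U -> U h -> U x -> U p ->
  mvform u h [:: x; x] * mvform u h [:: p; p] <= mvform u h [:: x; p] ^+ 2.
Proof.
move=> cU Uh Ux Up; have su := chamber_spans cU.
have [Ph|Ph] := pselect (hpoly u h !=set0); last by rewrite !(mvform_empty _ Ph) mul0r sqr_ge0.
have pos q1 q2 : U q1 -> U q2 -> 0 < mvform u h [:: q1; q2].
  move=> U1 U2; apply: (mvform_gt0 cU) => //.
  by move=> q; rewrite !inE => /orP[/eqP ->|/eqP ->].
pose y := 2^-1 *: x + (1 - 2^-1) *: p.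
have Uy : U y by apply: (chamber_convex cU) => //; apply/andP; split; lra.
have yE : 2 *: y = x + p.
  by apply/rowP => j; rewrite !mxE; field.
have volxp : fine (vol (hpoly u (x + p))) = 2 ^+ 2 * (mvform u h [:: y; y] / 2).
  rewrite -yE vol_hpoly_scale// fineM//; last by apply: vol_fin_num; exact: hpoly_compact.
  by rewrite (chamber_vol cU Uh Uy).
have yy : mvform u h [:: y; y] = 4^-1 * (mvform u h [:: x; x] + 2 * mvform u h [:: x; p] + mvform u h [:: p; p]).
  have sw : mvform u h [:: p; x] = mvform u h [:: x; p] by exact: mvform_swap (chamber_gen cU).
  have lin a b q : mvform u h [:: q; a *: x + b *: p] = a * mvform u h [:: q; x] + b * mvform u h [:: q; p].
    have := @mvform_lin R N 2 u h [:: q] [::] a x (b *: p) isT; rewrite !cat1s => ->; congr (_ + _).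
    have := @mvform_lin R N 2 u h [:: q] [::] b p 0 isT; rewrite !cat1s addr0 => ->.
    rewrite (_ : mvform u h [:: q; 0] = 0) ?addr0//.
    by rewrite (mvform_swap _ _ _ _ (chamber_gen cU)) mvform_head0.
  have -> : mvform u h [:: y; y] = 2^-1 * mvform u h [:: x; y] + (1 - 2^-1) * mvform u h [:: p; y].
    by rewrite [in LHS]/y mvform_headD !mvform_headZ.
  by rewrite /y !lin sw; field.
have vol_pos q : U q -> (0 < vol (hpoly u q))%E.
  by move=> Uq; rewrite (chamber_vol cU Uh Uq) lte_fin divr_gt0// pos.
have add v w : hpoly u x v -> hpoly u p w -> hpoly u (x + p) (v + w).
  by move=> Pv Pw j; rewrite dotpDr mxE lerD.
have [k k0] := brunn_minkowski2 (hpoly_compact su) (hpoly_compact su)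
  (hpoly_compact su) add (vol_pos _ Ux) (vol_pos _ Up).
rewrite volxp (chamber_vol cU Uh Ux) (chamber_vol cU Uh Up) yy.
have := pos _ _ Ux Ux; have := pos _ _ Up Up; have := pos _ _ Ux Up.
rewrite (_ : nseq 2 x = [:: x; x])// (_ : nseq 2 p = [:: p; p])//.
move: (mvform u h [:: x; x]) (mvform u h [:: p; p]) (mvform u h [:: x; p]) => a b c c0 b0 a0.
rewrite (_ : 2`!%:R = 2 :> R)// [fine _]/= [fine (b / 2)%:E]/= => H.
have {}H : k * a + k^-1 * b <= 2 * c by lra.
have kk : k * k^-1 = 1 by rewrite divff// gt_eqF.
have k1 : 0 < k^-1 by rewrite invr_gt0.
have s0 : 0 <= k * a + k^-1 * b by rewrite addr_ge0// mulr_ge0// ltW.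
have s1 : 0 <= 2 * c by lra.
have : (k * a + k^-1 * b) ^+ 2 <= (2 * c) ^+ 2 by rewrite ler_sqr.
have : 4 * (a * b) <= (k * a + k^-1 * b) ^+ 2.
  have := sqr_ge0 (k * a - k^-1 * b).
  have -> : (k * a - k^-1 * b) ^+ 2 = (k * a + k^-1 * b) ^+ 2 - 4 * (k * k^-1) * (a * b) by ring.
  by rewrite kk; lra.
nra.
Qed.

(** [z] need not be a support vector, but [p + t *: z] is one of the same type for small [t]. Adding
    a multiple of [p] does not affect the discriminant, and [t] only scales it by [t ^+ 2]. *)
Lemma AF2 D (u : 'I_N -> 'rV[R]_2) U h z p : chamber D u U -> U h -> U p ->
  (forall j, j \in D -> z ord0 j = 0) ->
  mvform u h [:: z; z] * mvform u h [:: p; p] <= mvform u h [:: z; p] ^+ 2.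
Proof.
move=> cU Uh Up dz; rewrite !(mvform_const _ cU Uh Up).
have [e e0 He] := regular_open (chamber_dead cU) (chamber_zero cU Up) (chamber_reg cU Up).
pose t := e / (2 * (`|z| + 1)).
have z1 : 0 < `|z| + 1 by rewrite ltr_wpDl.
have t0 : 0 < t by rewrite divr_gt0// mulr_gt0.
have tz : t * `|z| < e.
  rewrite /t mulrAC ltr_pdivrMr ?mulr_gt0//; have := normr_ge0 z; nra.
pose V := [set y | exists2 s, 0 <= s <= t & y = p + s *: z].
have cV : chamber D u V.
  split; [exact: chamber_gen cU|exact: chamber_spans cU|exact: chamber_dead cU| | | ].
  - move=> _ _ [s1 /andP[s10 s1t] ->] [s2 /andP[s20 s2t] ->] l /andP[l0 l1].
    exists (l * s1 + (1 - l) * s2); first by apply/andP; split; nra.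
    by apply/rowP => j; rewrite !mxE; ring.
  - move=> _ [s /andP[s0 st] ->]; apply: He; last first.
      by move=> j jD; rewrite !mxE dz// (chamber_zero cU Up jD) mulr0 addr0.
    rewrite opprD addrA subrr add0r normrN normrZ ger0_norm//; apply: le_lt_trans tz.
    by rewrite ler_wpM2r.
  - by move=> _ [s _ ->] j jD; rewrite !mxE dz// (chamber_zero cU Up jD) mulr0 addr0.
have Vp : V p by exists 0; rewrite ?scale0r ?addr0// lexx ltW.
have Vt : V (p + t *: z) by exists t; rewrite ?lexx ?ltW.
have := planar_AF cV Vp Vt Vp.
have sw : mvform u p [:: p; z] = mvform u p [:: z; p] by exact: mvform_swap (chamber_gen cU).
have lin q : mvform u p [:: q; p + t *: z] = mvform u p [:: q; p] + t * mvform u p [:: q; z].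
  rewrite [p + _]addrC [RHS]addrC.
  by have := @mvform_lin R N 2 u p [:: q] [::] t z p isT; rewrite !cat1s.
rewrite !lin ![mvform u p [:: p + _; _]]mvform_headD !mvform_headZ sw => H.
have {}H : t ^+ 2 * (mvform u p [:: z; z] * mvform u p [:: p; p]) <= t ^+ 2 * (mvform u p [:: z; p] ^+ 2) by nra.
by move: H; rewrite ler_pM2l// exprn_gt0.
Qed.

Lemma mvform_evec d (u : 'I_N -> 'rV[R]_d.+1) h i xs :
  mvform u h (evec i :: xs) = `|hd (u i)|^-1 * mvform (red u i) (lred u i h) (map (lred u i) xs).
Proof.
rewrite mvformS (bigD1 i)//= big1 ?addr0; first by rewrite mxE !eqxx mul1r.
by move=> j ji; rewrite mxE (negbTE ji) !mul0r.
Qed.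

Lemma mvform_coord d (u : 'I_N -> 'rV[R]_d.+1) h (x : 'rV[R]_N) xs :
  mvform u h (x :: xs) = \sum_i x ord0 i * mvform u h (evec i :: xs).
Proof. by rewrite mvformS; apply: eq_bigr => i _; rewrite mvform_evec mulrA. Qed.

(** Hyperbolicity with respect to [a] passes to [b]. The second hypothesis is the inequality for
    [ba z - za b], which is orthogonal to [a]. If the conclusion failed, [zz] and [za ^+ 2] would be
    positive, and so would [zz] times that value, by the identity in [H3]. *)
Lemma reverse_CS (zz bb aa za zb ba : R) : 0 < aa -> 0 < bb ->
  zz * aa <= za ^+ 2 -> (ba ^+ 2 * zz - 2 * ba * za * zb + za ^+ 2 * bb) * aa <= 0 ->
  zz * bb <= zb ^+ 2.
Proof.
move=> a0 b0 H1 H2; rewrite leNgt; apply/negP => H.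
have z0 : 0 < zz by have := sqr_ge0 zb; nra.
have {}H2 : ba ^+ 2 * zz - 2 * ba * za * zb + za ^+ 2 * bb <= 0 by nra.
have H3 : (ba * zz - za * zb) ^+ 2 + za ^+ 2 * (zz * bb - zb ^+ 2) <= 0.
  have -> : (ba * zz - za * zb) ^+ 2 + za ^+ 2 * (zz * bb - zb ^+ 2) =
     zz * (ba ^+ 2 * zz - 2 * ba * za * zb + za ^+ 2 * bb) by ring.
  nra.
have : za ^+ 2 * (zz * bb - zb ^+ 2) <= 0 by have := sqr_ge0 (ba * zz - za * zb); lra.
have zaa : 0 < za ^+ 2 by apply: lt_le_trans H1; exact: mulr_gt0.
by rewrite leNgt mulr_gt0// subr_gt0.
Qed.

End AlexandrovFenchelPolytopes.

(** * The Alexandrov-Fenchel inequality within a chamber *)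

Section AlexandrovFenchelTheorem.
Variables (R : realType) (N : nat).
Implicit Types (h p z : 'rV[R]_N) (xs ps : seq 'rV[R]_N) (D : {set 'I_N}).
Notation evec i := (delta_mx ord0 i : 'rV[R]_N).

Theorem mvform_AF d D (u : 'I_N -> 'rV[R]_d.+2) U h z p ps : chamber D u U -> U h -> U p ->
  (forall q, q \in ps -> U q) -> size ps = d -> (forall j, j \in D -> z ord0 j = 0) ->
  mvform u h (z :: z :: ps) * mvform u h (p :: p :: ps) <= mvform u h (z :: p :: ps) ^+ 2.
Proof.
elim: d D u U h z p ps => [|d IH] D u U h z p ps cU Uh Up Ups sp dz.
  by move/size0nil: sp => ->; exact: AF2 cU Uh Up dz.
case: ps Ups sp => [//|p3 ps] Ups [sp].
have gu := chamber_gen cU; have du := chamber_dead cU; have su := chamber_spans cU.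
have Up3 : U p3 by apply: Ups; rewrite mem_head.
have {}Ups q : q \in ps -> U q by move=> qp; apply: Ups; rewrite in_cons qp orbT.
have [Ph|Ph] := pselect (hpoly u h !=set0); last by rewrite !(mvform_empty _ Ph) mul0r sqr_ge0.
have Q_swap x y : mvform u h (x :: y :: p3 :: ps) = mvform u h (y :: x :: p3 :: ps) by exact: mvform_swap.
(* Translating [p3] to have the origin inside makes the Bochner weights [p' / r] positive; the form
   does not see the translation. *)
have [og Hog] := chamber_interior cU Up3 (nonempty_const cU Uh Up3 Ph).
pose p' := p3 - shiftv u og.
have p'E xs : size xs = d.+2 -> mvform u h (p' :: xs) = mvform u h (p3 :: xs).
  by move=> sx; rewrite mvform_headD -scaleN1r mvform_headZ (mvform_shiftv _ cU)// mulr0 addr0.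
have sz2 (a b : 'rV[R]_N) : size (a :: b :: ps) = d.+2 by rewrite /= sp.
pose A i j := mvform u h (evec i :: evec j :: p3 :: ps).
have symA i j : A i j = A j i by exact: Q_swap.
have rowA i (x : 'rV[R]_N) : \sum_j A i j * x ord0 j = mvform u h (evec i :: x :: p3 :: ps).
  by rewrite Q_swap mvform_coord; apply: eq_bigr => j _; rewrite /A Q_swap mulrC.
have qE x y : qform A x y = mvform u h (x :: y :: p3 :: ps).
  rewrite mvform_coord; apply: eq_bigr => i _; rewrite -rowA mulr_sumr.
  by apply: eq_bigr => j _; ring.
pose J := facets u h.
have JP i : i \in J -> [/\ hd (u i) != 0, hpoly (red u i) (lred u i h) !=set0 & i \notin D].
  move=> /facetsP[ai Pi]; split=> //; apply/negP => /(hd_dead du)/eqP; by rewrite (negbTE ai).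
have out i xs : i \notin J -> mvform u h (evec i :: xs) = 0.
  move=> iJ; rewrite mvform_evec; have [->|ai] := eqVneq (hd (u i)) 0.
    by rewrite normr0 invr0 mul0r.
  rewrite mvform_empty ?mulr0// => Pi; move/negP: iJ; apply; exact/facetsP.
have Uimg i q : U q -> (lred u i @` U) (lred u i q) by move=> Uq; exists q.
have Umap i q : q \in map (lred u i) ps -> (lred u i @` U) q.
  by move=> /mapP[q' q'ps ->]; exists q' => //; exact: Ups.
have posi i q1 q2 : i \in J -> U q1 -> U q2 -> 0 < mvform u h (evec i :: q1 :: q2 :: ps).
  move=> /JP[ai Pi _] U1 U2; rewrite mvform_evec mulr_gt0 ?invr_gt0 ?normr_gt0//.
  apply: (mvform_gt0 (chamber_red cU ai)) => //=; [exact: Uimg| |by rewrite size_map sp].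
  by move=> q; rewrite !in_cons => /or3P[/eqP ->|/eqP ->|]; [exact: Uimg|exact: Uimg|exact: Umap].
have rE i : \sum_j A i j * p' ord0 j = mvform u h (evec i :: p3 :: p3 :: ps).
  by rewrite rowA Q_swap (p'E _ (sz2 _ _)); exact: Q_swap.
have hyp x : qform A x x * qform A p' p' <= qform A x p' ^+ 2.
  apply: (@qform_hyperbolic R N A symA J p').
  - by move=> i j iJ; rewrite /A out.
  - move=> i j ij; rewrite /A mvform_evec; have [->|ai] := eqVneq (hd (u i)) 0.
      by rewrite normr0 invr0 mul0r.
    rewrite mulr_ge0 ?invr_ge0// map_cons; apply: (mvform_head_ge0 (chamber_red cU ai)).
    + exact: Uimg.
    + move=> k kD; rewrite !mxE /= (negbTE ij) mulr0 subr0; by case: (k == j).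
    + by move=> q; rewrite in_cons => /orP[/eqP ->|]; [exact: Uimg|exact: Umap].
    + by rewrite /= size_map sp.
  - by move=> i /JP[_ _ iD]; rewrite !mxE subr_gt0; exact: Hog.
  - by move=> i iJ; rewrite rE; exact: posi.
  (* Only coordinates on facets matter; the others are cleared because induction on a facet asks for
     zeros at the dead constraints. *)
  - move=> {}x; pose x' : 'rV[R]_N := \row_j (if j \in J then x ord0 j else 0).
    have x'E i : \sum_j A i j * x ord0 j = \sum_j A i j * x' ord0 j.
      apply: eq_bigr => j _; rewrite mxE; case: ifPn => // jJ.
      by rewrite symA /A out// !mul0r.
    have qx' : qform A x x = qform A x' x'.
      apply: eq_bigr => i _; apply: eq_bigr => j _; rewrite !mxE.
      have [iJ|iJ] := ifPn; last by rewrite /A out// !mul0r.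
      by have [jJ|jJ] := ifPn => //; rewrite symA /A out// !mul0r.
    rewrite qx' qE.
    (* The reference body moves to the head slot: the form becomes a sum of [p'_i] times facet forms
       of [x', x'], each bounded by the inequality in one dimension less against [p3]. *)
    have -> : mvform u h (x' :: x' :: p3 :: ps) = mvform u h (p' :: x' :: x' :: ps).
      rewrite (p'E _ (sz2 _ _)); apply: mvform_perm => //; first by rewrite /= sp.
      apply/permP => P /=; ring.
    rewrite mvform_coord [leRHS]big_mkcond; apply: ler_sum => i _; case: ifPn => iJ; last first.
      by rewrite out ?mulr0.
    have [ai Pi iD] := JP _ iJ.
    rewrite rE (x'E i) rowA -mulrA ler_pM2l; last by rewrite !mxE subr_gt0; exact: Hog.
    rewrite mulrC ler_pdivlMr; last exact: posi.
    rewrite !mvform_evec !map_cons exprMn expr2 -!mulrA ler_pM2l ?invr_gt0 ?normr_gt0//.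
    rewrite mulrCA ler_pM2l ?invr_gt0 ?normr_gt0//.
    apply: (IH _ _ _ _ _ _ _ (chamber_red cU ai)).
    + exact: Uimg.
    + exact: Uimg.
    + exact: Umap.
    + by rewrite size_map.
    + apply: lred_zero => // j jD; rewrite mxE; case: ifPn => // /JP[_ _].
      by rewrite jD.
  (* For [i] and [j] with a common ridge, [A i j] is a mixed form of that ridge, hence positive. *)
  - move=> S SJ S0 SnJ; have [i [j [iS jJ jS aij Pij]]] := facets_connected cU Uh SJ S0 SnJ.
    exists i, j; split=> //; have [ai _ _] := JP _ (fintype.subsetP SJ _ iS).
    have ji : j != i by apply/eqP => E; move: jS; rewrite E iS.
    have Lj : lred u i (evec j) = evec j.
      by apply/rowP => k; rewrite !mxE /= [i == j]eq_sym (negbTE ji) mulr0 subr0.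
    rewrite /A mvform_evec mulr_gt0 ?invr_gt0 ?normr_gt0// map_cons Lj mvform_evec.
    rewrite mulr_gt0 ?invr_gt0 ?normr_gt0//.
    have cij := chamber_red (chamber_red cU ai) aij.
    apply: (mvform_gt0 cij) => //; [by exists (lred u i h) => //; exact: Uimg| |by rewrite /= !size_map sp].
    move=> q /mapP[q' q'in ->]; exists q' => //; move: q'in; rewrite map_cons in_cons.
    by move=> /orP[/eqP ->|]; [exact: Uimg|exact: Umap].
have p'p' : qform A p' p' = mvform u h (p3 :: p3 :: p3 :: ps).
  by rewrite qE (p'E _ (sz2 _ _)) Q_swap (p'E _ (sz2 _ _)).
have xp' x : qform A x p' = qform A x p3.
  by rewrite !qE Q_swap (p'E _ (sz2 _ _)) Q_swap.
have posU q1 q2 : U q1 -> U q2 -> 0 < mvform u h (q1 :: q2 :: p3 :: ps).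
  move=> U1 U2; apply: (mvform_gt0 cU) => //; last by rewrite /= sp.
  by move=> q; rewrite !in_cons => /or4P[/eqP ->|/eqP ->|/eqP ->|/Ups].
have aa := posU _ _ Up3 Up3; have bb := posU _ _ Up Up.
have {}hyp x : qform A x x * mvform u h (p3 :: p3 :: p3 :: ps) <= qform A x p3 ^+ 2.
  by rewrite -p'p' -xp'; exact: hyp.
(* So far the reference body is [p3], a fixed entry of the form; it is exchanged for [p]. *)
rewrite -!qE; apply: (reverse_CS (aa := mvform u h (p3 :: p3 :: p3 :: ps)) (za := qform A z p3) (ba := qform A p p3)) => //.
  by rewrite qE.
pose y := qform A p p3 *: z + (- qform A z p3) *: p.
have y1 : qform A y p3 = 0 by rewrite qformDl !qformZl; ring.
have y2 : qform A y y = qform A p p3 ^+ 2 * qform A z z - 2 * qform A p p3 * qform A z p3 * qform A z p +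
    qform A z p3 ^+ 2 * qform A p p.
  by rewrite /y qformDl !qformZl !(qformDr symA) !(qformZr symA) (qformC symA p z); ring.
by have := hyp y; rewrite y1 y2 expr0n.
Qed.

End AlexandrovFenchelTheorem.

(** * Separation, neighbourhoods and weighted Minkowski sums *)

Section ConvexSets.
Variable R : realType.

Lemma dotp_ge0 n (x : 'rV[R]_n) : 0 <= dotp x x.
Proof. by apply: sumr_ge0 => i _; rewrite -expr2 sqr_ge0. Qed.

Lemma dotp_eq0 n (x : 'rV[R]_n) : dotp x x = 0 -> x = 0.
Proof.
move/eqP; rewrite psumr_eq0; last by move=> i _; rewrite -expr2 sqr_ge0.
move=> /allP H; apply/rowP => i; rewrite mxE; have := H i (mem_index_enum _).
by rewrite /= -expr2 sqrf_eq0 => /eqP.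
Qed.

Lemma dotp_norm n (x y : 'rV[R]_n) : `|dotp x y| <= n%:R * (`|x| * `|y|).
Proof.
rewrite (le_trans (ler_norm_sum _ _ _))// (le_trans (ler_sum _ (_ : forall i, _ -> _ <= `|x| * `|y|)))//.
  by move=> i _; rewrite normrM ler_pM// rV_coord_le.
by rewrite sumr_const card_ord mulr_natl.
Qed.

Lemma separation n (K : set 'rV[R]_n) x : compact K -> Defs.convex_set K -> K !=set0 -> ~ K x ->
  exists w, forall y, K y -> dotp w y < dotp w x.
Proof.
move=> cK vK K0 nx.
pose f (y : 'rV[R]_n) := dotp (x - y) (x - y).
have cf : continuous f.
  apply: continuous_sum => i y.
  have c : {for y, continuous (fun y : 'rV[R]_n => (x - y) ord0 i)}.
    have -> : (fun y : 'rV[R]_n => (x - y) ord0 i) = (fun y => x ord0 i - y ord0 i).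
      by apply/funext => z; rewrite !mxE.
    by apply: (@continuousB _ _ _ (fun=> x ord0 i) (fun y : 'rV[R]_n => y ord0 i)); [exact: cst_continuous|exact: rV_coord_continuous].
  by apply: (@continuousM _ _ (fun y : 'rV[R]_n => (x - y) ord0 i) (fun y : 'rV[R]_n => (x - y) ord0 i)).
have [y0 /[!inE] Ky0 Hy0] := EVT_min_rV K0 cK (continuous_subspaceT cf).
exists (x - y0) => y Ky.
have w0 : 0 < dotp (x - y0) (x - y0).
  rewrite lt_neqAle dotp_ge0 andbT eq_sym; apply/eqP => /dotp_eq0/eqP; rewrite subr_eq0 => /eqP E.
  by apply: nx; rewrite E.
have key : dotp (x - y0) (y - y0) <= 0.
  rewrite leNgt; apply/negP => H; have yy := dotp_ge0 (y - y0).
  set a := dotp (x - y0) (y - y0) in H; set b := dotp (y - y0) (y - y0) in yy.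
  (* A step in [(0, 1)] with [t * b < 2 * a], so that moving towards [y] comes closer to [x]. *)
  pose t := a / (a + b + 1).
  have ab : 0 < a + b + 1 by lra.
  have t0 : 0 < t by rewrite divr_gt0.
  have t1 : t < 1 by rewrite ltr_pdivrMr//; lra.
  have Kt : K (t *: y + (1 - t) *: y0) by apply: vK => //; rewrite !ltW.
  have := Hy0 _ (mem_set Kt); rewrite /f.
  have -> : x - (t *: y + (1 - t) *: y0) = (x - y0) - t *: (y - y0).
    by apply/rowP => i; rewrite !mxE; ring.
  have quad (X Y : 'rV[R]_n) : dotp (X - t *: Y) (X - t *: Y) = dotp X X - 2 * t * dotp X Y + t * t * dotp Y Y.
    by rewrite dotpBl !dotpBr !dotpZl !dotpZr (dotpC Y X); ring.
  rewrite quad -/a -/b => HH.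
  have : t * (2 * a - t * b) <= 0 by nra.
  have tE : t * (a + b + 1) = a by rewrite divfK// gt_eqF.
  have ta : 0 < t * a by rewrite mulr_gt0.
  have : 0 < t * (2 * a - t * b).
    by rewrite mulr_gt0//; move: tE; rewrite !mulrDr; lra.
  lra.
by move: key w0; rewrite !dotpBr; lra.
Qed.

Definition thick n (A : set 'rV[R]_n) (r : R) : set 'rV[R]_n :=
  [set x | exists2 y, A y & `|x - y| <= r].

Definition wsum n (I : finType) (w : I -> R) (C : I -> set 'rV[R]_n) : set 'rV[R]_n :=
  [set x | exists y : I -> 'rV[R]_n, (forall i, C i (y i)) /\ x = \sum_i w i *: y i].

Lemma normball_compact n (r : R) : compact [set x : 'rV[R]_n | `|x| <= r].
Proof.
apply: bounded_closed_compact; first by exists r; split; [exact: num_real|move=> y ry x /= xr; apply: le_trans xr (ltW ry)].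
apply: (@closed_comp _ _ (fun v : 'rV[R]_n => `|v|) [set y | y <= r]); last exact: closed_le.
by move=> *; exact: norm_continuous.
Qed.

Lemma add_compact n (A B : set 'rV[R]_n) : compact A -> compact B ->
  compact [set x | exists y z, [/\ A y, B z & x = y + z]].
Proof.
move=> cA cB; rewrite (_ : [set x | _] = (fun z : 'rV[R]_n * 'rV[R]_n => z.1 + z.2) @` (A `*` B)).
  apply: continuous_compact; last exact: compact_setX.
  apply: continuous_subspaceT; exact: add_continuous.
apply/seteqP; split=> [x [y [z [Ay Bz ->]]]|_ [[y z] [/= Ay Bz] <-]]; first by exists (y, z).
by exists y, z.
Qed.

Lemma thick_compact n (A : set 'rV[R]_n) r : compact A -> compact (thick A r).
Proof.
move=> cA; suff <- : [set x | exists y z, [/\ A y, `|z| <= r & x = y + z]] = thick A r.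
  exact: add_compact cA (@normball_compact n r).
apply/seteqP; split.
  by move=> x [y [z [Ay /= zr ->]]]; exists y => //; rewrite addrC addKr.
by move=> x [y Ay xy]; exists y, (x - y); split=> //; rewrite addrC subrK.
Qed.

Lemma thick_convex n (A : set 'rV[R]_n) r : Defs.convex_set A -> Defs.convex_set (thick A r).
Proof.
move=> vA x y [x' Ax xr] [y' Ay yr] l /andP[l0 l1]; exists (l *: x' + (1 - l) *: y').
  by apply: vA => //; rewrite l0.
have -> : l *: x + (1 - l) *: y - (l *: x' + (1 - l) *: y') = l *: (x - x') + (1 - l) *: (y - y').
  by apply/rowP => i; rewrite !mxE; ring.
rewrite (le_trans (ler_normD _ _))// !normrZ ger0_norm// ger0_norm ?subr_ge0//; nra.
Qed.

Lemma wsum_compact n (I : finType) (w : I -> R) (C : I -> set 'rV[R]_n) :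
  (forall i, compact (C i)) -> compact (wsum w C).
Proof.
move=> cC.
suff H (s : seq I) : uniq s -> compact [set x | exists y : I -> 'rV[R]_n, (forall i, i \in s -> C i (y i)) /\ x = \sum_(i <- s) w i *: y i].
  have := H _ (enum_uniq I); rewrite (_ : [set x | _] = wsum w C)//.
  apply/seteqP; split=> x [y [Cy ->]]; exists y; rewrite big_enum; split=> // i.
  by apply: Cy; rewrite mem_enum.
elim: s => [_|i s IH /= /andP[is_ us]].
  rewrite (_ : [set x | _] = [set 0]); first exact: compact_set1.
  apply/seteqP; split=> [x [y [_ ->]]|_ ->]; rewrite ?big_nil//.
  by exists (fun=> 0); rewrite big_nil.
have ci : compact ((fun x => w i *: x) @` C i).
  by apply: continuous_compact_image => //; exact: scaler_continuous.
have := add_compact ci (IH us); congr compact; apply/seteqP; split.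
  move=> _ [_ [_ [[y Cy <-] [z [Cz ->]] ->]]]; exists (fun k => if k == i then y else z k); split.
    by move=> k; rewrite in_cons; case: eqP => [-> //|_ /=]; exact: Cz.
  rewrite big_cons eqxx; congr (_ + _); rewrite !big_seq; apply: eq_bigr => k ks.
  by case: eqP => // ki; move: is_; rewrite -ki ks.
move=> x [y [Cy ->]]; rewrite big_cons; exists (w i *: y i), (\sum_(k <- s) w k *: y k); split=> //.
  by exists (y i) => //; apply: Cy; rewrite mem_head.
by exists y; split=> // k ks; apply: Cy; rewrite in_cons ks orbT.
Qed.

Lemma wsum_convex n (I : finType) (w : I -> R) (C : I -> set 'rV[R]_n) :
  (forall i, Defs.convex_set (C i)) -> Defs.convex_set (wsum w C).
Proof.
move=> vC x x' [y [Cy ->]] [y' [Cy' ->]] l l01; exists (fun i => l *: y i + (1 - l) *: y' i); split.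
  by move=> i; exact: vC.
rewrite !scaler_sumr -big_split; apply: eq_bigr => i _ /=; rewrite scalerDr !scalerA.
by rewrite [l * _]mulrC [(1 - l) * _]mulrC.
Qed.

Lemma wsum_thick n (I : finType) (w : I -> R) (C : I -> set 'rV[R]_n) r :
  (forall i, 0 <= w i) -> wsum w (fun i => thick (C i) r) `<=` thick (wsum w C) ((\sum_i w i) * r).
Proof.
move=> w0 x [y [Cy ->]].
have /choice[z Hz] : forall i, exists z, C i z /\ `|y i - z| <= r by move=> i; have [z ? ?] := Cy i; exists z.
exists (\sum_i w i *: z i); first by exists z; split=> // i; exact: (Hz i).1.
rewrite -sumrB mulr_suml; apply: le_trans (ler_norm_sum _ _ _) _; apply: ler_sum => i _.
by rewrite -scalerBr normrZ ger0_norm// ler_wpM2l// (Hz i).2.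
Qed.

Lemma vol_thick n (A : set 'rV[R]_n) (c : R) : compact A -> (vol A < c%:E)%E ->
  exists2 r : R, 0 < r & (vol (thick A r) < c%:E)%E.
Proof.
move=> cA Ac; pose e k : R := k.+1%:R^-1.
have [|||k Hk] := @vol_decreasing R n (fun k => thick A (e k)) c.
- by move=> k; exact: thick_compact.
- move=> k x [y Ay xy]; exists y => //; apply: le_trans xy _.
  by rewrite /e lef_pV2 ?posrE// ler_nat.
- rewrite (_ : \bigcap_k _ = A)//; apply/seteqP; split=> [x Hx|x Ax k _]; last first.
    by exists x => //; rewrite subrr normr0 invr_ge0.
  have : closure A x.
    move=> B /nbhs_ballP[ep /= ep0 Hep]; have [k Hk] := ltr_add_invr ep0; rewrite add0r in Hk.
    have [y Ay xy] := Hx k I; exists y; split=> //; apply: Hep.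
    by rewrite -ball_normE /=; apply: le_lt_trans xy Hk.
  by rewrite -(closure_id A).1//; apply: compact_closed => //; exact: norm_hausdorff.
by exists (e k) => //; rewrite invr_gt0.
Qed.

End ConvexSets.


(** * The fan of a hyperplane arrangement *)

Section Fan.
Variables (R : realType) (n : nat) (F : finType) (pt : F -> 'rV[R]_n).

Definition pdiff (fg : F * F) : 'rV[R]_n := pt fg.1 - pt fg.2.

(* [w'] lies in the closed cell of [w] in the arrangement of the hyperplanes
   orthogonal to the [pdiff fg]. *)
Definition compat (w w' : 'rV[R]_n) : Prop :=
  forall fg, 0 <= dotp w (pdiff fg) -> 0 <= dotp w' (pdiff fg).

Lemma pdiff_swap w f g : dotp w (pdiff (g, f)) = - dotp w (pdiff (f, g)).
Proof. by rewrite /pdiff -dotpNr opprB. Qed.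

Lemma compat_eq0 w w' fg : compat w w' -> dotp w (pdiff fg) = 0 -> dotp w' (pdiff fg) = 0.
Proof.
case: fg => f g c H; apply/eqP; rewrite eq_le c ?H// andbT -oppr_ge0 -pdiff_swap.
by apply: c; rewrite pdiff_swap H oppr0.
Qed.

Lemma compat_le0 w w' fg : compat w w' -> dotp w (pdiff fg) <= 0 -> dotp w' (pdiff fg) <= 0.
Proof.
by case: fg => f g c H; rewrite -oppr_ge0 -pdiff_swap; apply: c; rewrite pdiff_swap oppr_ge0.
Qed.

Lemma compat_trans w1 w2 w3 : compat w1 w2 -> compat w2 w3 -> compat w1 w3.
Proof. by move=> c d fg H; apply: d; exact: c. Qed.

Definition nonactive w : {set F * F} := finset (fun fg => dotp w (pdiff fg) != 0).

(** [t] is the first time at which the path from [w] along [y] meets a new hyperplane: no sign has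
    flipped, and one more difference has become orthogonal. *)
Lemma compat_step w y fg0 : (forall fg, dotp w (pdiff fg) = 0 -> dotp y (pdiff fg) = 0) ->
  0 < dotp w (pdiff fg0) -> dotp y (pdiff fg0) < 0 ->
  exists t : R, [/\ 0 < t, compat w (w + t *: y) & (#|nonactive (w + t *: y)| < #|nonactive w|)%N].
Proof.
move=> yw w0 y0.
pose P fg := (0 < dotp w (pdiff fg)) && (dotp y (pdiff fg) < 0).
pose T fg := dotp w (pdiff fg) / - dotp y (pdiff fg).
have P0 : P fg0 by rewrite /P w0.
case: (@arg_minP _ _ _ fg0 P T P0) => fg1 /andP[w1 y1] Hmin.
have dE fg : dotp (w + T fg1 *: y) (pdiff fg) = dotp w (pdiff fg) + T fg1 * dotp y (pdiff fg).
  by rewrite dotpDl dotpZl.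
have t0 : 0 < T fg1 by rewrite divr_gt0// oppr_gt0.
exists (T fg1); split=> //.
- move=> fg; rewrite dE le_eqVlt => /orP[/eqP E|wp]; first by rewrite -E yw -?E// mulr0 addr0.
  have [y2|y2] := leP 0 (dotp y (pdiff fg)); first by apply: addr_ge0; [exact: ltW|apply: mulr_ge0 => //; exact: ltW].
  have : T fg1 <= T fg by apply: Hmin; rewrite /P wp.
  by rewrite {2}/T ler_pdivlMr ?oppr_gt0// mulrN -subr_ge0 opprK.
- apply: proper_card; apply/fintype.properP; split.
    apply/fintype.subsetP => fg; rewrite !inE dE; apply: contra => /eqP E.
    by rewrite E yw// mulr0 addr0.
  exists fg1; first by rewrite inE gt_eqF.
  rewrite inE negbK dE /T invrN mulrN mulNr divfK ?subrr//.
  by rewrite lt_eqF.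
Qed.

Hypothesis span : forall z, (forall fg, dotp z (pdiff fg) = 0) -> z = 0.

Definition raygen (S : {set F * F}) (z : 'rV[R]_n) : Prop :=
  [/\ z <> 0, forall fg, fg \in S -> dotp z (pdiff fg) = 0 &
    forall y, (forall fg, fg \in S -> dotp y (pdiff fg) = 0) -> exists c, y = c *: z].

(** If the complement of [j.1] is a line, the boolean selects one of its two directions; otherwise
    the default 0 results, a zero normal, which is allowed. *)
Definition fanray (j : {set F * F} * bool) : 'rV[R]_n := (-1) ^+ j.2 *: xget 0 (raygen j.1).

(** Induction on the number of differences not orthogonal to [w]. Unless [w] spans a ray, it lies
    between two points of its closed cell, reached along [y] and [- y], at which more differences
    are orthogonal. *)
Lemma fan_cone w : exists a : {set F * F} * bool -> R,
  [/\ forall j, 0 <= a j, w = \sum_j a j *: fanray j &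
      forall j, a j != 0 -> compat w (fanray j)].
Proof.
have [k] := ubnP #|nonactive w|; elim: k w => [//|k IH] w; rewrite ltnS => Hk.
have [->|/eqP w0] := eqVneq w 0.
  exists (fun=> 0); split=> // [|j]; last by rewrite eqxx.
  by rewrite big1// => j _; rewrite scale0r.
pose S : {set F * F} := finset (fun fg => dotp w (pdiff fg) == 0).
have [H|/existsNP[z /not_implyP[Hz nz]]] := pselect (forall y,
   (forall fg, fg \in S -> dotp y (pdiff fg) = 0) -> exists c, y = c *: w).
  have gw : raygen S w by split=> // fg; rewrite inE => /eqP.
  have [r0 rS rE] := @xgetPex _ 0 _ (ex_intro _ w gw).
  have [|c Ec] := rE w; first by move=> fg; rewrite inE => /eqP.
  set r := xget 0 (raygen S) in r0 rS rE Ec.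
  have c0 : c != 0 by apply/eqP => c0; apply: w0; rewrite Ec c0 scale0r.
  have Ew : w = `|c| *: fanray (S, c < 0) by rewrite /fanray -/r scalerA mulrC -numEsign.
  exists (fun j => if j == (S, c < 0) then `|c| else 0); split.
  - by move=> j; case: ifP.
  - rewrite (bigD1 (S, c < 0))//= eqxx big1 ?addr0// => j /negPf ->.
    by rewrite scale0r.
  - move=> j /=; case: (j =P (S, c < 0)) => [-> _|_]; last by rewrite eqxx.
    by move=> fg; rewrite {1}Ew dotpZl pmulr_rge0// normr_gt0.
(* A direction orthogonal to [l] is negative on some difference that is positive on [w], so both [y]
   and [- y] run into a wall of the cell. *)
pose l := \sum_(fg | 0 < dotp w (pdiff fg)) pdiff fg.
have [fg0 wfg0] : exists fg, 0 < dotp w (pdiff fg).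
  apply: contrapT => H; apply: w0; apply: span => -[f g].
  apply/eqP; rewrite eq_le; apply/andP; split; rewrite leNgt; apply/negP => H1; apply: H.
    by exists (f, g).
  by exists (g, f); rewrite pdiff_swap oppr_gt0.
have wl : 0 < dotp w l.
  rewrite dotp_sumr (bigD1 fg0)//= ltr_wpDr// sumr_ge0// => fg /andP[/ltW].
  by [].
pose y := z - (dotp z l / dotp w l) *: w.
have yl : dotp y l = 0 by rewrite dotpBl dotpZl divfK ?subrr// gt_eqF.
have yS fg : dotp w (pdiff fg) = 0 -> dotp y (pdiff fg) = 0.
  by move=> H; rewrite dotpBl dotpZl H mulr0 subr0 Hz// inE H.
have y0 : y <> 0 by move/eqP; rewrite subr_eq0 => /eqP E; apply: nz; exists (dotp z l / dotp w l).
have neg (x : 'rV[R]_n) : (forall fg, dotp w (pdiff fg) = 0 -> dotp x (pdiff fg) = 0) ->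
    dotp x l = 0 -> x <> 0 -> exists2 fg, 0 < dotp w (pdiff fg) & dotp x (pdiff fg) < 0.
  move=> xS xl x0; apply: contrapT => H; apply: x0; apply: span.
  have xw fg : 0 < dotp w (pdiff fg) -> 0 <= dotp x (pdiff fg).
    by move=> wf; rewrite leNgt; apply/negP => xf; apply: H; exists fg.
  have x0 fg : 0 < dotp w (pdiff fg) -> dotp x (pdiff fg) = 0.
    move=> wf; apply/eqP; rewrite eq_le xw// andbT -xl dotp_sumr (bigD1 fg)//= lerDl.
    by apply: sumr_ge0 => ? /andP[/xw].
  move=> [f g]; have [wf|wf|wf] := ltgtP (dotp w (pdiff (f, g))) 0; last exact: xS.
    by apply/eqP; rewrite -oppr_eq0 -pdiff_swap x0// pdiff_swap oppr_gt0.
  exact: x0.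
have [fg1 w1 y1] := neg y yS yl y0.
have [fg2 w2 y2] : exists2 fg, 0 < dotp w (pdiff fg) & dotp (- y) (pdiff fg) < 0.
  apply: neg; first by move=> fg H; rewrite dotpNl yS ?oppr0.
    by rewrite dotpNl yl oppr0.
  by move/eqP; rewrite oppr_eq0 => /eqP.
have [t1 [t10 c1 n1]] := compat_step yS w1 y1.
have [|t2 [t20 c2 n2]] := compat_step _ w2 y2; first by move=> fg H; rewrite dotpNl yS ?oppr0.
have [a1 [a10 E1 C1]] := IH _ (leq_trans n1 Hk).
have [a2 [a20 E2 C2]] := IH _ (leq_trans n2 Hk).
have t12 : 0 < t1 + t2 by rewrite addr_gt0.
exists (fun j => (t1 + t2)^-1 * (t2 * a1 j + t1 * a2 j)); split.
- by move=> j; rewrite mulr_ge0 ?invr_ge0 ?addr_ge0 ?mulr_ge0// ltW.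
- transitivity ((t1 + t2)^-1 *: (t2 *: (w + t1 *: y) + t1 *: (w + t2 *: - y))).
    move: (y) => Y; apply/rowP => i; rewrite !mxE; field.
    by rewrite gt_eqF.
  rewrite {1}E1 {1}E2 !scaler_sumr -big_split scaler_sumr /=; apply: eq_bigr => j _.
  by move: (fanray j) (_^-1) => r c; apply/rowP => i; rewrite !mxE; ring.
- move=> j; have [->|a1j] := eqVneq (a1 j) 0; last by move=> _; apply: compat_trans c1 (C1 _ a1j).
  have [->|a2j] := eqVneq (a2 j) 0; first by rewrite !mulr0 addr0 mulr0 eqxx.
  by move=> _; apply: compat_trans c2 (C2 _ a2j).
Qed.

Definition fan_linear (H : 'rV[R]_n -> R) : Prop :=
  forall w, exists y, forall w', compat w w' -> H w' = dotp w' y.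

Definition subadd (H : 'rV[R]_n -> R) : Prop := forall w w', H (w + w') <= H w + H w'.

(** Support function of the convex hull of the points indexed by [V]. *)
Definition supp (V : {set F}) (w : 'rV[R]_n) : R :=
  xget 0 [set c | exists2 f, f \in V & c = dotp w (pt f) /\ forall g, g \in V -> dotp w (pt g) <= c].

Lemma suppP (V : {set F}) w : V != finset.set0 -> exists2 f, f \in V & supp V w = dotp w (pt f) /\
  forall g, g \in V -> dotp w (pt g) <= supp V w.
Proof.
move=> /set0Pn[f0 f0V]; apply: (@xgetPex _ 0 [set c | exists2 f, f \in V & c = dotp w (pt f) /\ forall g, g \in V -> dotp w (pt g) <= c]).
have [f fV] := @arg_maxP _ _ _ f0 (mem V) (fun f => dotp w (pt f)) f0V.
by move=> H; exists (dotp w (pt f)), f.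
Qed.

Lemma supp_ge (V : {set F}) w f : f \in V -> dotp w (pt f) <= supp V w.
Proof.
by move=> fV; have [|g gV [_]] := @suppP V w; [apply/set0Pn; exists f|exact].
Qed.

Lemma supp_subset (V V' : {set F}) w : V != finset.set0 -> V \subset V' -> supp V w <= supp V' w.
Proof. by move=> V0 /fintype.subsetP VV; have [f /VV fV [-> _]] := suppP w V0; exact: supp_ge. Qed.

Lemma supp_linear (V : {set F}) : V != finset.set0 -> fan_linear (supp V).
Proof.
move=> V0 w; have [f fV [E H]] := suppP w V0; exists (pt f) => w' c.
apply/eqP; rewrite eq_le supp_ge// andbT; have [g gV [-> _]] := suppP w' V0.
by have := c (f, g); rewrite /pdiff /= !dotpBr !subr_ge0; apply; rewrite -E H.
Qed.

Lemma supp_subadd (V : {set F}) : V != finset.set0 -> subadd (supp V).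
Proof.
move=> V0 w w'; have [f fV [-> _]] := suppP (w + w') V0.
by rewrite dotpDl lerD// supp_ge.
Qed.

(** Support function of the sum of the segments from [- pdiff fg] to [pdiff fg]. *)
Definition zono (w : 'rV[R]_n) : R := \sum_fg `|dotp w (pdiff fg)|.

Lemma zono_linear : fan_linear zono.
Proof.
move=> w; exists (\sum_fg Num.sg (dotp w (pdiff fg)) *: pdiff fg) => w' c.
rewrite dotp_sumr; apply: eq_bigr => fg _; rewrite dotpZr.
have [H|H|H] := ltgtP (dotp w (pdiff fg)) 0.
- by rewrite ltr0_sg// mulN1r ler0_norm// (compat_le0 c)// ltW.
- by rewrite gtr0_sg// mul1r ger0_norm// c// ltW.
- by rewrite (compat_eq0 c)// normr0 mulr0.
Qed.

(** Subadditivity is strict across a hyperplane of the arrangement; this later keeps normals of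
    different cells from being tight at the same point. *)
Lemma zono_strict w w' fg : 0 < dotp w (pdiff fg) -> dotp w' (pdiff fg) < 0 ->
  zono (w + w') < zono w + zono w'.
Proof.
move=> H H'; rewrite /zono -big_split (bigD1 fg)//= [ltRHS](bigD1 fg)//=.
rewrite ltr_leD//; last by rewrite ler_sum// => fg' _; rewrite dotpDl ler_normD.
rewrite dotpDl (gtr0_norm H) (ltr0_norm H') ltr_norml; lra.
Qed.

Lemma zono_ge0 w : 0 <= zono w. Proof. by rewrite sumr_ge0. Qed.

End Fan.

(** * Generic parameters and general position of the normals *)

Section Genericity.
Variable R : realType.

Lemma generic_param (I : finType) (p : I -> {poly R}) (e : R) : (forall i, p i != 0) -> 0 < e ->
  exists2 t, 0 < t < e & forall i, (p i).[t] != 0.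
Proof.
move=> p0 e0; pose q := \prod_i p i.
have q0 : q != 0 by apply/prodf_neq0.
pose s := [seq e / k.+2%:R | k <- iota 0 (size q)].
have us : uniq s.
  rewrite map_inj_uniq ?iota_uniq// => a b /(mulfI _)/invr_inj/eqP.
  by rewrite gt_eqF// eqr_nat => /(_ isT)/eqP[].
have [t ts nt] : exists2 t, t \in s & ~~ root q t.
  apply/hasP; rewrite has_predC; apply/negP => rs.
  by have := max_poly_roots q0 rs us; rewrite size_map size_iota ltnn.
exists t.
  have /mapP[k _ ->] := ts; rewrite divr_gt0//= ltr_pdivrMr// ltr_pMr// ltr1n.
  by [].
by move=> i; apply: contra nt => /eqP E; rewrite /root horner_prod (bigD1 i)//= E mul0r.
Qed.

Lemma dotp_ext d (u v : 'rV[R]_d) : (forall x, dotp u x = dotp v x) -> u = v.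
Proof.
move=> H; apply/eqP; rewrite -subr_eq0; apply/eqP; apply: dotp_eq0.
by rewrite dotpBl H subrr.
Qed.

(** [W] is a product of small shears, adjoint to [Wt]. The new first coordinate of a normal is its
    value at a point [(1, t, t^2, ...)] of the moment curve, a non-zero polynomial in [t] for a
    non-zero normal. [L'] lists everything that one elimination can produce from [L], which feeds
    the induction. *)
Lemma generic_rotation d (L : seq 'rV[R]_d) (e : R) : 0 < e ->
  exists W Wt : 'rV[R]_d -> 'rV[R]_d,
  [/\ forall u x, dotp (W u) x = dotp u (Wt x), forall y, exists x, Wt x = y,
     forall x, `|Wt x - x| <= e * `|x| &
     forall N (u : 'I_N -> 'rV[R]_d), (forall j, u j \in L) -> gen_pos (fun j => W (u j))].
Proof.
elim: d L e => [|d IH] L e e0.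
  exists id, id; split=> // [y|x]; first by exists y.
  by rewrite subrr normr0 mulr_ge0// ltW.
pose q (u : 'rV[R]_d.+1) : {poly R} := \poly_(i < d.+1) u ord0 (inord i).
have q0 u : u != 0 -> q u != 0.
  apply: contra => /eqP E; apply/eqP/rowP => i; rewrite mxE.
  have := congr1 (fun r : {poly R} => r`_i) E; rewrite coef_poly ltn_ord coef0 => <-.
  by rewrite inord_val.
pose beta (t : R) : 'rV[R]_d := \row_i t ^+ i.+1.
have qE u t : (q u).[t] = hd u + dotp (tl u) (beta t).
  rewrite horner_poly big_ord_recl expr0 mulr1 /hd; congr (u _ _ + _).
    by apply: val_inj; rewrite /= inordK.
  apply: eq_bigr => i _; rewrite !mxE; congr (u _ _ * _).
  by apply: val_inj; rewrite /= inordK//= ltnS ltn_ord.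
pose e1 := Num.min 1 (e / 2).
have e10 : 0 < e1 by rewrite lt_min ltr01 divr_gt0.
have [|t /andP[t0 te] Ht] := @generic_param 'I_(size L)
   (fun i => if nth 0 L i == 0 then 1 else q (nth 0 L i)) e1 _ e10.
  by move=> i; case: ifPn => [_|]; [exact: oner_neq0|exact: q0].
have {}Ht u : u \in L -> u != 0 -> hd u + dotp (tl u) (beta t) != 0.
  move=> /(nthP 0)[i iL <-] u0; have := Ht (Ordinal iL); rewrite /= (negPf u0).
  by rewrite qE.
have bt : `|beta t| <= e / 2.
  apply/rV_norm_leP => [|i]; first by rewrite divr_ge0// ltW.
  have /andP[t1 t2] : (t < 1) && (t < e / 2) by rewrite -lt_min.
  rewrite mxE ger0_norm ?exprn_ge0 ?(ltW t0)// exprS.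
  apply: le_trans (ltW t2); rewrite ler_piMr// ?(ltW t0)//.
  by rewrite exprn_ile1// ltW.
pose a u := hd u + dotp (tl u) (beta t).
pose L' := [seq tl v - (a v / a w) *: tl w | v <- L, w <- L].
have [|W [Wt [ad sj nr gp]]] := IH L' (e / 2); first by rewrite divr_gt0.
have Wlin x y c : W (x - c *: y) = W x - c *: W y.
  by apply: dotp_ext => z; rewrite ad !dotpBl !dotpZl !ad.
have W0 : W 0 = 0 by apply: dotp_ext => z; rewrite ad !dotp0l.
exists (fun u => row_cons (a u) (W (tl u))), (fun x => row_cons (hd x) (Wt (tl x) + hd x *: beta t)); split.
- move=> u x; rewrite -{1}(cons_hd_tl x) !dotp_cons hd_cons tl_cons ad dotpDr dotpZr /a; ring.
- move=> y; have [x Hx] := sj (tl y - hd y *: beta t); exists (row_cons (hd y) x).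
  by rewrite hd_cons tl_cons Hx subrK cons_hd_tl.
- move=> x; apply/rV_norm_leP => [|i]; first by rewrite mulr_ge0// ltW.
  case: (unliftP ord0 i) => [k ->|->]; last first.
    by rewrite !mxE unlift_none subrr normr0 mulr_ge0// ltW.
  rewrite mxE row_cons_lift !mxE.
  have -> : Wt (tl x) ord0 k + hd x * t ^+ k.+1 - x ord0 (lift ord0 k) =
     (Wt (tl x) - tl x) ord0 k + hd x * beta t ord0 k by rewrite !mxE; ring.
  apply: le_trans (ler_normD _ _) _; rewrite normrM.
  have tlx : `|tl x| <= `|x| by apply/rV_norm_leP => // j; rewrite mxE rV_coord_le.
  have H1 : `|(Wt (tl x) - tl x) ord0 k| <= e / 2 * `|x|.
    apply: le_trans (rV_coord_le _ _) (le_trans (nr _) _).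
    by rewrite ler_wpM2l// divr_ge0// ltW.
  have H2 : `|hd x| * `|beta t ord0 k| <= `|x| * (e / 2).
    by rewrite ler_pM// ?rV_coord_le//; apply: le_trans (rV_coord_le _ _) bt.
  lra.
- move=> N u uL /= i Wi; rewrite hd_cons; split.
    apply: Ht => //; apply/eqP => ui; apply: Wi.
    rewrite ui /a (_ : tl 0 = 0) ?W0; last by apply/rowP => j; rewrite !mxE.
    rewrite dotp0l /hd mxE addr0; apply/rowP => j; rewrite !mxE.
    by case: unliftP => // k _; rewrite mxE.
  rewrite (_ : red _ i = fun j => W (tl (u j) - (a (u j) / a (u i)) *: tl (u i))).
    by apply: gp => j; apply: allpairs_f.
  by apply/funext => j; rewrite /red !hd_cons !tl_cons Wlin.
Qed.

End Genericity.

(** * Simple polytopes are regular *)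

Section NormalRegularity.
Variables (R : realType) (N : nat).

(** At each point the normals of the tight constraints outside [D] are linearly independent. *)
Definition simple_at d (D : {set 'I_N}) (u : 'I_N -> 'rV[R]_d) (h : 'rV[R]_N) : Prop :=
  forall x, hpoly u h x -> forall c : 'I_N -> R,
    (forall j, c j != 0 -> j \notin D /\ dotp (u j) x = h ord0 j) ->
    \sum_j c j *: u j = 0 -> forall j, c j = 0.

(** A dependency among reduced normals lifts to one among the original ones: the coefficient [- s]
    at [i] cancels the multiples of [u i] subtracted by [red]. In dimension zero a single tight
    constraint is a dependency. *)
Lemma simple_regular d (D : {set 'I_N}) (u : 'I_N -> 'rV[R]_d) (h : 'rV[R]_N) : (forall j, j \in D -> u j = 0) ->
  simple_at D u h -> regular D u h.
Proof.
elim: d D u h => [|d IH] D u h Du Hs.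
  move=> h0 j jD; rewrite lt_neqAle h0 andbT; apply/eqP => hj.
  have := Hs 0 ((poly0 _ _ _).2 h0) (fun k => (k == j)%:R) _ _ j.
  rewrite eqxx; move=> /(_ _ _)/eqP; rewrite oner_eq0 => H; suff : false by [].
  apply: H => [k|]; last by apply/rowP => -[].
  by rewrite pnatr_eq0 eqb0 negbK => /eqP ->; rewrite dotp0r.
move=> i a0; apply: IH => [j jD|v Pv c Hc Ec]; first exact: (red_dead a0 Du).
set x := row_cons ((h ord0 i - dotp (tl (u i)) v) / hd (u i)) v.
have Px : hpoly u h x by exact: (poly_red _ _ a0).1 Pv.
have iD : i \notin D by apply/negP => /Du ui; move: a0; rewrite ui /hd mxE eqxx.
have xi : dotp (u i) x = h ord0 i.
  by rewrite /x dotp_cons mulrC divfK// subrK.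
pose s := \sum_j c j * hd (u j) / hd (u i).
have ci : c i = 0 by apply/eqP/negPn/negP => /Hc[]; rewrite in_setU1 eqxx.
have Hz : \sum_j (if j == i then - s else c j) *: u j = 0.
  have -> : \sum_j (if j == i then - s else c j) *: u j = \sum_j c j *: u j - s *: u i.
    rewrite (bigD1 i)//= eqxx [in RHS](bigD1 i)//= ci scale0r add0r addrC scaleNr; congr (_ - _).
    by apply: eq_bigr => j /negPf ->.
  apply/rowP => k; case: (unliftP ord0 k) => [k' ->|->]; rewrite !mxE summxE.
    have /(congr1 (fun w : 'rV[R]_d => w ord0 k')) := Ec; rewrite mxE summxE => E; rewrite -[RHS]E.
    rewrite /s big_distrl -sumrB; apply: eq_bigr => j _ /=; rewrite !mxE; ring.
  rewrite /s big_distrl -sumrB big1// => j _ /=; rewrite !mxE -/(hd _) -/(hd _).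
  by rewrite divfK// subrr.
have Hall := Hs x Px (fun j => if j == i then - s else c j) _ Hz.
move=> j; have [->//|ji] := eqVneq j i.
have := Hall _ j; rewrite (negPf ji); apply=> k.
case: (k =P i) => [-> _//|ki /Hc[]].
rewrite in_setU1 negb_or => /andP[_ kD]; rewrite (dotp_red k (h ord0 i) v a0) mxE -/x => E.
by split=> //; lra.
Qed.

End NormalRegularity.

(** * Generic perturbations of fan-linear support functions are simple *)

Section SimpleFan.
Variables (R : realType) (n : nat) (F : finType) (pt : F -> 'rV[R]_n).
Variables (N : nat) (u : 'I_N -> 'rV[R]_n).
Hypothesis cone : forall w, exists a : 'I_N -> R,
  [/\ forall j, 0 <= a j, w = \sum_j a j *: u j & forall j, a j != 0 -> compat pt w (u j)].

Lemma fan_linearD H H' (s : R) : fan_linear pt H -> fan_linear pt H' ->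
  fan_linear pt (fun w => H w + s * H' w).
Proof.
move=> hH hH' w; have [y Hy] := hH w; have [y' Hy'] := hH' w; exists (y + s *: y') => w' c.
by rewrite Hy// Hy'// dotpDr dotpZr.
Qed.

Lemma fan_linear_sum (I : finType) (mu : I -> R) (H : I -> 'rV[R]_n -> R) :
  (forall i, fan_linear pt (H i)) -> fan_linear pt (fun w => \sum_i mu i * H i w).
Proof.
move=> hH w; have /choice[y Hy] : forall i, exists y, forall w', compat pt w w' -> H i w' = dotp w' y.
  by move=> i; exact: hH.
exists (\sum_i mu i *: y i) => w' c; rewrite dotp_sumr; apply: eq_bigr => i _.
by rewrite dotpZr Hy.
Qed.

Lemma fan_linear_cone H w (a : 'I_N -> R) : fan_linear pt H -> w = \sum_j a j *: u j ->
  (forall j, a j != 0 -> compat pt w (u j)) -> H w = \sum_j a j * H (u j).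
Proof.
move=> hH Ew cw; have [y Hy] := hH w; rewrite Hy// {1}Ew dotp_suml; apply: eq_bigr => j _.
rewrite dotpZl; have [->|aj] := eqVneq (a j) 0; first by rewrite !mul0r.
by rewrite Hy//; exact: cw.
Qed.

Lemma fan_poly_le H x w : fan_linear pt H -> (forall j, dotp (u j) x <= H (u j)) -> dotp w x <= H w.
Proof.
move=> hH Hx; have [a [a0 Ew cw]] := cone w; rewrite (fan_linear_cone hH Ew cw) {1}Ew dotp_suml.
by apply: ler_sum => j _; rewrite dotpZl ler_wpM2l.
Qed.

Definition dependency (S : {set 'I_N}) (c : 'rV[R]_N) : Prop :=
  [/\ c != 0, forall j, c ord0 j != 0 -> j \in S & \sum_j c ord0 j *: u j = 0].

(** Tight normals at [x] lie in one cell, where [H + s zono] is linear, given by some [y]. Pairing a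
    dependency [c] of these normals with [x - y] leaves [del] times the sum of the [c_j g_j], which
    must vanish; the choice of [g] excludes this. *)
Lemma fan_simple : exists2 g : 'rV[R]_N, forall j, 0 < g ord0 j <= 1 &
  forall s : R, 0 < s -> exists2 e : R, 0 < e & forall del, 0 < del < e ->
  forall H, fan_linear pt H -> subadd H ->
  simple_at finset.set0 u (\row_j (H (u j) + s * zono pt (u j) + del * g ord0 j)).
Proof.
(* One dependency is chosen for each set [S] before [H] and [x] are known, so finitely many
   polynomials have to be avoided. *)
have [|t /andP[t0 t1] Ht] := @generic_param R {set 'I_N} (fun S =>
    if `[< exists c, dependency S c >] then rVpoly (xget 0 (dependency S)) else 1) 1 _ ltr01.
  move=> S; case: ifPn => [/asboolP ex|_]; last exact: oner_neq0.
  have [c0 _ _] := @xgetPex _ 0 _ ex; apply: contra c0 => /eqP E.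
  by rewrite -(rVpolyK (xget 0 (dependency S))) E linear0.
pose g : 'rV[R]_N := \row_j t ^+ j.
have g01 j : 0 < g ord0 j <= 1 by rewrite mxE exprn_gt0//= exprn_ile1// ltW.
exists g => // s s0.
have /choice[a Ha] : forall jk : 'I_N * 'I_N, exists a : 'I_N -> R,
    [/\ forall j, 0 <= a j, u jk.1 + u jk.2 = \sum_j a j *: u j &
        forall j, a j != 0 -> compat pt (u jk.1 + u jk.2) (u j)] by move=> jk; exact: cone.
pose A jk := \sum_l a jk l * g ord0 l.
have A0 jk : 0 <= A jk.
  by apply: sumr_ge0 => l _; rewrite mulr_ge0//; [case: (Ha jk)|case/andP: (g01 l) => /ltW].
pose gap jk := zono pt (u jk.1) + zono pt (u jk.2) - zono pt (u jk.1 + u jk.2).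
have [jk|e e0 He] := @exists_small R ('I_N * 'I_N)%type (fun jk del => 0 < gap jk -> del * A jk < s * gap jk).
  have [gp|gp] := ltP 0 (gap jk); last by exists 1.
  exists (s * gap jk / (A jk + 1)); first by rewrite divr_gt0 ?mulr_gt0// ltr_wpDl.
  move=> del /andP[d0]; rewrite ltr_pdivlMr ?ltr_wpDl// => H _; apply: le_lt_trans H.
  by rewrite ler_wpM2l ?lerDl// ltW.
exists e => // del dele H hH sH x Px c Hc Ec; have /andP[d0 _] := dele.
apply: contrapT => /existsNP[j0 /eqP cj0].
pose HH w := H w + s * zono pt w.
have hHH : fan_linear pt HH by apply: fan_linearD hH (@zono_linear _ _ _ pt).
pose S : {set 'I_N} := finset (fun j => dotp (u j) x == HH (u j) + del * g ord0 j).
have Px' j : dotp (u j) x <= HH (u j) + del * g ord0 j by have := Px j; rewrite mxE.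
have ex : exists c, dependency S c.
  exists (\row_j c j); split.
  - by apply/eqP => /rowP/(_ j0); rewrite !mxE => E; rewrite E eqxx in cj0.
  - by move=> j; rewrite mxE inE => /Hc[_ ->]; rewrite mxE.
  - by rewrite -[RHS]Ec; apply: eq_bigr => j _; rewrite mxE.
have [cs0 csS csu] := @xgetPex _ 0 _ ex.
have := Ht S; rewrite (asboolT ex); set cs := xget 0 (dependency S) in cs0 csS csu *.
move=> /eqP; apply.
have cons j k fg : j \in S -> k \in S -> 0 < dotp (u k) (pdiff pt fg) -> 0 <= dotp (u j) (pdiff pt fg).
  rewrite !inE => /eqP jS /eqP kS uk; rewrite leNgt; apply/negP => uj.
  have gp : 0 < gap (k, j) by rewrite subr_gt0; exact: zono_strict uk uj.
  have := He _ dele _ gp; apply/negP; rewrite -leNgt.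
  have [a0 Ew cw] := Ha (k, j); rewrite /= in Ew cw.
  have : dotp (u k + u j) x <= HH (u k + u j) + del * A (k, j).
    rewrite {1}Ew dotp_suml (fan_linear_cone hHH Ew cw) /A mulr_sumr -big_split.
    by apply: ler_sum => l _ /=; rewrite dotpZl mulrCA -mulrDr ler_wpM2l.
  rewrite dotpDl jS kS /HH /gap /= => H1; have := sH (u k) (u j).
  have := mulr_gt0 d0 (andP (g01 k)).1; have := mulr_gt0 d0 (andP (g01 j)).1; lra.
have cS j : j \in S -> compat pt (\sum_(k in S) u k) (u j).
  move=> jS fg; rewrite leNgt; apply: contraTT => uj; rewrite -ltNge in uj *.
  have uS k : k \in S -> dotp (u k) (pdiff pt fg) <= 0.
    move=> kS; rewrite leNgt; apply/negP => uk.
    by have := cons j k fg jS kS uk; rewrite leNgt uj.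
  rewrite dotp_suml (bigD1 j)//=; rewrite -[ltRHS]addr0 ltr_leD//.
  by apply: sumr_le0 => k /andP[/uS].
have [y Hy] := hHH (\sum_(k in S) u k).
have : \sum_j cs ord0 j * (dotp (u j) x - dotp (u j) y) = 0.
  have dz z : \sum_j cs ord0 j * dotp (u j) z = 0.
    transitivity (dotp (\sum_j cs ord0 j *: u j) z); last by rewrite csu dotp0l.
    by rewrite dotp_suml; apply: eq_bigr => j _; rewrite dotpZl.
  by under eq_bigr do rewrite mulrBr; rewrite sumrB !dz subrr.
have -> : \sum_j cs ord0 j * (dotp (u j) x - dotp (u j) y) = del * \sum_j cs ord0 j * g ord0 j.
  rewrite mulr_sumr; apply: eq_bigr => j _.
  have [->|cj] := eqVneq (cs ord0 j) 0; first by rewrite !mul0r mulr0.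
  have jS := csS j cj; have := jS; rewrite inE => /eqP ->; rewrite Hy; last exact: cS.
  by ring.
move=> /eqP; rewrite mulf_eq0 gt_eqF//= => /eqP <-.
rewrite horner_poly; apply: eq_bigr => j _; rewrite mxE.
by rewrite valK.
Qed.

End SimpleFan.

(** * Grid points, their fan and the support numbers of the bodies *)

Section FanData.
Variable R : realType.

(** Each coordinate is rounded up or down according to the sign of [w], so the nearby grid point
    also reaches at least as far in the direction [w]. Indices go up to [T + 1] to leave room for
    rounding up. *)
Lemma grid n (L r : R) : 0 < r -> exists (F : finType) (pt : F -> 'rV[R]_n),
  forall z w, `|z| <= L -> exists f, dotp w z <= dotp w (pt f) /\ `|pt f - z| <= r.
Proof.
move=> r0; pose T := Num.truncn (2 * L / r).
exists {ffun 'I_n -> 'I_T.+2}, (fun f : {ffun 'I_n -> 'I_T.+2} => \row_i (- L + r * (f i)%:R)) => z w zL.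
have zi i : `|z ord0 i| <= L by apply: le_trans (rV_coord_le _ _) zL.
have L0 : 0 <= L by apply: le_trans zL.
pose x i := (z ord0 i + L) / r; pose k i := Num.truncn (x i).
have x0 i : 0 <= x i by apply: divr_ge0; [have := zi i; rewrite ler_norml => /andP[? ?]; lra|exact: ltW].
have kx i : (k i)%:R <= x i < (k i).+1%:R by exact: truncn_itv.
have kr i : - L + r * (k i)%:R <= z ord0 i < - L + r * (k i).+1%:R.
  have /andP[] := kx i; rewrite ler_pdivlMr// ltr_pdivrMr// ![_ * r]mulrC => ? ?; apply/andP; split; lra.
have kT i : (k i <= T)%N.
  have : (k i)%:R < T.+1%:R :> R.
    have /andP[k1 _] := kx i; apply: le_lt_trans k1 _.
    have /andP[_ k2] : (T%:R : R) <= 2 * L / r < T.+1%:R.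
      by apply: truncn_itv; apply: divr_ge0; [exact: mulr_ge0|exact: ltW].
    apply: le_lt_trans k2; rewrite ler_pM2r ?invr_gt0//.
    by have := zi i; rewrite ler_norml => /andP[? ?]; lra.
  by rewrite ltr_nat ltnS.
exists [ffun i => inord (k i + (0 <= w ord0 i)%R)].
have fE i : ([ffun i => inord (k i + (0 <= w ord0 i)%R)] : {ffun 'I_n -> 'I_T.+2}) i = (k i + (0 <= w ord0 i)%R)%N :> nat.
  by rewrite ffunE inordK// ltnS; move: (0 <= _) (kT i) => -[] /=; rewrite ?addn1 ?addn0 => // /leqW.
split.
  apply: ler_sum => i _; rewrite mxE fE; have /andP[k1 k2] := kr i.
  have [w0|w0] := leP 0 (w ord0 i); first by rewrite ler_wpM2l// addn1 ltW.
  by rewrite ler_wnM2l ?addn0// ltW.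
apply/rV_norm_leP => [|i]; first exact: ltW.
rewrite !mxE fE; have /andP[k1 k2] := kr i; rewrite -natr1 in k2.
by case: (0 <= w ord0 i); rewrite ?addn1 ?addn0 -?natr1 ler_norml; apply/andP; split; lra.
Qed.

Lemma bodies_bounded n (I : finType) (C : I -> set 'rV[R]_n) : (forall i, compact (C i)) ->
  exists2 L : R, 0 < L & forall i x, C i x -> `|x| <= L.
Proof.
move=> cC; have /choice[B HB] : forall i, exists B : R, forall x, C i x -> `|x| <= B.
  move=> i; have [B [_ HB]] := compact_bounded (cC i); exists (B + 1) => x Cx.
  by apply: HB => //; rewrite ltrDl.
exists (1 + \sum_i `|B i|); first by rewrite ltr_pwDl// sumr_ge0.
move=> i x Cx; apply: le_trans (HB i x Cx) _; rewrite (bigD1 i)//=.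
have : 0 <= \sum_(j | j != i) `|B j| by rewrite sumr_ge0.
have := ler_norm (B i); lra.
Qed.

Lemma thick_le n (A : set 'rV[R]_n) (r r' : R) : r <= r' -> thick A r `<=` thick A r'.
Proof. by move=> rr x [y Ay xy]; exists y => //; apply: le_trans rr. Qed.

(** [k i] belongs to the hull of the grid points within [2 * r] of [C i]. The zonotope part [z] and
    the generic part [g] are returned separately, because [del] can only be chosen after [s]. *)
Lemma fan_data n (I : finType) (C : I -> set 'rV[R]_n) (r : R) :
  (forall i, compact (C i)) -> (forall i, Defs.convex_set (C i)) -> (forall i, C i !=set0) -> 0 < r ->
  exists N (u : 'I_N -> 'rV[R]_n) (k : I -> 'rV[R]_N) (z g : 'rV[R]_N),
  [/\ spans u, forall i, thick (C i) r `<=` hpoly u (k i),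
    forall i j, C i `<=` C j -> forall l, k i ord0 l <= k j ord0 l,
    forall w : I -> R, (forall i, 0 <= w i) ->
      hpoly u (\sum_i w i *: k i) `<=` wsum w (fun i => thick (C i) (2 * r)) &
    (forall l, 0 <= z ord0 l /\ 0 < g ord0 l <= 1) /\
    forall s : R, 0 < s -> exists2 e : R, 0 < e & forall del, 0 < del < e ->
      forall mu : I -> R, (forall i, 0 <= mu i) ->
      simple_at finset.set0 u (\sum_i mu i *: k i + s *: z + del *: g)].
Proof.
move=> cC vC C0 r0.
have [L L0 HL] := @bodies_bounded n I (fun i => thick (C i) r) (fun i => @thick_compact R n (C i) r (cC i)).
have [F [pt Hpt]] := grid n L r0.
have span y : (forall fg, dotp y (pdiff pt fg) = 0) -> y = 0.
  move=> Hy; apply: contrapT => /eqP y0; have ny : 0 < `|y| by rewrite normr_gt0.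
  pose c := L / `|y|; have c0 : 0 < c by rewrite divr_gt0.
  have nc : `|c *: y| <= L by rewrite normrZ gtr0_norm// divfK// gt_eqF.
  have [f [Hf _]] := Hpt (c *: y) y nc.
  have [|f' [Hf' _]] := Hpt (- (c *: y)) (- y); first by rewrite normrN.
  have := Hy (f, f'); rewrite /pdiff dotpBr /=; rewrite !dotpNl dotpNr opprK dotpZr in Hf'.
  rewrite dotpZr in Hf; have yy : 0 < dotp y y.
    by rewrite lt_neqAle dotp_ge0 andbT eq_sym; apply/eqP => /dotp_eq0 E; rewrite E eqxx in y0.
  by have := mulr_gt0 c0 yy; lra.
pose V i : {set F} := finset (fun f => `[< thick (C i) (2 * r) (pt f) >]).
have cover i x w : thick (C i) r x -> exists2 f, f \in V i & dotp w x <= dotp w (pt f).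
  move=> Cx; have [f [H1 H2]] := Hpt x w (HL i x Cx); exists f => //.
  rewrite inE; apply/asboolP; have [y Cy xy] := Cx; exists y => //.
  rewrite (_ : pt f - y = (pt f - x) + (x - y)); last by rewrite addrA subrK.
  by apply: le_trans (ler_normD _ _) _; rewrite mulr_natl mulr2n lerD.
have V0 i : V i != finset.set0.
  have [x Cx] := C0 i; have [|f fV _] := @cover i x 0; last by apply/set0Pn; exists f.
  by exists x => //; rewrite subrr normr0 ltW.
pose J := ({set F * F} * bool)%type; pose u (j : 'I_#|{: J}|) := fanray pt (enum_val j : J).
have cone w : exists a : 'I_#|{: J}| -> R,
  [/\ forall j, 0 <= a j, w = \sum_j a j *: u j & forall j, a j != 0 -> compat pt w (u j)].
  have [a [a0 Ew cw]] := fan_cone span w; exists (fun j => a (enum_val j)); split=> //.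
    rewrite {1}Ew -(big_enum_val (fun j => a j *: fanray pt j)) /=.
    by apply: eq_bigl.
  by move=> j; exact: cw.
have [g g01 Hg] := fan_simple cone.
exists #|{: J}|, u, (fun i => \row_j supp pt (V i) (u j)), (\row_j zono pt (u j)), g; split.
- move=> v Hv; apply: dotp_eq0; apply/eqP; rewrite eq_le dotp_ge0 andbT.
  apply: (@fan_poly_le _ _ _ pt _ u cone (fun=> 0)) => //.
  by move=> w; exists 0 => w' _; rewrite dotp0r.
- by move=> i x Cx j; have [f fV Hf] := cover i x (u j) Cx; rewrite mxE (le_trans Hf)// supp_ge.
- move=> i j Cij l; rewrite !mxE supp_subset//; apply/fintype.subsetP => f; rewrite inE => /asboolP[y Cy fy].
  by rewrite inE; apply/asboolP; exists y => //; exact: Cij.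
(* The support functions are linear on cells, so the inequalities at the normals imply those in
   every direction [om], and [x] cannot be separated from the weighted sum. *)
- move=> w w0 x Px; apply: contrapT => nx.
  have [||||om Hom] := @separation R n (wsum w (fun i => thick (C i) (2 * r))) x.
  + by apply: wsum_compact => i; exact: thick_compact.
  + by apply: wsum_convex => i; exact: thick_convex.
  + have /choice[y Hy] : forall i, exists y, C i y by move=> i; have [y] := C0 i; exists y.
    exists (\sum_i w i *: y i), y; split=> // i; exists (y i) => //.
    by rewrite subrr normr0 mulr_ge0// ltW.
  + by [].
  have /choice[f Hf] : forall i, exists f, f \in V i /\ supp pt (V i) om = dotp om (pt f).
    by move=> i; have [f ? [? _]] := suppP pt om (V0 i); exists f.
  have /Hom : wsum w (fun i => thick (C i) (2 * r)) (\sum_i w i *: pt (f i)).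
    exists (fun i => pt (f i)); split=> // i; have [fV _] := Hf i.
    by move: fV; rewrite inE => /asboolP.
  rewrite ltNge => /negP; apply.
  have := @fan_poly_le _ _ _ pt _ u cone (fun w' => \sum_i w i * supp pt (V i) w') x om.
  have -> : \sum_i w i * supp pt (V i) om = dotp om (\sum_i w i *: pt (f i)).
    by rewrite dotp_sumr; apply: eq_bigr => i _; rewrite dotpZr (Hf i).2.
  apply; first by apply: fan_linear_sum => i; exact: supp_linear.
  move=> j; apply: le_trans (Px j) _; rewrite summxE le_eqVlt; apply/orP; left; apply/eqP.
  by apply: eq_bigr => i _; rewrite !mxE.
- split=> [l|s s0]; first by rewrite mxE zono_ge0.
  have [e e0 He] := Hg s s0; exists e => // del dele mu mu0.
  have -> : \sum_i mu i *: (\row_j supp pt (V i) (u j)) + s *: (\row_j zono pt (u j)) + del *: g =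
      \row_j ((\sum_i mu i * supp pt (V i) (u j)) + s * zono pt (u j) + del * g ord0 j).
    apply/rowP => j; rewrite !mxE summxE; congr (_ + _ + _).
    by apply: eq_bigr => i _; rewrite !mxE.
  apply: (He del dele (fun w => \sum_i mu i * supp pt (V i) w)).
    by apply: fan_linear_sum => i; exact: supp_linear.
  move=> w w'; rewrite -big_split; apply: ler_sum => i _ /=; rewrite -mulrDr ler_wpM2l//.
  exact: supp_subadd.
Qed.

End FanData.

(** * Simultaneous approximation of bodies by polytopes of one chamber *)

Section Approximation.
Variable R : realType.

Lemma hpoly_le N d (u : 'I_N -> 'rV[R]_d) (h h' : 'rV[R]_N) :
  (forall j, h ord0 j <= h' ord0 j) -> hpoly u h `<=` hpoly u h'.
Proof. by move=> hh x Hx j; apply: le_trans (hh j). Qed.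

Lemma hpoly_vol_relax N d (u : 'I_N -> 'rV[R]_d) (h : 'rV[R]_N) (c : R) : spans u ->
  (vol (hpoly u h) < c%:E)%E ->
  exists2 t : R, 0 < t & (vol (hpoly u (h + const_mx t)) < c%:E)%E.
Proof.
move=> su Hv; pose e k : R := k.+1%:R^-1.
have [|||k Hk] := @vol_decreasing R d (fun k => hpoly u (h + const_mx (e k))) c.
- by move=> k; exact: hpoly_compact.
- move=> k; apply: hpoly_le => j; rewrite !mxE lerD2l.
  by rewrite /e lef_pV2 ?posrE// ler_nat.
- rewrite (_ : \bigcap_k _ = hpoly u h)//; apply/seteqP; split=> [x Hx j|x Hx k _]; last first.
    by apply: hpoly_le Hx => j; rewrite !mxE lerDl invr_ge0.
  rewrite leNgt; apply/negP => /ltr_add_invr[k Hk].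
  by have := Hx k I j; rewrite !mxE leNgt Hk.
by exists (e k) => //; rewrite invr_gt0.
Qed.

(** Each weighted sum of bodies lies in its polytope, which gives the lower estimate; the upper one
    is continuity of the volume from above. Inclusions survive as inequalities of support vectors
    because the nearby grid points increase with the body. *)
Lemma approx_chamber n (I : finType) (C : I -> set 'rV[R]_n) (Om : finType)
    (w : Om -> I -> R) (eps : R) :
  (forall i, compact (C i)) -> (forall i, Defs.convex_set (C i)) -> (forall i, C i !=set0) ->
  (forall om i, 0 <= w om i) -> 0 < eps ->
  exists N (u : 'I_N -> 'rV[R]_n) (U : set 'rV[R]_N) (p : I -> 'rV[R]_N),
  [/\ chamber finset.set0 u U, forall i, U (p i), forall i, hpoly u (p i) !=set0,
    forall i j, C i `<=` C j -> forall l, p i ord0 l <= p j ord0 l &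
    forall om, (vol (wsum (w om) C) <= vol (hpoly u (\sum_i w om i *: p i)) /\
      vol (hpoly u (\sum_i w om i *: p i)) <= vol (wsum (w om) C) + eps%:E)%E].
Proof.
move=> cC vC C0 w0 eps0.
have cw om : compact (wsum (w om) C) by exact: wsum_compact.
pose v om := fine (vol (wsum (w om) C)).
have vE om : vol (wsum (w om) C) = (v om)%:E by rewrite fineK//; exact: vol_fin_num.
have /choice[r Hr] : forall om, exists r, 0 < r /\ (vol (thick (wsum (w om) C) r) < (v om + eps)%:E)%E.
  by move=> om; have [|r ? ?] := @vol_thick R n _ (v om + eps) (cw om); [rewrite vE lte_fin ltrDl|exists r].
pose Sw om := \sum_i w om i.
have Sw0 om : 0 <= Sw om by exact: sumr_ge0.
have [om|r2 r20 Hr2] := @exists_small R Om (fun om t => Sw om * (2 * t) <= r om).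
  have S1 : 0 < 2 * (Sw om + 1) by rewrite mulr_gt0// ltr_wpDl.
  exists (r om / (2 * (Sw om + 1))); first by rewrite divr_gt0// (Hr om).1.
  move=> t /andP[t0]; rewrite ltr_pdivlMr// => H; have := Sw0 om; nra.
pose r1 := r2 / 2; have r10 : 0 < r1 by rewrite divr_gt0.
have {}Hr2 om : Sw om * (2 * r1) <= r om by apply: Hr2; rewrite r10 /r1; lra.
have [N [u [k [z [g [su Hk kmono Hup [zg Hreg]]]]]]] := fan_data cC vC C0 r10.
pose hh om := \sum_i w om i *: k i.
have up om : (vol (hpoly u (hh om)) < (v om + eps)%:E)%E.
  apply: le_lt_trans (Hr om).2; apply: vol_le => x /(Hup (w om) (w0 om)) Hx.
  by have := wsum_thick (w0 om) Hx; apply: thick_le; rewrite Hr2.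
have [om|t2 t20 Ht2] := @exists_small R Om
    (fun om t => (vol (hpoly u (hh om + const_mx t)) < (v om + eps)%:E)%E).
  have [t t0 Ht] := hpoly_vol_relax su (up om); exists t => // t' /andP[_ tt].
  by apply: le_lt_trans Ht; apply: vol_le; apply: hpoly_le => j; rewrite !mxE lerD2l ltW.
(* The slack [t] in the support numbers is shared: a quarter each for the zonotope and the generic
   perturbation, half for the linear map. *)
pose t := t2 / 2; have t0 : 0 < t by rewrite divr_gt0.
have Ht om : (vol (hpoly u (hh om + const_mx t)) < (v om + eps)%:E)%E.
  by apply: Ht2; rewrite t0 /t; lra.
pose Wm := 1 + \sum_om Sw om; pose Z := 1 + \sum_j z ord0 j.
have Wm0 : 0 < Wm by rewrite ltr_pwDl// sumr_ge0.
have Z0 : 0 < Z by rewrite ltr_pwDl// sumr_ge0// => j _; exact: (zg j).1.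
have SwW om : Sw om <= Wm.
  rewrite /Wm (bigD1 om)//=; have : 0 <= \sum_(i | i != om) Sw i by exact: sumr_ge0.
  lra.
have zZ j : z ord0 j <= Z.
  rewrite /Z (bigD1 j)//=.
  have : 0 <= \sum_(i | i != j) z ord0 i by apply: sumr_ge0 => i _; exact: (zg i).1.
  lra.
pose s := t / (4 * Wm * Z); have s0 : 0 < s by rewrite divr_gt0// !mulr_gt0.
have [e e0 He] := Hreg s s0.
pose del := Num.min (e / 2) (t / (4 * Wm)).
have del0 : 0 < del by rewrite lt_min !divr_gt0// mulr_gt0.
have dele : 0 < del < e.
  rewrite del0; have : del <= e / 2 by rewrite ge_min lexx.
  lra.
have delt : Wm * del <= t / 4.
  have : del <= t / (4 * Wm) by rewrite ge_min lexx orbT.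
  by rewrite ler_pdivlMr ?mulr_gt0//; lra.
have sW : Wm * s * Z = t / 4 by rewrite /s; field; rewrite !gt_eqF.
pose p i := k i + s *: z + del *: g.
have kp i j : k i ord0 j <= p i ord0 j.
  have [z1 /andP[g0 _]] := zg j; rewrite !mxE.
  by have := mulr_ge0 (ltW s0) z1; have := mulr_ge0 (ltW del0) (ltW g0); lra.
have sumE (mu : I -> R) : \sum_i mu i *: p i =
    \sum_i mu i *: k i + ((\sum_i mu i) * s) *: z + ((\sum_i mu i) * del) *: g.
  rewrite -(scalerA _ s) -(scalerA _ del) !scaler_suml -!big_split /=; apply: eq_bigr => i _.
  by rewrite /p !scalerDr.
have pup om j : (\sum_i w om i *: p i) ord0 j <= (hh om) ord0 j + t / 2.
  rewrite sumE -/(hh om) -/(Sw om) mxE [X in X + _ <= _]mxE [X in _ + X + _ <= _]mxE [X in _ + X <= _]mxE.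
  have H1 : Sw om * s * z ord0 j <= t / 4.
    rewrite -sW; apply: ler_pM => //; first by rewrite mulr_ge0// ltW.
      exact: (zg j).1.
    by rewrite ler_wpM2r// ltW.
  have H2 : Sw om * del * g ord0 j <= t / 4.
    apply: le_trans delt; have [_ /andP[g0 g1]] := zg j.
    rewrite -[leRHS]mulr1; apply: ler_pM => //; first by rewrite mulr_ge0// ltW.
      exact: ltW.
    by rewrite ler_wpM2r// ltW.
  lra.
have [Cb Cb0 HCb] := spans_bound su.
have [L L0 HL] := bodies_bounded cC.
pose Bd := Cb * \sum_om \sum_j `|(\sum_i w om i *: p i) ord0 j|.
have Bd0 : 0 <= Bd by rewrite mulr_ge0// sumr_ge0// => om _; exact: sumr_ge0.
have HBd om x : hpoly u (\sum_i w om i *: p i) x -> `|x| <= Bd.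
  move=> /HCb H; apply: le_trans H _; rewrite ler_wpM2l// [leRHS](bigD1 om)//= lerDl.
  by apply: sumr_ge0 => ? _; exact: sumr_ge0.
pose Un := 1 + n%:R * \sum_j `|u j|.
have Un0 : 0 < Un by rewrite ltr_pwDl// mulr_ge0// sumr_ge0.
have uU j : n%:R * `|u j| <= Un.
  apply: (@le_trans _ _ (n%:R * \sum_j `|u j|)); last by rewrite lerDr.
  by rewrite ler_wpM2l// (bigD1 j)//= lerDl sumr_ge0.
(* The three bounds give [|x| <= 2 |Wt x|], keep moved points of the bodies within [r1] of them, and
   limit the change of the support numbers to [t / 2]. *)
pose e2 := Num.min 2^-1 (Num.min (r1 / L) (t / (4 * Un * (Bd + 1)))).
have UB : 0 < 4 * Un * (Bd + 1) by rewrite !mulr_gt0// ltr_wpDl.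
have e20 : 0 < e2 by rewrite !lt_min !divr_gt0// invr_gt0 ltr0n.
have [e2a e2b e2c] : [/\ e2 <= 2^-1, e2 * L <= r1 & Un * e2 * (Bd + 1) <= t / 4].
  split; first by rewrite ge_min lexx.
    by rewrite -ler_pdivlMr// !ge_min lexx !orbT.
  have : e2 <= t / (4 * Un * (Bd + 1)) by rewrite !ge_min lexx !orbT.
  by rewrite ler_pdivlMr//; lra.
have [W [Wt [ad sj nr gp]]] := @generic_rotation R n (codom u) e2 e20.
have hW h x : hpoly (fun j => W (u j)) h x <-> hpoly u h (Wt x).
  by split=> H j; have := H j; rewrite ad.
have nWt x : `|x| <= 2 * `|Wt x|.
  have : `|x| <= `|Wt x| + `|Wt x - x| by rewrite -{1}(subKr (Wt x) x) ler_normB.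
  have := nr x; have : e2 * `|x| <= 2^-1 * `|x| by rewrite ler_wpM2r.
  lra.
have low om : wsum (w om) C `<=` hpoly (fun j => W (u j)) (\sum_i w om i *: p i).
  move=> _ [y [Cy ->]] j; rewrite dotp_sumr summxE; apply: ler_sum => i _.
  rewrite dotpZr mxE ler_wpM2l// ad (le_trans _ (kp i j))//; apply: Hk.
  exists (y i) => //; apply: le_trans (nr _) (le_trans _ e2b).
  by rewrite ler_wpM2l ?(ltW e20)// (HL i).
(* [U] is the hull of the [p i]. As weights sum to 1, all its points carry the same perturbation
   [s *: z + del *: g], and one [del] makes them all simple. *)
exists N, (fun j => W (u j)), [set h | exists mu : I -> R, [/\ forall i, 0 <= mu i, \sum_i mu i = 1 & h = \sum_i mu i *: p i]], p; split.
- split.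
  + by apply: gp => j; exact: codom_f.
  + move=> x Hx; apply/eqP; rewrite -normr_le0 (le_trans (nWt x))//.
    by rewrite (su (Wt x)) ?normr0 ?mulr0// => j; rewrite -ad.
  + by move=> j; rewrite inE.
  + move=> _ _ [mu [mu0 mu1 ->]] [nu [nu0 nu1 ->]] l /andP[l0 l1].
    exists (fun i => l * mu i + (1 - l) * nu i); split.
    * by move=> i; rewrite addr_ge0// mulr_ge0// subr_ge0.
    * by rewrite big_split -!mulr_sumr mu1 nu1 /=; ring.
    * rewrite !scaler_sumr -big_split; apply: eq_bigr => i _ /=.
      by rewrite [RHS]scalerDl -(scalerA l) -(scalerA (1 - l)).
  + move=> _ [mu [mu0 mu1 ->]]; rewrite sumE mu1 !mul1r.
    apply: simple_regular => [j|x /hW Px c Hc Ec]; first by rewrite inE.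
    apply: (He del dele mu mu0 (Wt x) Px) => [j /Hc[_ <-]|]; first by rewrite inE ad.
    apply: dotp_ext => y; have [x' <-] := sj y; rewrite dotp0l dotp_suml.
    transitivity (dotp (\sum_j c j *: W (u j)) x'); last by rewrite Ec dotp0l.
    by rewrite dotp_suml; apply: eq_bigr => j _; rewrite !dotpZl ad.
  + by move=> h Uh j; rewrite inE.
- move=> i; exists (fun l => (l == i)%:R); split=> [l||]; first exact: ler0n.
    by rewrite (bigD1 i)//= eqxx big1 ?addr0// => l /negPf ->.
  rewrite (bigD1 i)//= eqxx scale1r big1 ?addr0// => k' /negPf ->.
  by rewrite scale0r.
- move=> i; have [y Cy] := C0 i; have [x Hx] := sj y; exists x; apply/hW; rewrite Hx.
  apply: hpoly_le (kp i) _ _; apply: Hk; exists y => //.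
  by rewrite subrr normr0 ltW.
- by move=> i j Cij l; rewrite !mxE !lerD2r; exact: kmono.
- move=> om; split; first exact: vol_le (low om).
  rewrite vE -EFinD; apply: le_trans (ltW (Ht om)); apply: vol_le => x /hW Px j.
  rewrite mxE [X in _ <= _ + X]mxE.
  have -> : dotp (u j) x = dotp (u j) (Wt x) - dotp (u j) (Wt x - x) by rewrite dotpBr; ring.
  have H1 : dotp (u j) (Wt x) <= hh om ord0 j + t / 2 by apply: le_trans (Px j) (pup om j).
  have H2 : - dotp (u j) (Wt x - x) <= t / 2.
    apply: le_trans (ler_norm _) _; rewrite normrN; apply: le_trans (dotp_norm _ _) _.
    have H3 : `|Wt x - x| <= e2 * (2 * (Bd + 1)).
      apply: le_trans (nr x) _; rewrite ler_wpM2l ?(ltW e20)//.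
      have := nWt x; have := HBd om _ Px; lra.
    have : n%:R * `|u j| * `|Wt x - x| <= Un * (e2 * (2 * (Bd + 1))) by apply: ler_pM => //; rewrite mulr_ge0.
    rewrite mulrA; lra.
  lra.
Qed.

End Approximation.

(** * Polarization of the mixed form *)

Section Polarization.
Variable R : realType.

Lemma big_tuple_cons (V : nmodType) (J : finType) m (F : m.+1.-tuple J -> V) :
  \sum_t F t = \sum_j \sum_(t : m.-tuple J) F [tuple of j :: t].
Proof.
rewrite pair_bigA /= (reindex (fun p : J * m.-tuple J => [tuple of p.1 :: p.2]))//.
exists (fun t => (thead t, [tuple of behead t])) => [[j t] _|t _] /=.
  by congr pair; apply: val_inj.
by apply: val_inj; case/tupleP: t => j t.
Qed.

Lemma mvform_suml N d (u : 'I_N -> 'rV[R]_d) h (J : finType) (x : J -> 'rV[R]_N) (P : pred J) xs ys :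
  (size xs < d)%N ->
  mvform u h (xs ++ (\sum_(j | P j) x j) :: ys) = \sum_(j | P j) mvform u h (xs ++ x j :: ys).
Proof.
move=> sx; apply: (big_morph (fun y => mvform u h (xs ++ y :: ys))) => [y z|].
  by have := mvform_lin u h ys 1 y z sx; rewrite scale1r mul1r.
by have := mvform_lin u h ys (-1) 0 0 sx; rewrite scaler0 addr0 mulN1r addNr.
Qed.

Lemma mvform_expand N d (u : 'I_N -> 'rV[R]_d) h (J : finType) (x : J -> 'rV[R]_N) (P : pred J) m xs :
  (size xs + m = d)%N ->
  mvform u h (xs ++ nseq m (\sum_(j | P j) x j)) =
  \sum_(t : m.-tuple J | all P t) mvform u h (xs ++ map x t).
Proof.
elim: m xs => [|m IH] xs sx.
  rewrite (big_pred1 [tuple])//= => t; rewrite tuple0 /= eqxx//.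
rewrite /= mvform_suml; last by rewrite -sx addnS ltnS leq_addr.
rewrite [RHS]big_mkcond big_tuple_cons /= big_mkcond; apply: eq_bigr => j _.
case: (P j) => /=; last by rewrite big1.
rewrite -big_mkcond -cat_rcons IH; last by rewrite size_rcons -sx addSnnS.
by apply: eq_bigr => t _; rewrite cat_rcons.
Qed.

(** The signed sum is the expansion of the product over [i] of [1 - (i \notin t)]. *)
Lemma incl_excl n (t : seq 'I_n) :
  \sum_(S : {set 'I_n} | all (fun i => i \in S) t) (-1) ^+ (n - #|S|) = ([forall i, i \in t])%:R :> R.
Proof.
rewrite big_mkcond.
transitivity (\sum_(S in {set 'I_n}) \prod_i (if i \in S then 1 else - (i \notin t)%:R) : R).
  apply: eq_big => // S _; case: ifPn => [/allP tS|/allPn[j jt jS]]; last first.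
    by rewrite (bigD1 j)//= (negPf (jS : j \notin S)) jt oppr0 mul0r.
  transitivity (\prod_(i in finset.setC S) (-1 : R)).
    by rewrite prodr_const [in RHS]cardsCs finset.setCK card_ord.
  rewrite [LHS]big_mkcond; apply: eq_bigr => i _; rewrite finset.in_setC.
  case: (boolP (i \in S)) => //= iS; case: (boolP (i \in t)) => // /tS /= H.
  by rewrite H in iS.
transitivity (\prod_(i : 'I_n) (1 + - (i \notin t)%:R : R)); first by rewrite bigA_distr.
case: forallP => [Ht|/forallP/forallPn[i it]].
  by rewrite big1// => i _; rewrite Ht oppr0 addr0.
by rewrite (bigD1 i)//= it subrr mul0r.
Qed.

(** Inclusion-exclusion leaves the tuples in which every index occurs, that is the permutations, and
    the form is symmetric. *)
Lemma mvform_polarization N n (u : 'I_N -> 'rV[R]_n.+1) h (x : 'I_n.+1 -> 'rV[R]_N) : gen_pos u ->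
  \sum_(S : {set 'I_n.+1} | S != finset.set0)
    (-1) ^+ (n.+1 - #|S|) * mvform u h (nseq n.+1 (\sum_(i in S) x i)) =
  n.+1`!%:R * mvform u h [seq x i | i <- enum 'I_n.+1].
Proof.
move=> gu.
have E0 : (-1) ^+ (n.+1 - #|@finset.set0 'I_n.+1|) *
    mvform u h (nseq n.+1 (\sum_(i in @finset.set0 'I_n.+1) x i)) = 0.
  by rewrite big_set0 -[nseq _ _]/(0 :: nseq n 0) mvform_head0 mulr0.
pose G (S : {set 'I_n.+1}) := mvform u h (nseq n.+1 (\sum_(i in S) x i)).
have GE S : G S = \sum_(t : n.+1.-tuple 'I_n.+1 | all (fun i => i \in S) t) mvform u h (map x t).
  exact: (@mvform_expand N n.+1 u h 'I_n.+1 x (fun i => i \in S) n.+1 [::] erefl).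
transitivity (\sum_(S : {set 'I_n.+1}) (-1) ^+ (n.+1 - #|S|) * G S).
  by rewrite [RHS](bigD1 finset.set0)// [X in _ = X + _]E0 add0r.
under eq_bigr => S _ do rewrite GE mulr_sumr big_mkcond.
rewrite exchange_big /=.
transitivity (\sum_(t : n.+1.-tuple 'I_n.+1) ([forall i, i \in t])%:R * mvform u h (map x t)).
  apply: eq_bigr => t _; rewrite -incl_excl mulr_suml [RHS]big_mkcond /=.
  by [].
rewrite (eq_bigr (fun t : n.+1.-tuple 'I_n.+1 => ([forall i, i \in t])%:R * mvform u h [seq x i | i <- enum 'I_n.+1])).
  rewrite -mulr_suml -natr_sum; congr (_%:R * _).
  rewrite -ffactnn -[X in X ^_ _]card_ord -(card_uniq_tuples n.+1 xpredT) -sum1_card.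
  rewrite big_mkcond [RHS]big_mkcond /=; apply: eq_bigr => t _.
  rewrite inE all_predT /=; have -> : [forall i, i \in t] = uniq t.
    apply/idP/idP => [/forallP Ht|ut].
      apply/card_uniqP; rewrite size_tuple -[RHS]card_ord; apply: eq_card => i.
      by rewrite Ht.
    have E : #|t| = #|'I_n.+1| by rewrite (card_uniqP ut) size_tuple card_ord.
    have /(subset_cardP E) H : t \subset 'I_n.+1 by apply/fintype.subsetP.
    by apply/forallP => i; rewrite H.
  by case: uniq.
move=> t _; case: forallP => [Ht|]; last by rewrite !mul0r.
rewrite !mul1r; apply: mvform_perm => //; first by rewrite size_map size_tuple.
apply: perm_map; apply: uniq_perm; [|exact: enum_uniq|by move=> i; rewrite mem_enum Ht].
apply/card_uniqP; rewrite size_tuple -[RHS]card_ord; apply: eq_card => i.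
by rewrite Ht.
Qed.

Lemma mvform_scales N d (u : 'I_N -> 'rV[R]_d) h (J : Type) (s : seq J) (l : J -> R) (x : J -> 'rV[R]_N) xs :
  (size xs + size s = d)%N ->
  mvform u h (xs ++ [seq l j *: x j | j <- s]) = (\prod_(j <- s) l j) * mvform u h (xs ++ map x s).
Proof.
elim: s xs => [|j s IH] xs; first by rewrite big_nil mul1r.
rewrite /= addnS => sx.
have lin z ys : mvform u h (xs ++ l j *: z :: ys) = l j * mvform u h (xs ++ z :: ys).
  have ss : (size xs < d)%N by rewrite -sx ltnS leq_addr.
  have := mvform_lin u h ys (l j) z 0 ss; rewrite addr0 => ->.
  by have := mvform_lin u h ys (-1) 0 0 ss; rewrite scaler0 addr0 mulN1r addNr => ->; rewrite addr0.
rewrite lin big_cons -mulrA; congr (_ * _).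
by have := IH (rcons xs (x j)); rewrite !cat_rcons; apply; rewrite size_rcons addSn.
Qed.

(** A positive combination of points of the convex set [U] is a positive multiple of a point of [U],
    and both sides have the same homogeneity. *)
Lemma chamber_vol_comb N n (u : 'I_N -> 'rV[R]_n) U h (I : finType) (S : {set I})
    (l : I -> R) (x : I -> 'rV[R]_N) :
  chamber finset.set0 u U -> U h -> (forall i, U (x i)) -> (forall i, 0 < l i) -> S != finset.set0 ->
  vol (hpoly u (\sum_(i in S) l i *: x i)) =
  (mvform u h (nseq n (\sum_(i in S) l i *: x i)) / n`!%:R)%:E.
Proof.
move=> cU Uh Ux l0 /set0Pn[i0 i0S].
have [c [q [c0 Uq ->]]] : exists c q, [/\ 0 < c, U q & \sum_(i in S) l i *: x i = c *: q].
  have : enum S != [::] by apply/eqP => E; have := mem_enum S i0; rewrite E i0S.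
  rewrite -big_enum /=; elim: (enum S) => [//|i s IH] _.
  rewrite big_cons; have [->|sn] := eqVneq s [::]; first by exists (l i), (x i); rewrite big_nil addr0.
  have [c [q [c0 Uq ->]]] := IH sn; have lc : 0 < l i + c by rewrite addr_gt0.
  exists (l i + c), ((l i / (l i + c)) *: x i + (1 - l i / (l i + c)) *: q); split=> //.
    apply: (chamber_convex cU) => //; rewrite divr_ge0 ?(ltW (l0 i)) ?(ltW lc)//= ler_pdivrMr// mul1r.
    by rewrite lerDl ltW.
  apply/rowP => k; rewrite !mxE; field; by rewrite gt_eqF.
rewrite vol_hpoly_scale//; last exact: chamber_spans cU.
rewrite (chamber_vol cU Uh Uq) -EFinM mulrA; congr ((_ / _)%:E).
rewrite -(mvform_scale u h c (xs := nseq n q)) ?size_nseq//; congr (mvform u h _).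
by rewrite map_nseq.
Qed.

End Polarization.

(** * From pairs of entries to products *)

Section AFProduct.
Variables (R : realType).

Definition upd (X Y : finType) (f : {ffun X -> Y}) (a : X) (v : Y) : {ffun X -> Y} :=
  [ffun k => if k == a then v else f k].

(* A minimiser of [T f ^+ m / \prod_k T (cst (f k))] stays a minimiser when the
   value at one position is copied to another one, so a constant function is a
   minimiser, and the minimum is 1. *)
Lemma AF_product m (Y : finType) (T : {ffun 'I_m -> Y} -> R) :
  (forall f, 0 < T f) ->
  (forall (f : {ffun 'I_m -> Y}) a b, a != b -> T (upd f b (f a)) * T (upd f a (f b)) <= T f ^+ 2) ->
  forall f : {ffun 'I_m -> Y}, \prod_k T [ffun=> f k] <= T f ^+ m.
Proof.
case: m T => [|m] T T0 AF f; first by rewrite big_ord0 expr0.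
pose c v := T [ffun=> v]; have c0 v : 0 < c v by exact: T0.
pose D (f : {ffun 'I_m.+1 -> Y}) := \prod_k c (f k).
have D0 g : 0 < D g by exact: prodr_gt0.
pose B g := T g ^+ m.+1 / D g; have B0 g : 0 < B g by rewrite divr_gt0// exprn_gt0.
have Dupd g a v : D (upd g a v) = D g * (c v / c (g a)).
  rewrite /D (bigD1 a)//= [in RHS](bigD1 a)//= ffunE eqxx.
  rewrite (eq_bigr (fun k => c (g k))); last by move=> k /negPf ka; rewrite ffunE ka.
  by field; rewrite gt_eqF.
have Bstep g a b : a != b -> B (upd g b (g a)) * B (upd g a (g b)) <= B g ^+ 2.
  move=> ab; rewrite /B mulrACA -invfM exprMn exprVn -exprMn -exprM mulnC exprM.
  have -> : D (upd g b (g a)) * D (upd g a (g b)) = D g ^+ 2.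
    by rewrite !Dupd expr2; field; rewrite !gt_eqF.
  rewrite ler_pM2r ?invr_gt0 ?exprn_gt0// lerXn2r ?nnegrE ?mulr_ge0 ?exprn_ge0 ?(ltW (T0 _))//.
  exact: AF.
have [g0 _ Hg0] := @arg_minP _ _ _ f xpredT B isT.
have step g b : (forall g', B g <= B g') -> b != ord0 -> forall g', B (upd g b (g ord0)) <= B g'.
  move=> Hg b0 g'; rewrite (le_trans _ (Hg g'))// leNgt; apply/negP => H.
  have := Bstep g ord0 b; rewrite eq_sym => /(_ b0); rewrite leNgt => /negP; apply.
  rewrite expr2; apply: (@lt_le_trans _ _ (B (upd g b (g ord0)) * B g)); first by rewrite ltr_pM2r.
  by rewrite ler_pM2l.
have copy (s : seq 'I_m.+1) : forall g', B [ffun k => if k \in s then g0 ord0 else g0 k] <= B g'.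
  elim: s => [|b s IH] g'.
    by rewrite (_ : [ffun k => _] = g0) ?Hg0//; apply/ffunP => k; rewrite ffunE.
  have [b0|b0] := eqVneq b ord0.
    rewrite (_ : [ffun k => _] = [ffun k => if k \in s then g0 ord0 else g0 k])//.
    by apply/ffunP => k; rewrite !ffunE in_cons b0; case: eqP => //= ->; case: ifP.
  rewrite (_ : [ffun k => _] = upd [ffun k => if k \in s then g0 ord0 else g0 k] b
     ([ffun k => if k \in s then g0 ord0 else g0 k] ord0)); first exact: step.
  apply/ffunP => k; rewrite !ffunE in_cons; case: eqP => //= _.
  by case: ifP.
have := copy (enum 'I_m.+1) f; rewrite (_ : [ffun k => _] = [ffun=> g0 ord0]); last first.
  by apply/ffunP => k; rewrite !ffunE mem_enum.
rewrite /B (_ : D [ffun=> g0 ord0] = T [ffun=> g0 ord0] ^+ m.+1).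
  by rewrite divff ?expf_neq0 ?gt_eqF// ler_pdivlMr// mul1r.
rewrite /D (eq_bigr (fun=> T [ffun=> g0 ord0])); last by move=> k _; rewrite ffunE.
by rewrite prodr_const card_ord.
Qed.

End AFProduct.

(** * Monotonicity and Alexandrov-Fenchel for labelled families in a chamber *)

Section ChamberInequalities.
Variables (R : realType) (N : nat).

(** Entries are exchanged one at a time, those already exchanged being kept in [pre]; each exchange
    adds a form with the non-negative head [y j - x j]. *)
Lemma mvform_mono d (u : 'I_N -> 'rV[R]_d.+1) U h (J : Type) (x y : J -> 'rV[R]_N) s pre :
  chamber finset.set0 u U -> U h -> (forall j, U (x j)) -> (forall j, U (y j)) ->
  (forall j l, x j ord0 l <= y j ord0 l) -> (forall q, q \in pre -> U q) ->
  (size pre + size s = d.+1)%N ->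
  mvform u h (pre ++ map x s) <= mvform u h (pre ++ map y s).
Proof.
move=> cU Uh Ux Uy xy; elim: s pre => [//|j s IH] pre Upre ss; rewrite !map_cons.
have Umap q : q \in pre ++ map x s -> U q.
  rewrite mem_cat => /orP[/Upre//|]; elim: s {IH ss} => [//|k s IHs].
  by rewrite map_cons in_cons => /orP[/eqP ->|/IHs].
have H : mvform u h (pre ++ x j :: map x s) <= mvform u h (pre ++ y j :: map x s).
  have pe q : mvform u h (pre ++ q :: map x s) = mvform u h (q :: pre ++ map x s).
    apply: mvform_perm; [exact: chamber_gen cU|by rewrite size_cat /= size_map|].
    by rewrite -cat1s perm_catCA.
  rewrite !pe -subr_ge0.
  have -> : mvform u h (y j :: pre ++ map x s) - mvform u h (x j :: pre ++ map x s) =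
     mvform u h (y j - x j :: pre ++ map x s).
    by have := mvform_headD u h (y j - x j) (x j) (pre ++ map x s); rewrite subrK => ->; rewrite addrK.
  apply: (mvform_head_ge0 cU Uh) => //; first by move=> l _; rewrite !mxE subr_ge0.
  by rewrite size_cat size_map; move: ss; rewrite /= addnS => -[].
apply: le_trans H _; rewrite -!cat_rcons; apply: IH.
  by move=> q; rewrite mem_rcons in_cons => /orP[/eqP ->|/Upre].
by rewrite size_rcons addSnnS.
Qed.

Lemma mvform_AF_pos d (u : 'I_N -> 'rV[R]_d) U h (X Y : finType) (p : Y -> 'rV[R]_N)
    (f : {ffun X -> Y}) (a b : X) :
  #|X| = d -> chamber finset.set0 u U -> U h -> (forall j, U (p j)) -> a != b ->
  mvform u h [seq p (upd f b (f a) k) | k <- enum X] * mvform u h [seq p (upd f a (f b) k) | k <- enum X]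
  <= mvform u h [seq p (f k) | k <- enum X] ^+ 2.
Proof.
move=> dX cU Uh Up ab.
have uX := enum_uniq X; pose s := rem b (rem a (enum X)).
have aX : a \in enum X by rewrite mem_enum.
have bX : b \in rem a (enum X) by rewrite mem_rem_uniq// !inE eq_sym ab mem_enum.
have pX : perm_eq (enum X) (a :: b :: s).
  by apply: perm_trans (perm_to_rem aX) _; rewrite perm_cons; exact: perm_to_rem.
have ss : (size s).+2 = d by rewrite -dX cardE (perm_size pX).
case: d => [|[|d]] // in u U dX cU Uh Up ss *.
have sab k : k \in s -> (k != a) && (k != b).
  move=> ks; have := uX; rewrite (perm_uniq pX) /= in_cons negb_or => /and3P[/andP[_ as_] bs _].
  by apply/andP; split; apply/eqP => E; rewrite E in ks; [rewrite ks in as_|rewrite ks in bs].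
have E (g : {ffun X -> Y}) : (forall k, k \in s -> g k = f k) ->
    mvform u h [seq p (g k) | k <- enum X] = mvform u h (p (g a) :: p (g b) :: [seq p (f k) | k <- s]).
  move=> gf; rewrite (@mvform_perm R N d.+2 u h _ [seq p (g k) | k <- a :: b :: s]).
  - by rewrite !map_cons; congr (mvform u h (_ :: _ :: _)); apply/eq_in_map => k /gf ->.
  - exact: chamber_gen cU.
  - by rewrite size_map -cardE.
  - exact: perm_map.
have fa k : k \in s -> upd f a (f b) k = f k by move=> /sab/andP[/negPf ka _]; rewrite ffunE ka.
have fb k : k \in s -> upd f b (f a) k = f k by move=> /sab/andP[_ /negPf kb]; rewrite ffunE kb.
rewrite (E _ fa) (E _ fb) (E f (fun _ _ => erefl)) !ffunE !eqxx [b == a]eq_sym (negPf ab).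
apply: (mvform_AF cU Uh) => //.
- by move=> q /mapP[k _ ->].
- by rewrite size_map; case: ss.
- by move=> j; rewrite inE.
Qed.

End ChamberInequalities.

(** * Mixed volumes of bodies as limits of mixed forms *)

Section MixedVolumeApproximation.
Variable R : realType.

Definition dilate n (l : R) (A : set 'rV[R]_n) : set 'rV[R]_n := (fun x => l *: x) @` A.

Lemma dilate1 n (A : set 'rV[R]_n) : dilate 1 A = A.
Proof.
apply/seteqP; split=> [_ [x Ax <-]|x Ax]; first by rewrite scale1r.
by exists x; rewrite ?scale1r.
Qed.

Definition body n (A : set 'rV[R]_n) : Prop := [/\ compact A, Defs.convex_set A & A !=set0].

Lemma mixed_volumeE n (K : 'I_n -> set 'rV[R]_n) : (forall i, K i !=set0) ->
  mixed_volume K = (n`!%:R)^-1 * \sum_(S : {set 'I_n} | S != finset.set0)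
      (-1) ^+ (n - #|S|) * fine (vol (Defs.msum S K)).
Proof.
move=> K0; rewrite /mixed_volume; case: asboolP => // -[i Ki]; have [x] := K0 i.
by rewrite Ki.
Qed.

Lemma mixed_volume_approx n (I T : finType) (C : I -> set 'rV[R]_n.+1)
    (phi : T -> 'I_n.+1 -> I) (l : T -> 'I_n.+1 -> R) (i0 : I) (eps : R) :
  (forall i, body (C i)) -> (forall t i, 0 < l t i) -> 0 < eps ->
  exists N (u : 'I_N -> 'rV[R]_n.+1) (U : set 'rV[R]_N) (h : 'rV[R]_N) (p : I -> 'rV[R]_N),
  [/\ chamber finset.set0 u U, U h /\ hpoly u h !=set0, forall i, U (p i),
    forall i j, C i `<=` C j -> forall k, p i ord0 k <= p j ord0 k &
    forall t, `|mixed_volume (fun i => dilate (l t i) (C (phi t i))) -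
       (\prod_i l t i) * (mvform u h [seq p (phi t i) | i <- enum 'I_n.+1] / n.+1`!%:R)| <= eps].
Proof.
move=> bC l0 eps0.
(* Each slot of each configuration gets its own copy [inr (t, i)] of a body, so that a subset of
   slots is a weight vector even when [phi t] repeats a body. *)
pose I' := (I + T * 'I_n.+1)%type.
pose C' (k : I') := match k with inl i => C i | inr q => C (phi q.1 q.2) end.
have bC' k : body (C' k) by case: k => [i|q]; exact: bC.
pose Om := (T * {set 'I_n.+1})%type.
pose w (om : Om) (k : I') : R := match k with inl _ => 0 | inr q =>
  if (q.1 == om.1) && (q.2 \in om.2) then l om.1 q.2 else 0 end.
have sumw (V : lmodType R) om (y : I' -> V) :
    \sum_k w om k *: y k = \sum_(i in om.2) l om.1 i *: y (inr (om.1, i)).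
  rewrite big_sumType /= big1 ?add0r; last by move=> i _; rewrite scale0r.
  transitivity (\sum_t \sum_i (if (t == om.1) && (i \in om.2) then l om.1 i else 0) *: y (inr (t, i))).
    by rewrite pair_bigA; apply: eq_bigr => -[].
  rewrite (bigD1 om.1)//= [X in _ + X]big1 ?addr0; last first.
    by move=> t /negPf tt; rewrite big1// => i _; rewrite tt scale0r.
  rewrite [RHS]big_mkcond; apply: eq_bigr => i _; rewrite eqxx /=; case: ifP => //.
  by rewrite scale0r.
have wsumE t S : wsum (w (t, S)) C' = Defs.msum S (fun i => dilate (l t i) (C (phi t i))).
  apply/seteqP; split=> [x [y [Cy ->]]|x [y [Cy ->]]].
    exists (fun i => l t i *: y (inr (t, i))); split; last by rewrite sumw.
    by move=> i _; exists (y (inr (t, i))) => //; exact: (Cy (inr (t, i))).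
  have /choice[z Hz] : forall i, exists z, C (phi t i) z /\ (i \in S -> y i = l t i *: z).
    move=> i; have [iS|iS] := boolP (i \in S); first by have [z Cz <-] := Cy i iS; exists z.
    by have [_ _ [z Cz]] := bC (phi t i); exists z.
  have /choice[c Hc] : forall k, exists a, C' k a by move=> k; have [_ _ [a Ca]] := bC' k; exists a.
  exists (fun k => match k with inl _ => c k | inr q => if q.1 == t then z q.2 else c k end); split.
    move=> [i|[t' i]] /=; first exact: (Hc (inl i)).
    by case: eqP => [->|_]; [exact: (Hz i).1|exact: (Hc (inr (t', i)))].
  by rewrite sumw /=; apply: eq_bigr => i iS; rewrite eqxx (Hz i).2.
pose cS : R := #|{set 'I_n.+1}|%:R.
have cS0 : 0 < cS by rewrite ltr0n; apply/card_gt0P; exists finset.set0.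
have [|||||N [u [U [p' [cU Up' Np mono Hv]]]]] := @approx_chamber R n.+1 I' C' Om w (eps / cS).
- by move=> k; case: (bC' k).
- by move=> k; case: (bC' k).
- by move=> k; case: (bC' k).
- by move=> om [i|q] /=; [|case: ifP => // _; exact: ltW].
- by rewrite divr_gt0.
pose p i := p' (inl i).
(* Copies are included in each other both ways, so they share one support vector. *)
have pE t i : p' (inr (t, i)) = p (phi t i).
  by apply/rowP => k; apply/eqP; rewrite eq_le; apply/andP; split; apply: mono.
exists N, u, U, (p i0), p; split=> //; first by split; [exact: Up'|exact: Np].
- by move=> i; exact: Up'.
- by move=> i j Cij; exact: mono.
move=> t; set K := fun i => _; set x := fun i => p (phi t i).
have K0 i : K i !=set0 by have [_ _ [z Cz]] := bC (phi t i); exists (l t i *: z), z.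
pose M (S : {set 'I_n.+1}) := mvform u (p i0) (nseq n.+1 (\sum_(i in S) l t i *: x i)).
have HM (S : {set 'I_n.+1}) : S != finset.set0 -> `|fine (vol (Defs.msum S K)) - M S / n.+1`!%:R| <= eps / cS.
  move=> S0; have [lo hi] := Hv (t, S).
  have vE : vol (hpoly u (\sum_k w (t, S) k *: p' k)) = (M S / n.+1`!%:R)%:E.
    rewrite sumw /=; under eq_bigr do rewrite pE.
    by apply: (chamber_vol_comb cU) => //; [exact: Up'|move=> i; exact: Up'].
  move: lo hi; rewrite vE wsumE -/K.
  have fK : vol (Defs.msum S K) \is a fin_num.
    rewrite -wsumE; apply: vol_fin_num; apply: wsum_compact => k; by case: (bC' k).
  rewrite -(fineK fK) -EFinD !lee_fin fineK// => lo hi.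
  rewrite ler_norml; apply/andP; split; lra.
rewrite mixed_volumeE//.
have -> : (\prod_i l t i) * (mvform u (p i0) [seq p (phi t i) | i <- enum 'I_n.+1] / n.+1`!%:R) =
    n.+1`!%:R^-1 * \sum_(S : {set 'I_n.+1} | S != finset.set0) (-1) ^+ (n.+1 - #|S|) * (M S / n.+1`!%:R).
  have := mvform_polarization (p i0) (fun i => l t i *: x i) (chamber_gen cU).
  have := @mvform_scales R N n.+1 u (p i0) 'I_n.+1 (enum 'I_n.+1) (l t) x [::].
  rewrite !cat0s big_enum /= => -> //; last by rewrite size_enum_ord.
  move=> E; have <- : (\sum_(S : {set 'I_n.+1} | S != finset.set0) (-1) ^+ (n.+1 - #|S|) * M S) / n.+1`!%:R =
      \sum_(S : {set 'I_n.+1} | S != finset.set0) (-1) ^+ (n.+1 - #|S|) * (M S / n.+1`!%:R).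
    by rewrite mulr_suml; apply: eq_bigr => S _; rewrite mulrA.
  rewrite [X in _ = _ * (X / _)]E; field.
  by rewrite pnatr_eq0 -lt0n fact_gt0.
rewrite -mulrBr -sumrB normrM ger0_norm ?invr_ge0//.
apply: (@le_trans _ _ (1 * \sum_(S : {set 'I_n.+1}) (eps / cS))); last first.
  rewrite mul1r sumr_const -[#|_|]/#|{set 'I_n.+1}| -[X in X <= _]mulr_natr divfK ?gt_eqF//.
apply: ler_pM => //.
  by rewrite invf_le1 ?ltr0n ?fact_gt0// ler1n fact_gt0.
apply: le_trans (ler_norm_sum _ _ _) _; rewrite [leRHS](bigID (fun S => S != finset.set0)) /=.
rewrite -[leLHS]addr0; apply: lerD; last by apply: sumr_ge0 => S _; rewrite divr_ge0// ltW.
apply: ler_sum => S S0; rewrite -mulrBr normrM normrX normrN1 expr1n mul1r; exact: HM.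
Qed.

End MixedVolumeApproximation.

(** * Inequalities for mixed volumes of convex bodies *)

Section MixedVolumeInequalities.
Variable R : realType.

Lemma approx_ge0 (v : R) : (forall e, 0 < e -> exists2 m, 0 <= m & `|v - m| <= e) -> 0 <= v.
Proof.
move=> H; rewrite leNgt; apply/negP => v0.
have [|m m0] := H (- v / 2); first by rewrite divr_gt0// oppr_gt0.
by rewrite ler_norml => /andP[? ?]; lra.
Qed.

Lemma mv_ge0 n (K : 'I_n.+1 -> set 'rV[R]_n.+1) : (forall i, body (K i)) -> 0 <= mixed_volume K.
Proof.
move=> bK; apply: approx_ge0 => e e0.
have [|N [u [U [h [p [cU [Uh _] Up _ /(_ tt) H]]]]]] := @mixed_volume_approx R n 'I_n.+1 unit K
  (fun _ i => i) (fun _ _ => 1) ord0 e bK _ e0; first by [].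
exists (mvform u h [seq p i | i <- enum 'I_n.+1] / n.+1`!%:R).
  rewrite divr_ge0//; apply: (mvform_ge0 cU Uh); first by move=> q /mapP[i _ ->].
  by rewrite size_map size_enum_ord.
move: H; rewrite big1// mul1r (_ : (fun i => dilate 1 (K i)) = K)//.
by apply/funext => i; rewrite dilate1.
Qed.

Lemma mv_mono n (K K' : 'I_n.+1 -> set 'rV[R]_n.+1) : (forall i, body (K i)) -> (forall i, body (K' i)) ->
  (forall i, K i `<=` K' i) -> mixed_volume K <= mixed_volume K'.
Proof.
move=> bK bK' KK; rewrite -subr_ge0; apply: approx_ge0 => e e0.
pose C (q : bool * 'I_n.+1) := if q.1 then K' q.2 else K q.2.
have bC q : body (C q) by rewrite /C; case: ifP.
have e20 : 0 < e / 2 by rewrite divr_gt0.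
have [//|N [u [U [h [p [cU [Uh _] Up mono H]]]]]] := @mixed_volume_approx R n (bool * 'I_n.+1)%type bool C
  (fun b i => (b, i)) (fun _ _ => 1) (true, ord0) (e / 2) bC _ e20.
pose M b := mvform u h [seq p (b, i) | i <- enum 'I_n.+1] / n.+1`!%:R.
have H1 b : `|mixed_volume (if b then K' else K) - M b| <= e / 2.
  have := H b; rewrite big1// mul1r (_ : (fun i => dilate 1 (C (b, i))) = if b then K' else K)//.
  by apply/funext => i; rewrite dilate1 /C; case: b.
exists (M true - M false).
  rewrite subr_ge0 /M ler_pM2r ?invr_gt0 ?ltr0n ?fact_gt0//.
  have := @mvform_mono R N n u U h 'I_n.+1 (fun i => p (false, i)) (fun i => p (true, i)) (enum 'I_n.+1) [::] cU Uh.
  apply=> //; last by rewrite size_enum_ord.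
  by move=> j l; apply: mono; exact: KK.
have := H1 true; have := H1 false; rewrite !ler_norml => /andP[? ?] /andP[? ?].
by apply/andP; split; lra.
Qed.

Lemma mv_scale n (K : 'I_n.+1 -> set 'rV[R]_n.+1) (l : 'I_n.+1 -> R) : (forall i, body (K i)) ->
  (forall i, 0 < l i) -> mixed_volume (fun i => dilate (l i) (K i)) = (\prod_i l i) * mixed_volume K.
Proof.
move=> bK l0; set v' := mixed_volume (fun i => dilate (l i) (K i)); set v := mixed_volume K.
set L := \prod_i l i; have L0 : 0 < L by apply: prodr_gt0.
apply/eqP; rewrite -subr_eq0 -normr_le0; apply/ler_addgt0Pl => e e0; rewrite addr0.
have e20 : 0 < e / (L + 1) by rewrite divr_gt0// addr_gt0.
have [|N [u [U [h [p [cU [Uh _] Up _ H]]]]]] := @mixed_volume_approx R n 'I_n.+1 bool K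
  (fun _ i => i) (fun b i => if b then l i else 1) ord0 (e / (L + 1)) bK _ e20; first by case.
have := H false; rewrite big1// mul1r (_ : (fun i => dilate 1 (K i)) = K); last first.
  by apply/funext => i; rewrite dilate1.
have := H true; rewrite -/v' -/v -/L; set M := _ / _ => H1 H2.
have -> : v' - L * v = (v' - L * M) - L * (v - M) by ring.
apply: le_trans (ler_normB _ _) _; rewrite normrM (gtr0_norm L0).
have E : e = e / (L + 1) + L * (e / (L + 1)) by field; rewrite gt_eqF// addr_gt0.
by rewrite [leRHS]E; apply: lerD => //; rewrite ler_wpM2l// ltW.
Qed.

Lemma poly_le_lim (P Q : {poly R}) e : 0 < e ->
  (forall d, 0 < d < e -> P.[d] <= Q.[d]) -> P.[0] <= Q.[0].
Proof.
move=> e0 H; rewrite -subr_ge0 -hornerN -hornerD; set D := Q - P.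
have {}H d : 0 < d < e -> 0 <= D.[d] by move=> /H; rewrite hornerD hornerN subr_ge0.
have [E HE] : exists E, D - D.[0]%:P = E * ('X - 0%:P).
  by apply/factor_theorem; rewrite /root hornerD hornerN hornerC subrr.
have {}HE d : D.[d] = D.[0] + E.[d] * d.
  have := congr1 (fun p : {poly R} => p.[d]) HE.
  by rewrite hornerM hornerXsubC subr0 hornerD hornerN hornerC => <-; rewrite addrC subrK.
pose C := 1 + \sum_(i < size E) `|E`_i|.
have C0 : 0 < C by rewrite ltr_pwDl// sumr_ge0.
rewrite leNgt; apply/negP => D0.
pose d := Num.min (Num.min 1 (e / 2)) (- D.[0] / (2 * C)).
have [d0 d1 de dD] : [/\ 0 < d, d <= 1, d < e & d * (2 * C) <= - D.[0]].
  split.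
  - by rewrite !lt_min ltr01 !divr_gt0// ?oppr_gt0// mulr_gt0.
  - by rewrite !ge_min lexx.
  - have : d <= e / 2 by rewrite !ge_min lexx orbT.
    lra.
  - by rewrite -ler_pdivlMr ?mulr_gt0// !ge_min lexx orbT.
have EC : `|E.[d]| <= C.
  rewrite horner_coef (le_trans (ler_norm_sum _ _ _))// /C -[leLHS]add0r lerD//.
  apply: ler_sum => i _; rewrite normrM ler_piMr// normrX exprn_ile1//.
  by rewrite gtr0_norm.
have : 0 <= D.[d] by apply: H; rewrite d0.
rewrite HE; have : E.[d] * d <= C * d by rewrite ler_pM2r// (le_trans (ler_norm _)).
lra.
Qed.

(** On polytopes all values are positive and [AF_product] applies. In the limit either some factor
    on the left is zero, or for small [d] the product of the [b k - d] is at most [(a + d) ^+ m],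
    and [d] tends to 0. *)
Lemma mv_AF n m (A K : nat -> set 'rV[R]_n.+1) : (m <= n.+1)%N ->
  (forall i : 'I_n.+1, body (join_sets m A K i)) ->
  \prod_(k < m) mixed_volume (join_sets m (fun=> A k) K) <= mixed_volume (join_sets m A K) ^+ m.
Proof.
move=> mn bC.
have bA k : (k < m)%N -> body (A k).
  by move=> km; have := bC (Ordinal (leq_trans km mn)); rewrite /join_sets /= km.
have bCk (k : 'I_m) i : body (join_sets m (fun=> A k) K i).
  by have := bC i; rewrite /join_sets; case: ifP => // _ _; exact: bA.
(* [f] says which body occupies each of the first [m] slots; the remaining slots keep their own. *)
pose ext (f : {ffun 'I_m -> 'I_n.+1}) (i : 'I_n.+1) : 'I_n.+1 :=
  if insub (val i) : option 'I_m is Some k then f k else i.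
pose C (i : 'I_n.+1) := join_sets m A K i.
have approx e : 0 < e -> exists T : {ffun 'I_m -> 'I_n.+1} -> R,
   [/\ forall f, 0 <= T f, forall f : {ffun 'I_m -> 'I_n.+1}, \prod_k T [ffun=> f k] <= T f ^+ m &
     forall f, `|mixed_volume (fun i => C (ext f i)) - T f| <= e].
  move=> e0.
  have [//|N [u [U [h [p [cU [Uh Ph] Up _ H]]]]]] := @mixed_volume_approx R n 'I_n.+1 {ffun 'I_m -> 'I_n.+1} C
    ext (fun _ _ => 1) ord0 e bC _ e0.
  pose T f := mvform u h [seq p (ext f i) | i <- enum 'I_n.+1] / n.+1`!%:R.
  have f0 : 0 < n.+1`!%:R :> R by rewrite ltr0n fact_gt0.
  have T0 f : 0 < T f.
    rewrite divr_gt0//; apply: (mvform_gt0 cU Uh Ph); first by move=> q /mapP[i _ ->].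
    by rewrite size_map size_enum_ord.
  exists T; split=> [f||f]; first exact: ltW.
    apply: AF_product => // f a b ab.
    have wi (k : 'I_m) : (widen_ord mn k : 'I_n.+1) = k :> nat by [].
    have extE (g : {ffun 'I_m -> 'I_n.+1}) k : ext g (widen_ord mn k) = g k.
      by rewrite /ext /= valK.
    have extU g c v : (fun i => p (ext (upd g c v) i)) =1 (fun i => p (upd [ffun i => ext g i] (widen_ord mn c) v i)).
      move=> i; congr p; rewrite !ffunE /ext; case: insubP => [k _ ki|im]; rewrite ?ffunE.
        rewrite (_ : (i == widen_ord mn c) = (k == c)); last by rewrite -!val_eqE /= ki.
        by [].
      by rewrite ifN//; apply: contra im => /eqP ->; rewrite /= ltn_ord.
    rewrite /T !(eq_map (extU _ _ _)) mulrACA -invfM exprMn exprVn -expr2.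
    rewrite ler_pM2r ?invr_gt0 ?exprn_gt0//.
    have ab' : widen_ord mn a != widen_ord mn b by rewrite -val_eqE.
    have := @mvform_AF_pos R N n.+1 u U h 'I_n.+1 'I_n.+1 p [ffun i => ext f i] _ _ (card_ord _) cU Uh Up ab'.
    rewrite [in X in X -> _]ffunE extE [in X in X -> _]ffunE extE => HH; apply: le_trans HH _.
    rewrite le_eqVlt; apply/orP; left; apply/eqP; congr (mvform u h _ ^+ 2).
    by apply: eq_map => i; rewrite ffunE.
  have := H f; rewrite big1// mul1r (_ : (fun i => dilate 1 (C (ext f i))) = fun i => C (ext f i))//.
  by apply/funext => i; rewrite dilate1.
pose f0 : {ffun 'I_m -> 'I_n.+1} := [ffun k => widen_ord mn k].
have E0 : (fun i => C (ext f0 i)) = join_sets m A K.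
  apply/funext => i; rewrite /C /ext; case: insubP => [k _ ki|//]; rewrite ffunE /=.
  by congr (join_sets m A K _); apply: val_inj.
have Ek (k : 'I_m) : (fun i => C (ext [ffun=> f0 k] i)) = join_sets m (fun=> A k) K.
  apply/funext => i; rewrite /C /ext; case: insubP => [k' k'm ki|im]; rewrite /join_sets ?(negPf im)//.
  by rewrite !ffunE /= ltn_ord -ki ltn_ord.
set a := mixed_volume (join_sets m A K); pose b (k : 'I_m) := mixed_volume (join_sets m (fun=> A k) K).
have a0 : 0 <= a by exact: mv_ge0.
have [[k bk]|nb] := pselect (exists k, b k <= 0).
  rewrite (bigD1 k)//= (_ : mixed_volume (join_sets m (fun=> A k) K) = 0) ?mul0r ?exprn_ge0//.
  by apply/eqP; rewrite eq_le [_ <= 0]bk mv_ge0.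
have b0 k : 0 < b k by rewrite ltNge; apply/negP => H; apply: nb; exists k.
have [k|e e0 He] := @exists_small R 'I_m (fun k d => d <= b k).
  by exists (b k) => // t /andP[_ /ltW].
have Pd d : (\prod_k ((b k)%:P - 'X)).[d] = \prod_k (b k - d).
  by rewrite horner_prod; apply: eq_bigr => k _; rewrite hornerD hornerN hornerC hornerX.
have Qd d : ((a%:P + 'X) ^+ m).[d] = (a + d) ^+ m by rewrite horner_exp hornerD hornerC hornerX.
have := @poly_le_lim (\prod_k ((b k)%:P - 'X)) ((a%:P + 'X) ^+ m) e e0.
rewrite Pd Qd addr0 (eq_bigr b) => [|k _]; last by rewrite subr0.
apply => d de; have /andP[d0 _] := de; have [T [T0 TP TH]] := approx d d0; rewrite Pd Qd.
apply: (@le_trans _ _ (\prod_k T [ffun=> f0 k])).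
  apply: ler_prod => k _; rewrite subr_ge0 He//=.
  by have := TH [ffun=> f0 k]; rewrite Ek -/(b k) ler_norml => /andP[? ?]; lra.
apply: le_trans (TP f0) _; have := TH f0; rewrite E0 -/a ler_norml => /andP[H1 H2].
by apply: lerXn2r; rewrite ?nnegrE ?addr_ge0 ?(ltW d0)//; lra.
Qed.

Lemma msum_wsum n (K : 'I_n -> set 'rV[R]_n) S : (forall i, K i !=set0) ->
  Defs.msum S K = wsum (fun i => (i \in S)%:R) K.
Proof.
move=> K0; have sE (y : 'I_n -> 'rV[R]_n) : \sum_(i in S) y i = \sum_i (i \in S)%:R *: y i.
  by rewrite big_mkcond; apply: eq_bigr => i _; case: (i \in S); rewrite ?scale1r ?scale0r.
have /choice[c Hc] : forall i, exists c, K i c by move=> i; have [c] := K0 i; exists c.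
apply/seteqP; split=> x [y [Ky ->]]; last by exists y; rewrite sE.
exists (fun i => if i \in S then y i else c i); split.
  by move=> i; case: ifP => [/Ky|].
by rewrite -sE; apply: eq_bigr => i ->.
Qed.

(** Only finitely many volumes of partial sums enter the polarization formula, and each is
    continuous from above. *)
Lemma mv_continuous n (K : 'I_n.+1 -> set 'rV[R]_n.+1) (e : R) : (forall i, body (K i)) -> 0 < e ->
  exists2 r : R, 0 < r & forall K', (forall i, body (K' i)) ->
    (forall i, K i `<=` K' i) -> (forall i, K' i `<=` thick (K i) r) ->
    mixed_volume K' <= mixed_volume K + e.
Proof.
move=> bK e0; have K0 i : K i !=set0 by case: (bK i).
have cM (L : 'I_n.+1 -> set 'rV[R]_n.+1) S : (forall i, body (L i)) -> compact (Defs.msum S L).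
  move=> bL; rewrite msum_wsum; first by apply: wsum_compact => i; case: (bL i).
  by move=> i; case: (bL i).
pose cS : R := #|{set 'I_n.+1}|%:R.
have cS0 : 0 < cS by rewrite ltr0n; apply/card_gt0P; exists finset.set0.
have eS : 0 < e / cS by rewrite divr_gt0.
have [S|r r0 Hr] := @exists_small R {set 'I_n.+1} (fun S r =>
    (vol (thick (Defs.msum S K) (n.+1%:R * r)) < (fine (vol (Defs.msum S K)) + e / cS)%:E)%E).
  have [|r r0 Hr] := @vol_thick R n.+1 _ (fine (vol (Defs.msum S K)) + e / cS) (cM K S bK).
    by rewrite EFinD fineK ?lteDl ?lte_fin//; apply: vol_fin_num; exact: cM.
  exists (r / n.+1%:R) => [|t /andP[_]]; first by rewrite divr_gt0.
  rewrite ltr_pdivlMr// mulrC => /ltW tr; apply: le_lt_trans Hr; apply: vol_le.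
  exact: thick_le.
pose r1 := r / 2; have r10 : 0 < r1 by rewrite divr_gt0.
exists r1 => // K' bK' KK' K'K; have K'0 i : K' i !=set0 by case: (bK' i).
have HS S : 0 <= fine (vol (Defs.msum S K')) - fine (vol (Defs.msum S K)) <= e / cS.
  have f1 : vol (Defs.msum S K') \is a fin_num by apply: vol_fin_num; exact: cM.
  have f2 : vol (Defs.msum S K) \is a fin_num by apply: vol_fin_num; exact: cM.
  rewrite subr_ge0 lerBlDl -!lee_fin !fineK// vol_le/=; last first.
    by move=> x [y [Ky ->]]; exists y; split=> // i /Ky; exact: KK'.
  have /Hr/(_ S) H : 0 < r1 < r by rewrite r10 /r1; lra.
  apply: le_trans (ltW H); apply: vol_le; rewrite !msum_wsum// => x [y [Ky ->]].
  have Hx : wsum (fun i => (i \in S)%:R : R) (fun i => thick (K i) r1) (\sum_i (i \in S)%:R *: y i).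
    by exists y; split=> // i; exact: K'K.
  have w0 i : 0 <= (i \in S)%:R :> R by exact: ler0n.
  apply: thick_le (wsum_thick w0 Hx); rewrite ler_pM2r//.
  apply: (@le_trans _ _ (\sum_(i < n.+1) 1)); last by rewrite sumr_const card_ord.
  by apply: ler_sum => i _; case: (i \in S).
rewrite !mixed_volumeE// -lerBlDl -mulrBr -sumrB.
apply: (@le_trans _ _ (1 * \sum_(S : {set 'I_n.+1}) (e / cS))); last first.
  by rewrite mul1r sumr_const -[#|_|]/#|{set 'I_n.+1}| -[X in X <= _]mulr_natr divfK ?gt_eqF.
apply: (@le_trans _ _ (n.+1`!%:R^-1 * \sum_(S : {set 'I_n.+1}) (e / cS))).
  rewrite ler_wpM2l ?invr_ge0// [leRHS](bigID (fun S => S != finset.set0)) /=.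
  rewrite -[leLHS]addr0; apply: lerD; last by apply: sumr_ge0 => S _; exact: ltW.
  apply: ler_sum => S _; rewrite -mulrBr; have /andP[H1 H2] := HS S.
  apply: le_trans (ler_norm _) _; rewrite normrM normrX normrN1 expr1n mul1r.
  by rewrite ger0_norm.
rewrite ler_wpM2r//; first by apply: sumr_ge0 => S _; exact: ltW.
by rewrite invf_le1 ?ltr0n ?fact_gt0// ler1n fact_gt0.
Qed.

End MixedVolumeInequalities.

(** * Euclidean balls *)

Section Balls.
Variable R : realType.

Lemma euclid_ballE n (r : R) : @euclid_ball R n r = [set x | dotp x x <= r ^+ 2].
Proof. by []. Qed.

Lemma euclid_ball_body n (r : R) : 0 <= r -> body (@euclid_ball R n r).
Proof.
move=> r0; have eE (x : 'rV[R]_n) : \sum_(i < n) x ord0 i ^+ 2 = dotp x x by [].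
split.
- apply: bounded_closed_compact.
    exists r; split; [exact: num_real|move=> y ry x /= xr; apply: le_trans (ltW ry)].
    apply/rV_norm_leP => // i; rewrite -(@ler_pXn2r _ 2)// ?nnegrE// real_normK ?num_real//.
    by apply: le_trans xr; rewrite (bigD1 i)//= lerDl sumr_ge0// => j _; exact: sqr_ge0.
  apply: (@closed_comp _ _ (fun x : 'rV[R]_n => \sum_(i < n) x ord0 i ^+ 2) [set y | y <= r ^+ 2]).
    move=> x _; apply: continuous_sum => i y; apply: (@continuousM _ _ (fun y : 'rV[R]_n => y ord0 i) (fun y : 'rV[R]_n => y ord0 i));
      exact: rV_coord_continuous.
  exact: closed_le.
- move=> x y Hx Hy l /andP[l0 l1]; rewrite euclid_ballE /= in Hx Hy *.
  have H : 0 <= dotp (x - y) (x - y) by exact: dotp_ge0.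
  rewrite dotpBl !dotpBr (dotpC y x) in H.
  rewrite dotpDl !dotpDr !dotpZl !dotpZr (dotpC y x).
  set a := dotp x x in Hx H *; set b := dotp x y in H *; set c := dotp y y in Hy H *.
  have l2 : 0 <= l * (1 - l) by rewrite mulr_ge0// subr_ge0.
  have l3 : l * (1 - l) * (2 * b) <= l * (1 - l) * (a + c) by rewrite ler_wpM2l//; lra.
  have l4 : l * a <= l * r ^+ 2 by rewrite ler_wpM2l.
  have l5 : (1 - l) * c <= (1 - l) * r ^+ 2 by rewrite ler_wpM2l// subr_ge0.
  have -> : l * (l * a) + l * ((1 - l) * b) + ((1 - l) * (l * b) + (1 - l) * ((1 - l) * c)) =
    l * a + (1 - l) * c + (l * (1 - l) * (2 * b) - l * (1 - l) * (a + c)) by ring.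
  lra.
- exists 0; rewrite /euclid_ball /= big1 ?sqr_ge0// => i _.
  by rewrite mxE expr0n.
Qed.

Lemma euclid_ball_dilate n (l : R) : 0 < l -> dilate l (@unit_ball R n) = euclid_ball l.
Proof.
move=> l0; apply/seteqP; split=> [_ [x Hx <-]|x Hx].
  rewrite /unit_ball !euclid_ballE /= in Hx *; rewrite dotpZl dotpZr mulrA -expr2.
  by rewrite ler_piMr ?sqr_ge0// (le_trans Hx)// expr1n.
exists (l^-1 *: x); last by rewrite scalerA divff ?scale1r// gt_eqF.
rewrite /unit_ball !euclid_ballE /= in Hx *; rewrite dotpZl dotpZr mulrA -expr2 exprVn.
by rewrite ler_pdivrMl ?exprn_gt0// expr1n mulr1.
Qed.

Lemma euclid_ball_le n (r r' : R) : 0 <= r -> r <= r' -> @euclid_ball R n r `<=` euclid_ball r'.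
Proof.
move=> r0 rr x; rewrite !euclid_ballE /= => H; apply: le_trans H _.
by rewrite lerXn2r// nnegrE (le_trans r0).
Qed.

Lemma powR_root (q : R) m : (0 < m)%N -> 0 <= q -> (q `^ (m%:R^-1)) ^+ m = q.
Proof.
move=> m0 q0; rewrite -powR_mulrn ?powR_ge0// -powRrM mulVf ?powRr1//.
by rewrite pnatr_eq0 -lt0n.
Qed.

Lemma euclid_ball_root n m (q : R) (x : 'rV[R]_n) : (0 < m)%N -> 0 <= q ->
  euclid_ball (q `^ (m%:R^-1)) x <-> Num.sqrt (dotp x x) ^+ m <= q.
Proof.
move=> m0 q0; rewrite -[X in _ <= X](powR_root m0 q0) euclid_ballE /=.
rewrite -[X in X <= _](sqr_sqrtr (dotp_ge0 x)).
by rewrite !ler_pXn2r// nnegrE ?sqrtr_ge0 ?powR_ge0.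
Qed.

End Balls.

(** * Symmetrization of bodies and of level sets *)

Section Symmetrization.
Variables (R : realType) (n m : nat) (K : nat -> set 'rV[R]_n.+1).
Hypotheses (m0 : (0 < m)%N) (mn : (m <= n.+1)%N).
Hypothesis bK : forall j, (j < n.+1 - m)%N -> body (K j).

Lemma join_body (A : nat -> set 'rV[R]_n.+1) : (forall i, (i < m)%N -> body (A i)) ->
  forall i : 'I_n.+1, body (join_sets m A K i).
Proof.
move=> bA i; rewrite /join_sets; case: ltnP => [/bA//|mi]; apply: bK.
by rewrite ltn_sub2r// (leq_ltn_trans mi).
Qed.

Local Notation Phi := (size_functional m K).
Local Notation D := (@unit_ball R n.+1).

Lemma unit_ball_body : body D. Proof. exact: euclid_ball_body. Qed.

Lemma Phi_ge0 A : body A -> 0 <= Phi A.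
Proof. by move=> bA; apply: mv_ge0; apply: join_body. Qed.

Lemma Phi_mono A B : body A -> body B -> A `<=` B -> Phi A <= Phi B.
Proof.
move=> bA bB AB; apply: mv_mono; try exact: join_body.
by move=> i x; rewrite /join_sets; case: ifP => // _; exact: AB.
Qed.

Definition radius A := (Phi A / Phi D) `^ (m%:R^-1).

Lemma ratio_ge0 A : body A -> 0 <= Phi A / Phi D.
Proof. by move=> bA; rewrite divr_ge0// Phi_ge0//; exact: unit_ball_body. Qed.

Lemma sym_setE A : body A -> sym_set m K A = euclid_ball (radius A).
Proof.
move=> [_ _ [x Ax]]; rewrite /sym_set; case: asboolP => // A0.
by rewrite A0 in Ax.
Qed.

Lemma mixed_volume_sym_le (A : nat -> set 'rV[R]_n.+1) : (forall i, (i < m)%N -> body (A i)) ->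
  mixed_volume (join_sets m (fun i => sym_set m K (A i)) K) <= mixed_volume (join_sets m A K).
Proof.
move=> bA; set v := mixed_volume _; pose r i := radius (A i).
have r0 i : 0 <= r i by exact: powR_ge0.
have PD0 : 0 <= Phi D by apply: Phi_ge0; exact: unit_ball_body.
have bD := unit_ball_body.
(* Homogeneity is available for positive factors, while a radius may be 0; the radii are enlarged by
   [d], which then tends to 0. *)
have vd d : 0 < d -> v <= \prod_(k < m) (r k + d) * Phi D.
  move=> d0; pose l (i : 'I_n.+1) := if (i < m)%N then r i + d else 1.
  have l0 i : 0 < l i by rewrite /l; case: ifP => // _; rewrite ltr_wpDl.
  have -> : \prod_(k < m) (r k + d) = \prod_i l i.
    by rewrite (big_ord_widen n.+1 (fun k => r k + d) mn) big_mkcond.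
  have bDK := join_body (fun i _ => bD).
  rewrite -(mv_scale bDK l0); apply: mv_mono.
  - by apply: join_body => i im; rewrite sym_setE; [apply: euclid_ball_body; exact: powR_ge0|exact: bA].
  - move=> i; rewrite /join_sets /l; have := join_body bA i; rewrite /join_sets.
    case: ifP => [_ _|_ ?]; last by rewrite dilate1.
    rewrite euclid_ball_dilate ?ltr_wpDl//; apply: euclid_ball_body.
    by rewrite addr_ge0// ltW.
  - move=> i; rewrite /join_sets /l; case: ifP => [im|_]; last by rewrite dilate1.
    rewrite sym_setE ?euclid_ball_dilate ?ltr_wpDl//; last exact: bA.
    by apply: euclid_ball_le; [exact: r0|rewrite -/(r i) lerDl ltW].
have vr : v <= \prod_(k < m) r k * Phi D.
  have Q d : ((\prod_(k < m) ((r k)%:P + 'X)) * (Phi D)%:P).[d] = \prod_(k < m) (r k + d) * Phi D.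
    rewrite hornerM hornerC horner_prod; congr (_ * _); apply: eq_bigr => k _.
    by rewrite hornerD hornerC hornerX.
  have := @poly_le_lim R v%:P ((\prod_(k < m) ((r k)%:P + 'X)) * (Phi D)%:P) 1 ltr01.
  rewrite hornerC Q (eq_bigr (fun k : 'I_m => r k)) => [|k _]; last by rewrite addr0.
  by apply => d /andP[d0 _]; rewrite hornerC Q; exact: vd.
apply: le_trans vr _.
have VA0 : 0 <= mixed_volume (join_sets m A K) by apply: mv_ge0; exact: join_body.
(* If [Phi D] were 0, the radii would carry no information, but the bound on [v] is then 0. *)
have [PD|PD] := eqVneq (Phi D) 0; first by rewrite PD mulr0.
rewrite -(ler_pXn2r m0) ?nnegrE//; last by rewrite mulr_ge0// prodr_ge0.
apply: le_trans (mv_AF mn (join_body bA)); rewrite exprMn -prodrXl.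
rewrite -[X in _ * _ ^+ X <= _]card_ord -prodr_const -big_split /=.
rewrite le_eqVlt; apply/orP; left; apply/eqP; apply: eq_bigr => k _.
by rewrite powR_root ?ratio_ge0 ?divfK//; exact: bA.
Qed.

Variable f : 'rV[R]_n.+1 -> R.
Hypotheses (qf : QC0 f) (cf : compact_levels f).

Lemma level_body t : 0 < t <= 1 -> body (level f t).
Proof.
move=> /andP[t0 t1]; have [f0 uf cvf f01 f1] := qf; split; first exact: cf.
  by move=> x y Hx Hy l l01; apply: le_trans (cvf x y l l01); rewrite /= le_min Hx.
by exists 0; rewrite /level /= f01.
Qed.

Lemma level_gt1 t : 1 < t -> level f t = set0.
Proof.
move=> t1; have [_ _ _ _ f1] := qf; apply/seteqP; split=> // x /= tx.
by have := le_trans tx (f1 x); rewrite leNgt t1.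
Qed.

(** The levels [s k] increase to [t], so the compact parts of [level f (s k)] at distance at least
    [r] from [level f t] decrease to the empty set. The index [k.+2] keeps [s 0] positive. *)
Lemma level_shrink t r : 0 < t -> 0 < r -> exists2 s, 0 < s < t & level f s `<=` thick (level f t) r.
Proof.
move=> t0 r0; pose s k : R := t * (1 - k.+2%:R^-1).
have s01 k : 0 < s k < t.
  have k0 : 0 < (k.+2%:R^-1 : R) by rewrite invr_gt0.
  have k1 : (k.+2%:R^-1 : R) < 1 by rewrite invf_lt1// ltr1n.
  by rewrite /s mulr_gt0 ?subr_gt0//= gtr_pMr// gtrBl.
pose F := [set x : 'rV[R]_n.+1 | forall y, level f t y -> r <= `|x - y|].
have cF : closed F.
  rewrite (_ : F = \bigcap_(y in level f t) [set x | r <= `|x - y|]); last by [].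
  apply: closed_bigI => y _.
  apply: (@closed_comp _ _ (fun x : 'rV[R]_n.+1 => `|x - y|) [set z | r <= z]); last exact: closed_ge.
  move=> x _; apply: (@continuous_comp _ _ _ (fun x : 'rV[R]_n.+1 => x - y) (fun z => `|z|)).
    by apply: (@continuousB _ _ _ id (fun=> y)); [exact: id|exact: cst_continuous].
  exact: norm_continuous.
apply: contrapT => H.
have [||||x Hx] := @compact_decreasing_nonempty _ (fun k => level f (s k) `&` F).
- exact: norm_hausdorff.
- by move=> k; apply: compact_closedI => //; apply: cf; case/andP: (s01 k).
- move=> k x [Hx Fx]; split=> //; apply: le_trans Hx; rewrite /s ler_pM2l// lerB//.
  by rewrite lef_pV2 ?posrE// ler_nat.
- move=> k; apply: contrapT => Hk; apply: H; exists (s k) => // x Hx.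
  apply: contrapT => nx; apply: Hk; exists x; split=> // y ty; rewrite leNgt; apply/negP => xy.
  by apply: nx; exists y => //; exact: ltW.
have tx : level f t x.
  rewrite /level /= leNgt; apply/negP => fx.
  have /ltr_add_invr[k Hk] : 0 < (t - f x) / t by rewrite divr_gt0// subr_gt0.
  have [+ _] := Hx k I; rewrite /level /= leNgt => /negP; apply.
  rewrite add0r ltr_pdivlMr// in Hk.
  have : t * k.+2%:R^-1 <= k.+1%:R^-1 * t.
    by rewrite mulrC ler_pM2r// lef_pV2 ?posrE// ler_nat.
  rewrite /s; move: Hk; move: (k.+2%:R^-1) (k.+1%:R^-1) => c c'; lra.
by have [_ /(_ x tx)] := Hx 0%N I; rewrite subrr normr0 leNgt r0.
Qed.

Definition sym_levels x := [set 0] `|` [set t | 0 < t /\ sym_set m K (level f t) x].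

Lemma sym_levels_le1 x : ubound (sym_levels x) 1.
Proof.
move=> t [->|[t0 Hs]]; first exact: ler01.
rewrite leNgt; apply/negP => t1; move: Hs; rewrite /sym_set level_gt1//.
by case: asboolP.
Qed.

Lemma sym_levels_has_sup x : has_sup (sym_levels x).
Proof. by split; [exists 0; left|exists 1; exact: sym_levels_le1]. Qed.

Lemma sym_fun_ge0 x : 0 <= sym_fun m K f x.
Proof. by apply: ub_le_sup; [exists 1; exact: sym_levels_le1|left]. Qed.

Lemma sym_fun_le1 x : sym_fun m K f x <= 1.
Proof. by apply: ge_sup; [exists 0; left|exact: sym_levels_le1]. Qed.

Lemma sym_fun_level t : 0 < t <= 1 -> level (sym_fun m K f) t = sym_set m K (level f t).
Proof.
move=> t01; have /andP[t0 t1] := t01; have bt := level_body t01.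
apply/seteqP; split=> x; last first.
  by move=> Hx; apply: ub_le_sup; [exists 1; exact: sym_levels_le1|right].
rewrite /level /= => tx; rewrite sym_setE//; apply/(euclid_ball_root _ m0 (ratio_ge0 bt)).
set e := Num.sqrt _.
(* A supremum at least [t] only gives membership in the symmetrized levels below [t]; the level [t]
   itself needs the limit that follows. *)
have Hs s : 0 < s < t -> e ^+ m <= Phi (level f s) / Phi D.
  move=> /andP[s0 st].
  have [s' Es' ss'] := sup_gt (sym_levels_has_sup x).1 (lt_le_trans st tx).
  have s'1 := sym_levels_le1 Es'; case: Es' => [E|[s'0 Hs']]; first by move: ss'; rewrite E ltNge (ltW s0).
  have bs : body (level f s) by apply: level_body; rewrite s0 (le_trans (ltW st)).
  have bs' : body (level f s') by apply: level_body; rewrite s'0.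
  move: Hs'; rewrite sym_setE// => /(euclid_ball_root _ m0 (ratio_ge0 bs')) H; apply: le_trans H _.
  rewrite ler_wpM2r ?invr_ge0 ?Phi_ge0//; first exact: unit_ball_body.
  by apply: Phi_mono => // y /=; apply: le_trans; exact: ltW.
(* Division by [Phi D = 0] gives 0 at every level, so any level below [t] yields the bound. *)
have [PD|PD] := eqVneq (Phi D) 0.
  have := Hs (t / 2); rewrite PD invr0 !mulr0; apply; rewrite divr_gt0//=; lra.
have PD0 : 0 < Phi D by rewrite lt_neqAle eq_sym PD Phi_ge0//; exact: unit_ball_body.
rewrite ler_pdivlMr// leNgt; apply/negP => H.
pose eta := (e ^+ m * Phi D - Phi (level f t)) / 2.
have eta0 : 0 < eta by rewrite divr_gt0// subr_gt0.
have [r r0 Hr] := mv_continuous (join_body (fun i (_ : (i < m)%N) => bt)) eta0.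
have [s st Hst] := level_shrink t0 r0; have /andP[s0 s1] := st.
have bs : body (level f s) by apply: level_body; rewrite s0 (le_trans (ltW s1)).
have : Phi (level f s) <= Phi (level f t) + eta.
  apply: Hr; first exact: join_body.
    by move=> i; rewrite /join_sets; case: ifP => _ x' // /=; apply: le_trans; exact: ltW.
  move=> i; rewrite /join_sets; case: ifP => _ x' Kx; [exact: Hst|exists x' => //].
  by rewrite subrr normr0 ltW.
have := Hs s st; rewrite ler_pdivlMr// /eta; lra.
Qed.

End Symmetrization.

(** * Comparison of integrals and the passage to functions *)

Section IntegralMono.
Variable R : realType.

Lemma level_indic n (A : set 'rV[R]_n) (t : R) : 0 < t <= 1 -> level (\1_A) t = A.
Proof.
move=> /andP[t0 t1]; apply/seteqP; split=> x; rewrite /level /= indicE.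
  by case: (boolP (x \in A)) => [/set_mem//|_]; rewrite leNgt t0.
by move=> Ax; rewrite mem_set.
Qed.

(** The positive parts compare in one direction and the negative parts in the other. *)
Lemma le_integral_nomeas (d : measure_display) (T : measurableType d)
    (mu : {measure set T -> \bar R}) (D : set T) (f g : T -> \bar R) :
  (forall x, D x -> f x <= g x)%E -> (\int[mu]_(x in D) f x <= \int[mu]_(x in D) g x)%E.
Proof.
move=> fg; rewrite (integral_mkcond D f) (integral_mkcond D g).
have {}fg x : ((f \_ D) x <= (g \_ D) x)%E.
  by rewrite /patch; case: ifP => // /set_mem; exact: fg.
rewrite (integralE _ _ (f \_ D)) (integralE _ _ (g \_ D)); apply: leeB.
  apply: le_integralT => x; first exact: funepos_ge0.
  by rewrite !funeposE ge_max !le_max fg lexx orbT.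
apply: le_integralT => x; first exact: funeneg_ge0.
by rewrite !funenegE ge_max !le_max leeN2 fg lexx orbT.
Qed.

End IntegralMono.

Theorem theorem3p8 (R : realType) (n m : nat) (K : nat -> set 'rV[R]_n) :
  (1 <= m <= n)%N ->
  (forall j, (j < n - m)%N -> cc_set (K j) /\ (interior (K j) !=set0)) ->
  (forall A : nat -> set 'rV[R]_n,
     (forall i, (i < m)%N -> cc_set (A i) /\ (A i !=set0)) ->
     mixed_volume (join_sets m (fun i => sym_set m K (A i)) K)
       <= mixed_volume (join_sets m A K))
  /\
  (forall f : nat -> 'rV[R]_n -> R,
     (forall i, (i < m)%N -> QC0 (f i) /\ compact_levels (f i)) ->
     (mixed_integral (join_funs m (fun i => sym_fun m K (f i))
                                  (fun j => \1_(K j)))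
       <= mixed_integral (join_funs m f (fun j => \1_(K j))))%E).
Proof.
case: n K => [|n'] K /andP[m0 mn]; first by have := leq_trans m0 mn.
move=> HK; have bK j : (j < n'.+1 - m)%N -> body (K j).
  move=> jm; have [[cK vK] [x Kx]] := HK j jm; split=> //; exists x; exact: interior_subset Kx.
have part1 A : (forall i, (i < m)%N -> cc_set (A i) /\ A i !=set0) ->
    mixed_volume (join_sets m (fun i => sym_set m K (A i)) K) <= mixed_volume (join_sets m A K).
  by move=> HA; apply: mixed_volume_sym_le => // i /HA[[cA vA] A0].
split=> [A HA|f Hf]; first exact: part1.
apply: le_integral_nomeas => t /=.
rewrite in_itv /= andbT => t0; rewrite lee_fin.
have lvl F G : (fun i : 'I_n'.+1 => level (join_funs m F G i) t) =
    join_sets m (fun i => level (F i) t) (fun j => level (G j) t).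
  by apply/funext => i; rewrite /join_funs /join_sets; case: ifP.
rewrite !lvl.
have [t1|t1] := ltP 1 t.
  (* Above height 1 the slot 0 is empty, as [m] is positive, and the mixed volume is 0 by
     convention. *)
  have E F : (forall i, (i < m)%N -> level (F i) t = set0) ->
      mixed_volume (join_sets m (fun i => level (F i) t) (fun j => level (\1_(K j)) t)) = 0 :> R.
    move=> HF; rewrite /mixed_volume; case: asboolP => // -[]; exists ord0.
    by rewrite /join_sets m0 HF.
  rewrite !E// => i /Hf[qf cf]; first exact: level_gt1.
  apply/seteqP; split=> // x; rewrite /level /= leNgt => /negP; apply.
  exact: le_lt_trans (sym_fun_le1 _ _ qf x) t1.
(* At [t = 0] the level sets of the functions are the whole space, not convex bodies; both
   integrands are then equal because their arguments are. *)
move: t0; rewrite le_eqVlt => /orP[/eqP <-|t0].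
  suff -> : join_sets m (fun i => level (sym_fun m K (f i)) 0) (fun j => level (\1_(K j)) 0) =
     join_sets m (fun i => level (f i) 0) (fun j => level (\1_(K j)) 0) :> ('I_n'.+1 -> _) by [].
  apply/funext => i; rewrite /join_sets; case: ifP => // im; have [qf _] := Hf i im.
  apply/seteqP; split=> x _; rewrite /level /=; first by case: qf.
  exact: sym_fun_ge0.
have t01 : 0 < t <= 1 by rewrite t0.
have -> : join_sets m (fun i => level (sym_fun m K (f i)) t) (fun j => level (\1_(K j)) t) =
   join_sets m (fun i => sym_set m K (level (f i) t)) K :> ('I_n'.+1 -> _).
  apply/funext => i; rewrite /join_sets; case: ifP => [im|_].
    by have [qf cf] := Hf i im; exact: sym_fun_level.
  exact: level_indic.
have -> : join_sets m (fun i => level (f i) t) (fun j => level (\1_(K j)) t) =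
   join_sets m (fun i => level (f i) t) K :> ('I_n'.+1 -> _).
  by apply/funext => i; rewrite /join_sets; case: ifP => // _; exact: level_indic.
apply: mixed_volume_sym_le => // i im; have [qf cf] := Hf i im.
exact: level_body.
Qed.
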